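(* Let $k,\alpha>0$, $\gamma,\omega\in\mathbb{R}$, $\mu\in(0,1)$ with $\mu<k$, and $\nu\in[0,1]$. Let $f\in AC^{1}[0,b]$ for every $b>0$ be such that the Laplace transforms of $f$ and of the regularized $k$-Hilfer-Prabhakar derivative ${}_{k}^{C}\mathcal{D}_{\alpha,\omega,0^{+}}^{\gamma,\mu,\nu}f$ exist, and let $F(u)=\mathcal{L}[f](u)$. Then, for $u$ with $\left|\omega k(ku)^{-\alpha/k}\right|<1$, $$\mathcal{L}\big({}_{k}^{C}\mathcal{D}_{\alpha,\omega,0^{+}}^{\gamma,\mu,\nu}f(t)\big)(u)=(ku)^{\frac{\mu}{k}}\Big(1-\omega k(ku)^{-\frac{\alpha}{k}}\Big)^{\frac{\gamma}{k}}F(u)-k(ku)^{-\frac{k-\mu}{k}}\Big(1-\omega k(ku)^{-\frac{\alpha}{k}}\Big)^{\frac{\gamma}{k}}f(0^{+}).$$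
   Context: The Laplace transform is $\mathcal{L}[f](u)=\int_0^\infty e^{-ut}f(t)\,dt$ (when the integral exists; $\operatorname{Re}u>0$). Complex powers are principal branches. $AC^{1}[0,b]$ is the set of real-valued absolutely continuous functions on $[0,b]$. The $k$-gamma function is $\Gamma_k(z)=\int_0^\infty e^{-t^k/k}t^{z-1}\,dt$ for $\operatorname{Re}z>0$, and the $k$-Pochhammer symbol is $(\gamma)_{n,k}=\gamma(\gamma+k)\cdots(\gamma+(n-1)k)$, $(\gamma)_{0,k}=1$. The $k$-Mittag-Leffler function is $E_{k,\alpha,\mu}^{\gamma}(z)=\sum_{n=0}^\infty \frac{(\gamma)_{n,k}}{\Gamma_k(\alpha n+\mu)}\frac{z^n}{n!}$. The $k$-Prabhakar integral (for $\operatorname{Re}\alpha,\operatorname{Re}\mu>0$) is $$\big({}_{k}P_{\alpha,\mu,\omega}^{\gamma}f\big)(x)=\big({}_{k}P_{\alpha,\mu,\omega,0^+}^{\gamma}f\big)(x)=\int_0^x\frac{(x-t)^{\frac{\mu}{k}-1}}{k}E_{k,\alpha,\mu}^{\gamma}\big[\omega(x-t)^{\frac{\alpha}{k}}\big]f(t)\,dt ,$$ with the convention that ${}_{k}P_{\alpha,0,\omega}^{0}$ is the identity. The regularized $k$-Hilfer-Prabhakar fractional derivative is $${}_{k}^{C}\mathcal{D}_{\alpha,\omega,0^{+}}^{\gamma,\mu,\nu}f(t)=k\Big({}_{k}P_{\alpha,\nu(k-\mu),\omega,0^{+}}^{-\gamma\nu}\,{}_{k}P_{\alpha,(1-\nu)(k-\mu),\omega,0^{+}}^{-\gamma(1-\nu)}\frac{d}{dt}f\Big)(t),$$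 which also equals $k\big({}_{k}P_{\alpha,k-\mu,\omega,0^{+}}^{-\gamma}\frac{d}{dt}f\big)(t)$. *)

(* Defs.v *)
From HB Require Import structures.
From mathcomp Require Import all_boot all_order all_algebra.
From mathcomp Require Import all_classical all_reals all_analysis.
From mathcomp Require Export complex.

Set Implicit Arguments.
Unset Strict Implicit.
Unset Printing Implicit Defensive.

Import Order.TTheory GRing.Theory Num.Theory.
Import numFieldNormedType.Exports.

Local Open Scope classical_set_scope.
Local Open Scope ring_scope.
Local Open Scope complex_scope.

Section ComplexFunctions.
Context {R : realType}.
Implicit Types (z w u : R[i]).

Definition expC z : R[i] :=
  (expR (complex.Re z) * cos (complex.Im z))
    +i* (expR (complex.Re z) * sin (complex.Im z)).

(* Principal argument, with values in ]-pi, pi]. *)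
Definition argC z : R :=
  let r := complex.Re z / complex.Re `|z| in
  if 0 <= complex.Im z then acos r else - acos r.

Definition logC z : R[i] := ln (complex.Re `|z|) +i* argC z.

(* Principal branch; only meaningful for z != 0. *)
Definition powC z w : R[i] := expC (w * logC z).

Definition integralC (D : set R) (g : R -> R[i]) : R[i] :=
  (\int[lebesgue_measure]_(t in D) complex.Re (g t))
    +i* (\int[lebesgue_measure]_(t in D) complex.Im (g t)).

End ComplexFunctions.

Section LaplaceTransform.
Context {R : realType}.
Implicit Types (f : R -> R) (u : R[i]).

Definition laplace_partial f u (T : R) : R[i] :=
  integralC `[0, T] (fun t => expC (- (u * t%:C)) * (f t)%:C).

(* The integral over [0, +oo[ is a Lebesgue integral on every [0, T] and is
   improper at +oo, so absolute convergence is not required. *)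
Definition laplace_exists f u : Prop :=
  [/\ forall T : R,
        (@lebesgue_measure R).-integrable `[0, T] (fun t => (f t)%:E),
      cvg (complex.Re (laplace_partial f u T) @[T --> +oo]) &
      cvg (complex.Im (laplace_partial f u T) @[T --> +oo])].

Definition laplace f u : R[i] :=
  lim (complex.Re (laplace_partial f u T) @[T --> +oo])
    +i* lim (complex.Im (laplace_partial f u T) @[T --> +oo]).

End LaplaceTransform.

Section KHilferPrabhakar.
Context {R : realType}.
Implicit Types (f : R -> R) (a b k alpha mu nu omega gam x z : R).

Definition abs_continuous a b f : Prop :=
  forall e : R, 0 < e -> exists2 d : R, 0 < d &
    forall (n : nat) (A B : 'I_n -> R),
      (forall i, [/\ a <= A i, A i <= B i & B i <= b]) ->
      trivIset [set: 'I_n] (fun i => `]A i, B i[%classic) ->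
      \sum_(i < n) (B i - A i) < d ->
      \sum_(i < n) `|f (B i) - f (A i)| < e.

Definition kGamma k z : R :=
  \int[lebesgue_measure]_(t in `[0, +oo[)
    (expR (- (t `^ k / k)) * t `^ (z - 1)).

Definition kPochhammer k gam (n : nat) : R := \prod_(i < n) (gam + i%:R * k).

Definition kMittagLeffler k alpha mu gam z : R :=
  limn (series (fun n : nat =>
    kPochhammer k gam n / kGamma k (alpha * n%:R + mu) * (z ^+ n / n`!%:R))).

(* The first branch is the convention that the operator with mu = gam = 0 is
   the identity. *)
Definition kPrabhakar k alpha mu omega gam f x : R :=
  if (mu == 0) && (gam == 0) then f x else
  \int[lebesgue_measure]_(t in `[0, x])
    ((x - t) `^ (mu / k - 1) / k
     * kMittagLeffler k alpha mu gam (omega * (x - t) `^ (alpha / k)) * f t).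

(* [derive1 f] has an arbitrary value where [f] is not derivable; for absolutely
   continuous [f] this only concerns a null set, which the integrals ignore. *)
Definition regularized_kHilferPrabhakar k alpha mu nu omega gam f x : R :=
  k * kPrabhakar k alpha (nu * (k - mu)) omega (- gam * nu)
        (kPrabhakar k alpha ((1 - nu) * (k - mu)) omega (- gam * (1 - nu))
           (derive1 f)) x.

End KHilferPrabhakar.

(* Main.v *)
Require Import Defs.
From HB Require Import structures.
From mathcomp Require Import all_boot all_order all_algebra.
From mathcomp Require Import all_classical all_reals all_analysis.
From mathcomp Require Import measurable_realfun ring lra.

(** Let H and H' be the partial Laplace integrals at u of f and of the derivative
    D = k P1 P2 f', where P1 and P2 are the two Prabhakar integrals; both are
    bounded functions of T with limits L[f](u) and L[D](u). Formally D is a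
    convolution of f' with two kernels, and the formula is the convolution theorem.
    The transforms exist only as improper integrals at the single point u, however,
    so the proof takes place on the ray y u, y > 1, and returns to y = 1 at the end.

    Large y. f is the primitive of its derivative: absolute continuity gives a
    bounded variation, a Jordan decomposition, Stieltjes measures without singular
    part and hence a density ([ac_primitive]). The primitive of f is of exponential
    order even if f is not, and its Laplace integral at s is, up to the factor
    (s - u) / s, that of the bounded function H at s - u
    ([lap_primitive_improper]); likewise for D and H'. Primitives commute with P1
    and P2, so that two integrations turn D = k P1 P2 f' into a relation between
    absolutely convergent Laplace integrals. With p = (y - 1) u it reads
      p lap H' p = M(y) (y u p lap H p - f(0))
    where M(y) is k times the product of the transforms of the two kernels
    ([transform_identity]). These transforms are computed term by term
    ([lap_kPrabhakar_kernel]): the powers of t have transforms given by the Gamma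
    integral ([lap_gpow]) and the resulting series is binomial
    ([binomial_series]).

    All y > 1. Both sides of the identity are real-analytic in y: lap H p because H
    is bounded, M because on the ray it is itself a Laplace transform in y of a
    series with complex coefficients ([symbol_laplace]). The radius of analyticity
    is proportional to y - 1, which suffices to carry the identity from large y to
    all y > 1 ([analytic_continuation]).

    y -> 1. By Abel's theorem along the ray ([lap_abel]) p lap H p and p lap H' p
    tend to L[f](u) and L[D](u), and M is continuous at 1 since the convergence
    condition on u is strict. The limit of the identity is
      L[D](u) = M(1) (u L[f](u) - f(0)),
    which is the claim after collecting the powers of k u. *)

Set Implicit Arguments.
Unset Strict Implicit.
Unset Printing Implicit Defensive.

Import Order.TTheory GRing.Theory Num.Theory.
Import numFieldNormedType.Exports.

Local Open Scope classical_set_scope.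
Local Open Scope ring_scope.
Local Open Scope complex_scope.

(** * Complex numbers: modulus, exponential, convergence *)

Notation normC := ComplexField.Normc.normc.

Section ComplexNumbers.
Context {R : realType}.
Implicit Types (z w : R[i]) (x y : R).

Lemma Re_norm z : complex.Re `|z| = normC z.
Proof. by case: z. Qed.

Lemma normCE z : normC z = Num.sqrt (complex.Re z ^+ 2 + complex.Im z ^+ 2).
Proof. by case: z. Qed.

Lemma cReD z w : complex.Re (z + w) = complex.Re z + complex.Re w.
Proof. by case: z w => [a b] [c d]. Qed.

Lemma cImD z w : complex.Im (z + w) = complex.Im z + complex.Im w.
Proof. by case: z w => [a b] [c d]. Qed.

Lemma cReN z : complex.Re (- z) = - complex.Re z.
Proof. by case: z. Qed.

Lemma cImN z : complex.Im (- z) = - complex.Im z.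
Proof. by case: z. Qed.

Lemma cReM z w : complex.Re (z * w) =
  complex.Re z * complex.Re w - complex.Im z * complex.Im w.
Proof. by case: z w => [a b] [c d]. Qed.

Lemma cImM z w : complex.Im (z * w) =
  complex.Re z * complex.Im w + complex.Im z * complex.Re w.
Proof. by case: z w => [a b] [c d]. Qed.

Definition ReImE := (cReD, cImD, cReN, cImN, cReM, cImM).

Lemma cplx_eq z w : complex.Re z = complex.Re w -> complex.Im z = complex.Im w ->
  z = w.
Proof. by case: z w => [a b] [c d] /= -> ->. Qed.

Lemma Re_sum (I : Type) (r : seq I) (P : pred I) (F : I -> R[i]) :
  complex.Re (\sum_(i <- r | P i) F i) = \sum_(i <- r | P i) complex.Re (F i).
Proof. exact: (big_morph _ cReD). Qed.

Lemma Im_sum (I : Type) (r : seq I) (P : pred I) (F : I -> R[i]) :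
  complex.Im (\sum_(i <- r | P i) F i) = \sum_(i <- r | P i) complex.Im (F i).
Proof. exact: (big_morph _ cImD). Qed.

Lemma normC_ge0 z : 0 <= normC z.
Proof. by rewrite normCE sqrtr_ge0. Qed.

Lemma normC0 : normC (0 : R[i]) = 0.
Proof. exact: ComplexField.Normc.normc0. Qed.

Lemma normC1 : normC (1 : R[i]) = 1.
Proof. exact: ComplexField.Normc.normc1. Qed.

Lemma normC_eq0 z : (normC z == 0) = (z == 0).
Proof.
apply/eqP/eqP => [/ComplexField.Normc.eq0_normc //|->]; exact: normC0.
Qed.

Lemma normC_gt0 z : (0 < normC z) = (z != 0).
Proof. by rewrite lt_def normC_ge0 andbT normC_eq0. Qed.

Lemma normCM z w : normC (z * w) = normC z * normC w.
Proof. exact: ComplexField.Normc.normcM. Qed.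

Lemma normCV z : normC z^-1 = (normC z)^-1.
Proof. exact: ComplexField.Normc.normcV. Qed.

Lemma normCX z n : normC (z ^+ n) = normC z ^+ n.
Proof.
by elim: n => [|n IH]; rewrite ?expr0 ?normC1// !exprS normCM IH.
Qed.

Lemma normC_real x : normC x%:C = `|x|.
Proof. by rewrite /= expr0n/= addr0 sqrtr_sqr. Qed.

Lemma normC_le1 z w : normC (z + w) <= normC z + normC w.
Proof.
have := ler_normD z w.
by rewrite lecE -!Re_norm => /andP[_]; rewrite cReD.
Qed.

Lemma normCN z : normC (- z) = normC z.
Proof. by rewrite !normCE !ReImE !sqrrN. Qed.

Lemma normC_sum (I : Type) (r : seq I) (P : pred I) (F : I -> R[i]) :
  normC (\sum_(i <- r | P i) F i) <= \sum_(i <- r | P i) normC (F i).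
Proof.
elim/big_ind2 : _ => [|x1 x2 y1 y2 h1 h2|//]; first by rewrite normC0.
by rewrite (le_trans (normC_le1 _ _))// lerD.
Qed.

Lemma normr_Re z : `|complex.Re z| <= normC z.
Proof.
rewrite normCE -(@ler_pXn2r _ 2)// ?nnegrE ?sqrtr_ge0//.
by rewrite sqr_sqrtr ?addr_ge0 ?sqr_ge0// real_normK ?num_real// lerDl sqr_ge0.
Qed.

Lemma normr_Im z : `|complex.Im z| <= normC z.
Proof.
rewrite normCE -(@ler_pXn2r _ 2)// ?nnegrE ?sqrtr_ge0//.
by rewrite sqr_sqrtr ?addr_ge0 ?sqr_ge0// real_normK ?num_real// lerDr sqr_ge0.
Qed.

Lemma normC_le_ReIm z : normC z <= `|complex.Re z| + `|complex.Im z|.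
Proof.
rewrite normCE -(@ler_pXn2r _ 2)// ?nnegrE ?sqrtr_ge0// ?addr_ge0//.
rewrite sqr_sqrtr ?addr_ge0 ?sqr_ge0// sqrrD !real_normK ?num_real//.
by rewrite lerD2r lerDl mulrn_wge0// mulr_ge0.
Qed.

Lemma expC0 : expC 0 = 1 :> R[i].
Proof. by rewrite /expC/= expR0 cos0 sin0 mulr1 mulr0. Qed.

Lemma expCD z w : expC (z + w) = expC z * expC w.
Proof.
apply: cplx_eq; rewrite /expC !ReImE/= expRD ?cosD ?sinD; ring.
Qed.

Lemma normC_expC z : normC (expC z) = expR (complex.Re z).
Proof.
rewrite normCE /= !exprMn -mulrDr cos2Dsin2 mulr1 sqrtr_sqr.
by rewrite ger0_norm// expR_ge0.
Qed.

Lemma expC_neq0 z : expC z != 0.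
Proof. by rewrite -normC_eq0 normC_expC gt_eqF// expR_gt0. Qed.

Lemma expCN z : expC (- z) = (expC z)^-1.
Proof.
by apply: (mulfI (expC_neq0 z)); rewrite -expCD subrr expC0 divff// expC_neq0.
Qed.

Lemma expC_real x : expC x%:C = (expR x)%:C.
Proof. by rewrite /expC/= cos0 sin0 mulr1 mulr0. Qed.

End ComplexNumbers.

(** Componentwise convergence, since the Laplace transform is defined through
    the limits of the two components. *)
Definition cvgC {R : realType} {T : Type} (F : set_system T) (g : T -> R[i])
    (l : R[i]) : Prop :=
  (complex.Re (g x) @[x --> F] --> complex.Re l) /\
  (complex.Im (g x) @[x --> F] --> complex.Im l).

Section ComplexConvergence.
Context {R : realType} {T : Type} {F : set_system T} {FF : ProperFilter F}.
Implicit Types (g h : T -> R[i]) (l m : R[i]).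

Lemma cvgC_cst l : cvgC F (fun=> l) l.
Proof. by split; exact: cvg_cst. Qed.

Lemma cvgCD g h l m : cvgC F g l -> cvgC F h m ->
  cvgC F (fun x => g x + h x) (l + m).
Proof.
move=> [gr gi] [hr hi]; split; rewrite ?cReD ?cImD.
- by under eq_fun do rewrite cReD; exact: cvgD.
- by under eq_fun do rewrite cImD; exact: cvgD.
Qed.

Lemma cvgCN g l : cvgC F g l -> cvgC F (fun x => - g x) (- l).
Proof.
move=> [gr gi]; split; rewrite ?cReN ?cImN.
- by under eq_fun do rewrite cReN; exact: cvgN.
- by under eq_fun do rewrite cImN; exact: cvgN.
Qed.

Lemma cvgCM g h l m : cvgC F g l -> cvgC F h m ->
  cvgC F (fun x => g x * h x) (l * m).
Proof.
move=> [gr gi] [hr hi]; split; rewrite ?cReM ?cImM.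
- by under eq_fun do rewrite cReM; apply: cvgB; exact: cvgM.
- by under eq_fun do rewrite cImM; apply: cvgD; exact: cvgM.
Qed.

Lemma cvgC_unique g l m : cvgC F g l -> cvgC F g m -> l = m.
Proof.
by move=> [gr gi] [hr hi]; apply: cplx_eq; [exact: cvg_unique gr hr |
  exact: cvg_unique gi hi].
Qed.

End ComplexConvergence.

(** * Real power series and continuation along a half-line *)

Section PowerSeries.
Context {R : realType}.
Implicit Types (a b : nat -> R) (r x y : R).

(** Bounded terms at radius r. By Abel's lemma this means a radius of
    convergence at least r, in a form that passes easily to derivatives. *)
Definition rad a r := exists C : R, forall n, `|a n| * r ^+ n <= C.

Lemma rad_cvg a r : rad a r -> forall x, `|x| < r -> cvgn (pseries a x).
Proof.
move=> [C aC] x xr; apply: normed_cvg.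
have r0 : 0 < r by rewrite (le_lt_trans _ xr).
apply: (@series_le_cvg _ _ (geometric C (`|x| / r))) => [n|n|n|].
- by rewrite /=.
- rewrite /= mulr_ge0 ?exprn_ge0 ?divr_ge0 ?(ltW r0)//.
  by rewrite (le_trans _ (aC 0%N))// mulr_ge0// exprn_ge0// ltW.
- rewrite /= normrM normrX expr_div_n mulrCA [leLHS]mulrC ler_wpM2l ?exprn_ge0//.
  by rewrite ler_pdivlMr ?exprn_gt0.
- apply: is_cvg_geometric_series.
  by rewrite normrM normfV normr_id (gtr0_norm r0) ltr_pdivrMr// mul1r.
Qed.

Lemma cvg_rad a x : cvgn (pseries a x) -> rad a `|x|.
Proof.
move=> /cvg_series_bounded [K [_ KP]].
exists (K + 1) => n; rewrite -normrX -normrM.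
by apply: KP => //; rewrite ltrDl.
Qed.

Lemma nat_geometric (q : R) : 1 < q -> exists C : R,
  forall n : nat, n%:R <= C * q ^+ n.
Proof.
move=> q1; exists (q - 1)^-1 => n.
have q0 : 0 < q - 1 by rewrite subr_gt0.
rewrite -ler_pdivrMl ?invr_gt0// invrK.
have : 1 + n%:R * (q - 1) <= q ^+ n.
  elim: n => [|n IH]; first by rewrite mul0r addr0.
  rewrite exprS -nat1r; have h : 0 <= n%:R :> R by [].
  have : 0 <= q * (q ^+ n - (1 + n%:R * (q - 1))).
    by rewrite mulr_ge0 ?subr_ge0//; lra.
  have h2 : 0 <= n%:R * (q - 1) by rewrite mulr_ge0// ltW.
  have h3 : 0 <= n%:R * (q - 1) * (q - 1) by rewrite mulr_ge0// ltW.
  rewrite mulrBr; lra.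
by move=> h; rewrite mulrC; lra.
Qed.

Lemma rad_diffs a r r' : 0 < r' < r -> rad a r -> rad (pseries_diffs a) r'.
Proof.
move=> /andP[r'0 rr'] [C aC]; have r0 := lt_trans r'0 rr'.
have q1 : 1 < r / r' by rewrite ltr_pdivlMr// mul1r.
have [D DP] := nat_geometric q1.
exists (D * C / r') => n; rewrite /pseries_diffs normrM normr_nat.
have := DP n.+1; rewrite expr_div_n mulrA ler_pdivlMr ?exprn_gt0// => H.
rewrite ler_pdivlMr// -mulrA -exprSr mulrAC.
have C0 : 0 <= C by rewrite (le_trans _ (aC 0%N))// mulr_ge0// exprn_ge0// ltW.
have D0 : 0 <= D * r ^+ n.+1.
  by rewrite (le_trans _ H)// mulr_ge0// exprn_ge0// ltW.
have {D0} D0 : 0 <= D by rewrite -(pmulr_lge0 _ (exprn_gt0 n.+1 r0)).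
rewrite (le_trans (ler_wpM2r (normr_ge0 _) H))//.
by rewrite -mulrA ler_wpM2l// mulrC.
Qed.

Lemma rad_is_derive a r x : rad a r -> `|x| < r ->
  is_derive x (1 : R) (fun x => limn (pseries a x))
    (limn (pseries (pseries_diffs a) x)).
Proof.
move=> ar xr.
pose m y z : R := (y + z) / 2.
have mP y z : y < z -> y < m y z < z by rewrite /m => ?; apply/andP; split; lra.
have /andP[h1 h1'] := mP _ _ xr; set r1 := m _ _ in h1 h1'.
have /andP[h2 h2'] := mP _ _ h1'; set r2 := m _ _ in h2 h2'.
have /andP[h3 h3'] := mP _ _ h2'; set r3 := m _ _ in h3 h3'.
have r10 : 0 < r1 by rewrite (le_lt_trans _ h1).
have r20 : 0 < r2 by rewrite (lt_trans _ h2).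
have r30 : 0 < r3 by rewrite (lt_trans _ h3).
have d1 : rad (pseries_diffs a) r3 by apply: rad_diffs ar; rewrite r30.
have d2 : rad (pseries_diffs (pseries_diffs a)) r2.
  by apply: rad_diffs d1; rewrite r20.
have nr1 : `|r1| = r1 by rewrite gtr0_norm.
apply: (@pseries_snd_diffs _ a r1).
- by apply: rad_cvg ar _ _; rewrite nr1.
- by apply: rad_cvg d1 _ _; rewrite nr1 (lt_trans h2).
- by apply: rad_cvg d2 _ _; rewrite nr1.
- by rewrite nr1.
Qed.

Lemma nonincr_bounded (t : nat -> R) J : (forall n, 0 <= t n) ->
  (forall n, (J <= n)%N -> t n.+1 <= t n) -> exists C, forall n, t n <= C.
Proof.
move=> t0 tJ; exists (\sum_(i < J.+1) t i) => n.
have tle m : (m <= J)%N -> t m <= \sum_(i < J.+1) t i.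
  move=> mJ; rewrite -ltnS in mJ.
  by rewrite (bigD1 (Ordinal mJ))//= lerDl sumr_ge0.
have [/tle//|Jn] := leqP n J.
rewrite (le_trans _ (tle _ (leqnn J)))//.
rewrite -(subnK (ltnW Jn)); elim: (n - J)%N => [|k IH]//.
by rewrite addSn (le_trans _ IH)// tJ// leq_addl.
Qed.

Lemma sum_geometric_le (q : R) N M : 0 <= q < 1 ->
  \sum_(N <= i < M) q ^+ i <= q ^+ N / (1 - q).
Proof.
move=> /andP[q0 q1]; have q1' : 0 < 1 - q by rewrite subr_gt0.
have [NM|MN] := leqP N M; last first.
  by rewrite big_geq ?(ltnW MN)// divr_ge0 ?exprn_ge0// ltW.
suff -> : \sum_(N <= i < M) q ^+ i = (q ^+ N - q ^+ M) / (1 - q).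
  by rewrite ler_pdivrMr// divfK ?gt_eqF// gerBl exprn_ge0.
have q1n : 1 - q != 0 by rewrite gt_eqF.
apply: (mulIf q1n); rewrite divfK//; apply/eqP; rewrite eq_sym.
rewrite [X in X == _](_ : _ = - q ^+ M - - q ^+ N); last by rewrite opprK addrC.
rewrite -(telescope_sumr (fun i => - q ^+ i) NM).
rewrite mulr_suml; apply/eqP/eq_bigr => i _.
by rewrite exprS; ring.
Qed.

(** By strong induction: once the earlier coefficients vanish, the term of
    degree n is the opposite of a tail of order n.+1 in x; dividing by the
    n-th power of x and letting x tend to 0 gives 0. *)
Lemma pseries_eq0 a r : 0 < r ->
  (forall x, 0 < x < r -> pseries a x @ \oo --> 0) -> forall n, a n = 0.
Proof.
move=> r0 a0.
have r20 : 0 < r / 2 by rewrite divr_gt0.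
have [C aC] : rad a (r / 2).
  rewrite -(gtr0_norm r20); apply: cvg_rad; apply/cvg_ex; exists 0.
  by apply: a0; rewrite r20 /=; lra.
set s := r / 2 in aC r20.
have C0 : 0 <= C by rewrite (le_trans _ (aC 0%N))// mulr_ge0// exprn_ge0// ltW.
elim/ltn_ind => n IH; apply/eqP; rewrite -normr_le0; apply/ler_addgt0Pl => e e0.
rewrite addr0.
pose D : R := 2 * C / s ^+ n.+1.
have D0 : 0 <= D by rewrite divr_ge0 ?mulr_ge0// exprn_ge0// ltW.
pose x := Num.min (s / 2) (e / (D + 1)).
have x0 : 0 < x by rewrite lt_min !divr_gt0// ltr_wpDl.
have xs : x <= s / 2 by rewrite ge_min lexx.
have xe : D * x <= e.
  rewrite (@le_trans _ _ ((D + 1) * x))//; first by rewrite ler_wpM2r ?(ltW x0)// lerDl.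
  by rewrite -ler_pdivlMl ?ltr_wpDl// mulrC ge_min lexx orbT.
apply: le_trans xe.
have q1 : x / s <= 1 / 2 by rewrite ler_pdivrMr// mul1r mulrC.
have q0 : 0 <= x / s by rewrite divr_ge0// ltW.
have ax : pseries a x @ \oo --> 0.
  by apply: a0; rewrite x0 /=; move: xs r20 r0; rewrite /s; lra.
suff bnd : `|a n * x ^+ n| <= 2 * C * (x / s) ^+ n.+1.
  rewrite normrM normrX (gtr0_norm x0) in bnd.
  rewrite -(ler_pM2r (exprn_gt0 n x0)) (le_trans bnd)//.
  by rewrite /D expr_div_n -[leRHS]mulrA -exprS mulrA -!mulrA [_^-1 * _]mulrC lexx.
have -> : `|a n * x ^+ n| = `|0 - a n * x ^+ n| by rewrite sub0r normrN.
have cv : `|pseries a x m - a n * x ^+ n| @[m --> \oo] --> `|0 - a n * x ^+ n|.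
  by apply: cvg_norm; apply: cvgB => //; exact: cvg_cst.
apply: (cvgr_to_le cv); near=> m.
have nm : (n < m)%N by near: m; exact: nbhs_infty_gt.
rewrite /pseries /series /= (big_cat_nat _ (n := n.+1))//=.
rewrite big_nat_recr//= big_nat big1 ?add0r; last first.
  by move=> i ni; rewrite IH// mul0r.
rewrite [X in `|X|]addrAC subrr add0r.
rewrite (le_trans (ler_norm_sum _ _ _))//.
have H i : `|a i * x ^+ i| <= C * (x / s) ^+ i.
  rewrite normrM normrX (gtr0_norm x0) expr_div_n mulrA ler_pdivlMr ?exprn_gt0//.
  by rewrite mulrAC ler_wpM2r ?exprn_ge0// ltW.
rewrite (le_trans (ler_sum _ (fun i _ => H i)))// -mulr_sumr.
rewrite -mulrA mulrCA ler_wpM2l//.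
rewrite (le_trans (sum_geometric_le _ _ _))//; first by rewrite q0 (le_lt_trans q1)//; lra.
rewrite mulrC ler_wpM2r ?exprn_ge0//.
by rewrite invf_ple ?posrE ?subr_gt0//; [move: q1; lra|move: q1; lra].
Unshelve. all: by end_near. Qed.

Definition cauchy_prod a b n := \sum_(i < n.+1) a i * b (n - i)%N.

(** The product of the partial sums, computed as polynomials, differs from the
    partial sum of the Cauchy product by terms of degree at least N, dominated
    by a geometric tail because both series have bounded terms at a slightly
    larger radius. *)
Lemma cauchy_prodP a b r x (A B : R) : (forall x, `|x| < r -> cvgn (pseries a x)) ->
  (forall x, `|x| < r -> cvgn (pseries b x)) -> `|x| < r ->
  pseries a x @ \oo --> A -> pseries b x @ \oo --> B ->
  pseries (cauchy_prod a b) x @ \oo --> A * B.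
Proof.
move=> ar br xr aA bB.
pose m y z : R := (y + z) / 2.
have mP y z : y < z -> y < m y z < z by rewrite /m => ?; apply/andP; split; lra.
have /andP[h1 h1'] := mP _ _ xr; set r1 := m _ _ in h1 h1'.
have /andP[h2 h2'] := mP _ _ h1'; set r2 := m _ _ in h2 h2'.
have r10 : 0 < r1 by rewrite (le_lt_trans _ h1).
have r20 : 0 < r2 by rewrite (lt_trans _ h2).
clearbody r2; clearbody r1; clear m mP.
have [C aC] : rad a r2 by rewrite -(gtr0_norm r20); apply/cvg_rad/ar; rewrite gtr0_norm.
have [D bD] : rad b r2 by rewrite -(gtr0_norm r20); apply/cvg_rad/br; rewrite gtr0_norm.
have C0 : 0 <= C by rewrite (le_trans _ (aC 0%N))// mulr_ge0// exprn_ge0// ltW.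
have D0 : 0 <= D by rewrite (le_trans _ (bD 0%N))// mulr_ge0// exprn_ge0// ltW.
have q1 : 1 < r2 / r1 by rewrite ltr_pdivlMr// mul1r.
have [E EP] := nat_geometric q1.
pose P N := \poly_(i < N) a i; pose Q N := \poly_(i < N) b i.
have PE N : (P N).[x] = pseries a x N.
  by rewrite horner_poly /pseries /series/= big_mkord.
have QE N : (Q N).[x] = pseries b x N.
  by rewrite horner_poly /pseries /series/= big_mkord.
have PQE N : (P N * Q N).[x] = pseries (cauchy_prod a b) x N +
    \sum_(N <= n < N + N) (P N * Q N)`_n * x ^+ n.
  rewrite (@horner_coef_wide _ (N + N)); last first.
    by rewrite (leq_trans (size_polyMleq _ _))// (leq_trans (leq_pred _))//
      leq_add// size_poly.
  rewrite -(big_mkord xpredT (fun i => (P N * Q N)`_i * x ^+ i)).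
  rewrite (big_cat_nat _ (n := N)) ?leq_addr//=; congr (_ + _).
  rewrite /pseries /series /= big_nat [RHS]big_nat; apply: eq_bigr => n /= nN.
  rewrite coefM; congr (_ * _); apply: eq_bigr => i _.
  rewrite !coef_poly (leq_ltn_trans (leq_subr _ _) nN).
  by rewrite (leq_ltn_trans _ nN)// -ltnS.
pose K := C * D * E * (r2 / r1).
have K0 : 0 <= E.
  by have := EP 1%N; rewrite expr1 => h; rewrite -(@pmulr_lge0 _ (r2 / r1)) ?(lt_trans _ q1)// (le_trans _ h).
have PQb N n : `|(P N * Q N)`_n * x ^+ n| <= K * (`|x| / r1) ^+ n.
  rewrite normrM normrX expr_div_n mulrA ler_pdivlMr ?exprn_gt0// mulrAC.
  rewrite ler_wpM2r ?exprn_ge0// coefM.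
  rewrite (@le_trans _ _ ((n.+1%:R * (C * D) / r2 ^+ n) * r1 ^+ n))//.
    rewrite ler_wpM2r ?exprn_ge0 ?(ltW r10)// ler_pdivlMr ?exprn_gt0//.
    rewrite (le_trans (ler_wpM2r _ (ler_norm_sum _ _ _))) ?exprn_ge0 ?(ltW r20)//.
    rewrite mulr_suml mulr_natl -[in leRHS](card_ord n.+1) -sumr_const.
    apply: ler_sum => i _.
    have -> : r2 ^+ n = r2 ^+ i * r2 ^+ (n - i).
      by rewrite -exprD subnKC// -ltnS.
    rewrite normrM mulrACA ler_pM ?mulr_ge0 ?exprn_ge0 ?(ltW r20)//.
    - rewrite coef_poly (le_trans _ (aC i))// ler_wpM2r ?exprn_ge0 ?(ltW r20)//.
      by case: ifP => //; rewrite normr0.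
    - rewrite coef_poly (le_trans _ (bD (n - i)%N))// ler_wpM2r ?exprn_ge0 ?(ltW r20)//.
      by case: ifP => //; rewrite normr0.
  have := EP n.+1; rewrite exprSr expr_div_n => h.
  have : n.+1%:R * ((C * D) / r2 ^+ n * r1 ^+ n) <=
      E * (r2 ^+ n / r1 ^+ n * (r2 / r1)) * ((C * D) / r2 ^+ n * r1 ^+ n).
    rewrite ler_wpM2r// mulr_ge0 ?exprn_ge0 ?(ltW r10)// divr_ge0 ?exprn_ge0 ?(ltW r20)//.
    by rewrite mulr_ge0.
  rewrite !mulrA => h'; rewrite (le_trans h')// /K le_eqVlt; apply/orP; left.
  apply/eqP; field; rewrite ?expf_neq0 ?gt_eqF//.
have q11 : `|x| / r1 < 1 by rewrite ltr_pdivrMr// mul1r.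
have q10 : 0 <= `|x| / r1 by rewrite divr_ge0// ltW.
have tail : (\sum_(N <= n < N + N) (P N * Q N)`_n * x ^+ n) @[N --> \oo] --> 0.
  apply/norm_cvg0P.
  apply: (@squeeze_cvgr _ _ _ _ (cst 0) (fun N => K / (1 - `|x| / r1) * (`|x| / r1) ^+ N)).
  - near=> N; rewrite normr_ge0/= (le_trans (ler_norm_sum _ _ _))//.
    rewrite (le_trans (ler_sum _ (fun i _ => PQb N i)))// -mulr_sumr.
    rewrite [leRHS]mulrAC -[leRHS]mulrA ler_wpM2l ?sum_geometric_le ?q10//.
    by rewrite /K !mulr_ge0// ?invr_ge0 ltW.
  - exact: cvg_cst.
  - rewrite -[X in _ --> X](mulr0 (K / (1 - `|x| / r1))).
    by apply: cvgMl_tmp; apply: cvg_expr; rewrite ger0_norm.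
have -> : pseries (cauchy_prod a b) x = (fun N => pseries a x N * pseries b x N -
    \sum_(N <= n < N + N) (P N * Q N)`_n * x ^+ n).
  by apply/funext => N; rewrite -PE -QE -hornerM PQE addrK.
by rewrite -[X in _ --> X]subr0; apply: cvgB => //; exact: cvgM.
Unshelve. all: by end_near. Qed.

(** The radius is part of the notion: the continuation argument needs discs of
    known size. *)
Definition analytic_at (f : R -> R) y r :=
  exists a, forall h, `|h| < r -> pseries a h @ \oo --> f (y + h).

Lemma analytic_atM f g y r : analytic_at f y r -> analytic_at g y r ->
  analytic_at (fun x => f x * g x) y r.
Proof.
move=> [a af] [b bg]; exists (cauchy_prod a b) => h hr.
by apply: (cauchy_prodP (r := r)) (af _ hr) (bg _ hr) => // z zr;
  apply/cvg_ex; [exists (f (y + z)); exact: af | exists (g (y + z)); exact: bg].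
Qed.

Lemma analytic_atD f g y r : analytic_at f y r -> analytic_at g y r ->
  analytic_at (fun x => f x + g x) y r.
Proof.
move=> [a af] [b bg]; exists (fun n => a n + b n) => h hr.
have -> : pseries (fun n => a n + b n) h = pseries a h \+ pseries b h.
  apply/funext => N; rewrite /pseries /series /= -big_split/=.
  by apply: eq_bigr => i _; rewrite mulrDl.
by apply: cvgD; [exact: af | exact: bg].
Qed.

Lemma analytic_atN f y r : analytic_at f y r ->
  analytic_at (fun x => - f x) y r.
Proof.
move=> [a af]; exists (fun n => - a n) => h hr.
have -> : pseries (fun n => - a n) h = (fun N => - pseries a h N).
  apply/funext => N; rewrite /pseries /series /= -sumrN.
  by apply: eq_bigr => i _; rewrite mulNr.
by apply: cvgN; exact: af.
Qed.

Lemma analytic_atB f g y r : analytic_at f y r -> analytic_at g y r ->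
  analytic_at (fun x => f x - g x) y r.
Proof. by move=> af ag; apply: analytic_atD af (analytic_atN ag). Qed.

Lemma analytic_at_affine (c d : R) y r : analytic_at (fun x => c * x + d) y r.
Proof.
exists (fun n => if n is n'.+1 then (if n' is 0 then c else 0) else c * y + d).
move=> h _; rewrite -(cvg_shiftn 2).
rewrite [X in X @ _ --> _](_ : _ = (fun=> c * (y + h) + d)); first exact: cvg_cst.
apply/funext => n; rewrite /pseries /series /= addn2 big_nat_recl// big_nat_recl//.
rewrite big1 ?addr0; last by move=> i _; rewrite mul0r.
by rewrite expr0 expr1; ring.
Qed.

Lemma analytic_at_cst (c : R) y r : analytic_at (fun=> c) y r.
Proof.
have := analytic_at_affine 0 c y r.
by under eq_fun do rewrite mul0r add0r.
Qed.

Lemma analytic_at_eq0 f y r : 0 < r -> analytic_at f y r ->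
  (forall h, 0 < h < r -> f (y + h) = 0) ->
  forall h, `|h| < r -> f (y + h) = 0.
Proof.
move=> r0 [a af] f0 h hr.
have a0 : forall n, a n = 0.
  apply: (pseries_eq0 r0) => x /andP[x0 xr].
  by rewrite -(f0 x) ?x0//; apply: af; rewrite gtr0_norm.
have := af _ hr.
rewrite [X in X @ _ --> _](_ : _ = (fun=> 0)).
  by move=> h1; apply/esym; apply: cvg_unique h1 => //; exact: cvg_cst.
by apply/funext => N; rewrite /pseries /series /= big1// => i _; rewrite a0 mul0r.
Qed.

Lemma analytic_at_continuous f y r : 0 < r -> analytic_at f y r ->
  {for y, continuous f}.
Proof.
move=> r0 [a af].
have ar : rad a (r / 2).
  have r20 : 0 < r / 2 by lra.
  rewrite -(gtr0_norm r20); apply: cvg_rad; apply/cvg_ex; exists (f (y + r / 2)).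
  by apply: af; rewrite gtr0_norm//; lra.
have d0 : is_derive (0 : R) (1 : R) (fun x => limn (pseries a x))
    (limn (pseries (pseries_diffs a) 0)).
  by apply: (rad_is_derive ar); rewrite normr0; lra.
have : {for 0, continuous (fun x => limn (pseries a x))}.
  by apply: differentiable_continuous; apply/derivable1_diffP; exact: ex_derive.
move=> cont.
have fE h : `|h| < r -> limn (pseries a h) = f (y + h).
  by move=> hr; apply: cvg_lim => //; exact: af.
have -> : {for y, continuous f} = (f \o shift y @ 0 --> f y).
  by rewrite /prop_for /continuous_at cvg_comp_shift add0r.
rewrite -[X in f X](addr0 y) -(fE 0) ?normr0//.
apply: cvg_trans cont; apply: near_eq_cvg.
have N : \forall h \near (0 : R), `|h| < r by exact: nbhs0_lt.
by apply: filterS N => h hr; rewrite /= (fE _ hr) addrC.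
Qed.

(** Zeros propagate to the left: if f vanishes above 1 + S, then the disc of
    radius c * S about 1 + S shows that f vanishes above 1 + (1 - c / 2) * S.
    Iterating, the threshold tends to 1. *)
Lemma analytic_continuation f c Y : 0 < c <= 1 ->
  (forall y, 1 < y -> analytic_at f y (c * (y - 1))) ->
  (forall y, Y <= y -> f y = 0) -> forall y, 1 < y -> f y = 0.
Proof.
move=> /andP[c0 c1] fan fY y y1.
pose T : R := Num.max 1 (Y - 1).
have T0 : 0 < T by rewrite lt_max ltr01.
have H n z : 1 + (1 - c / 2) ^+ n * T <= z -> f z = 0.
  elim: n z => [|n IH] z.
    rewrite expr0 mul1r => zT; apply: fY; rewrite (le_trans _ zT)//.
    by rewrite -lerBlDl le_max lexx orbT.
  set S := (1 - c / 2) ^+ n * T in IH.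
  have S0 : 0 < S by rewrite mulr_gt0// exprn_gt0//; lra.
  rewrite exprS -mulrA -/S => zS.
  have [/IH//|zS'] := leP (1 + S) z.
  have -> : z = (1 + S) + (z - (1 + S)) by ring.
  have cS : 0 < c * S by rewrite mulr_gt0.
  apply: (@analytic_at_eq0 _ _ (c * S)) => //.
  - by have := fan (1 + S); rewrite addrAC subrr add0r; apply; rewrite ltrDl.
  - by move=> h /andP[h0 _]; apply: IH; rewrite lerDl ltW.
  - by rewrite ltr_norml; apply/andP; split; nra.
have q1 : `|1 - c / 2| < 1 by rewrite ltr_norml; apply/andP; split; lra.
have : T * (1 - c / 2) ^+ n @[n --> \oo] --> T * 0.
  by apply: cvgM; [exact: cvg_cst | exact: cvg_expr].
rewrite mulr0.
move=> /cvgrPdist_lt /(_ (y - 1)); rewrite subr_gt0 => /(_ y1)[n _ /(_ n (leqnn _))].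
rewrite sub0r normrN => hn; apply: (H n).
by rewrite -lerBrDl mulrC (le_trans (ler_norm _))// ltW.
Qed.

End PowerSeries.

(** * Complex power series, principal powers, the binomial series *)

Section ComplexDerivative.
Context {R : realType}.
Implicit Types (f g : R -> R[i]) (x : R).

Definition is_deriveC (x : R) (f : R -> R[i]) (df : R[i]) :=
  is_derive x (1 : R) (fun t => complex.Re (f t)) (complex.Re df) /\
  is_derive x (1 : R) (fun t => complex.Im (f t)) (complex.Im df).

Lemma is_derive1D (p q : R -> R) x dp dq : is_derive x (1 : R) p dp ->
  is_derive x (1 : R) q dq -> is_derive x (1 : R) (fun t => p t + q t) (dp + dq).
Proof. exact: is_deriveD. Qed.

Lemma is_derive1B (p q : R -> R) x dp dq : is_derive x (1 : R) p dp ->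
  is_derive x (1 : R) q dq -> is_derive x (1 : R) (fun t => p t - q t) (dp - dq).
Proof. exact: is_deriveB. Qed.

Lemma is_derive1M (p q : R -> R) x dp dq : is_derive x (1 : R) p dp ->
  is_derive x (1 : R) q dq ->
  is_derive x (1 : R) (fun t => p t * q t) (p x * dq + q x * dp).
Proof. exact: is_deriveM. Qed.

Lemma is_derive1comp (p q : R -> R) x dp dq : is_derive (q x) (1 : R) p dp ->
  is_derive x (1 : R) q dq -> is_derive x (1 : R) (fun t => p (q t)) (dp * dq).
Proof. exact: is_derive1_comp. Qed.

Lemma is_derive1V (p : R -> R) x dp : p x != 0 -> is_derive x (1 : R) p dp ->
  is_derive x (1 : R) (fun t => (p t)^-1) (- (p x) ^- 2 * dp).
Proof. exact: is_deriveV. Qed.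

Lemma is_deriveC_eq x f df df' : is_deriveC x f df -> df = df' ->
  is_deriveC x f df'.
Proof. by move=> ? <-. Qed.

Lemma is_deriveC_ext x f g df : (forall t, f t = g t) -> is_deriveC x f df ->
  is_deriveC x g df.
Proof. by move=> /funext ->. Qed.

Lemma is_deriveC_cst (z : R[i]) x : is_deriveC x (fun=> z) 0.
Proof. by split; exact: is_derive_cst. Qed.

Lemma is_deriveC_linear (z w : R[i]) x : is_deriveC x (fun t => z + t%:C * w) w.
Proof.
split; under eq_fun do rewrite !ReImE/= ?mul0r ?mulr0 ?subr0 ?addr0.
- apply: is_derive_eq (is_derive1D (is_derive_cst _ _ _) (is_derive1M (is_derive_id _ _) (is_derive_cst _ _ _))) _.
  by rewrite mulr0 mulr1 !add0r.
- apply: is_derive_eq (is_derive1D (is_derive_cst _ _ _) (is_derive1M (is_derive_id _ _) (is_derive_cst _ _ _))) _.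
  by rewrite mulr0 mulr1 !add0r.
Qed.

Lemma is_deriveCM x f g df dg : is_deriveC x f df -> is_deriveC x g dg ->
  is_deriveC x (fun t => f t * g t) (f x * dg + df * g x).
Proof.
move=> [fr fi] [gr gi]; split; under eq_fun do rewrite ReImE.
- apply: is_derive_eq (is_derive1B (is_derive1M fr gr) (is_derive1M fi gi)) _.
  by rewrite !ReImE; ring.
- apply: is_derive_eq (is_derive1D (is_derive1M fr gi) (is_derive1M fi gr)) _.
  by rewrite !ReImE; ring.
Qed.

Lemma is_deriveC_exp x f df : is_deriveC x f df ->
  is_deriveC x (fun t => expC (f t)) (df * expC (f x)).
Proof.
move=> [fr fi]; split; rewrite /expC/=.
- apply: is_derive_eq (is_derive1M (is_derive1comp (is_derive_expR _) fr) (is_derive1comp (is_derive_cos _) fi)) _.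
  by rewrite !ReImE/=; ring.
- apply: is_derive_eq (is_derive1M (is_derive1comp (is_derive_expR _) fr) (is_derive1comp (is_derive_sin _) fi)) _.
  by rewrite !ReImE/=; ring.
Qed.

Lemma is_deriveC0_eq f : (forall x, 0 <= x <= 1 -> is_deriveC x f 0) ->
  f 1 = f 0.
Proof.
move=> f0.
have H (p : R -> R) : (forall x, 0 <= x <= 1 -> is_derive x (1 : R) p 0) ->
    p 1 = p 0.
  move=> p0; apply/eqP; rewrite -subr_eq0; apply/eqP.
  have [||x _ ->] := @MVT_segment R p (fun=> 0) 0 1 ler01; last by rewrite mul0r.
  - by move=> x; rewrite in_itv/= => /andP[x0 x1]; apply: p0; rewrite !ltW.
  - apply: continuous_in_subspaceT => x; rewrite inE/= in_itv/= => /p0 px.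
    by apply: differentiable_continuous; apply/derivable1_diffP; exact: ex_derive.
by apply: cplx_eq; [apply: (H (fun t => complex.Re (f t)))|
  apply: (H (fun t => complex.Im (f t)))] => x /f0[].
Qed.

End ComplexDerivative.

Section ComplexSeries.
Context {R : realType}.
Implicit Types (a : nat -> R[i]) (x r : R).

Definition cvgS (a : nat -> R[i]) (l : R[i]) := cvgC \oo (series a) l.

Lemma Re_series a n : complex.Re (series a n) = series (fun i => complex.Re (a i)) n.
Proof. exact: Re_sum. Qed.

Lemma Im_series a n : complex.Im (series a n) = series (fun i => complex.Im (a i)) n.
Proof. exact: Im_sum. Qed.

Lemma cvgSP a l : cvgS a l <->
  (series (fun i => complex.Re (a i)) @ \oo --> complex.Re l /\
   series (fun i => complex.Im (a i)) @ \oo --> complex.Im l).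
Proof.
by rewrite /cvgS /cvgC -(funext (Re_series a)) -(funext (Im_series a)).
Qed.

Definition radC a r := exists C : R, forall n, normC (a n) * r ^+ n <= C.

Definition diffsC a n : R[i] := n.+1%:R * a n.+1.

Definition psumC a x : R[i] :=
  limn (pseries (fun n => complex.Re (a n)) x) +i*
  limn (pseries (fun n => complex.Im (a n)) x).

Lemma radC_Re a r : 0 <= r -> radC a r -> rad (fun n => complex.Re (a n)) r.
Proof.
move=> r0 [C aC]; exists C => n; rewrite (le_trans _ (aC n))//.
by rewrite ler_wpM2r ?exprn_ge0// normr_Re.
Qed.

Lemma radC_Im a r : 0 <= r -> radC a r -> rad (fun n => complex.Im (a n)) r.
Proof.
move=> r0 [C aC]; exists C => n; rewrite (le_trans _ (aC n))//.
by rewrite ler_wpM2r ?exprn_ge0// normr_Im.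
Qed.

Lemma radC_norm a r : radC a r <-> rad (fun n => normC (a n)) r.
Proof.
by split=> -[C aC]; exists C => n; have := aC n; rewrite ger0_norm// normC_ge0.
Qed.

Lemma psumC_cvg a r x : radC a r -> `|x| < r ->
  cvgS (fun n => a n * (x ^+ n)%:C) (psumC a x).
Proof.
move=> ar xr; have r0 : 0 <= r by rewrite ltW// (le_lt_trans _ xr).
apply/cvgSP; split => /=.
- under eq_fun do rewrite cReM/= mulr0 subr0.
  exact: rad_cvg (radC_Re r0 ar) _ xr.
- under eq_fun do rewrite cImM/= mulr0 add0r.
  exact: rad_cvg (radC_Im r0 ar) _ xr.
Qed.

Lemma diffsC_Re a n : complex.Re (diffsC a n) =
  pseries_diffs (fun n => complex.Re (a n)) n.
Proof.
rewrite /diffsC /pseries_diffs cReM -(rmorph_nat (real_complex R))/=.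
by rewrite mul0r subr0.
Qed.

Lemma diffsC_Im a n : complex.Im (diffsC a n) =
  pseries_diffs (fun n => complex.Im (a n)) n.
Proof.
rewrite /diffsC /pseries_diffs cImM -(rmorph_nat (real_complex R))/=.
by rewrite mul0r addr0.
Qed.

Lemma psumC_derive a r x : radC a r -> `|x| < r ->
  is_deriveC x (psumC a) (psumC (diffsC a) x).
Proof.
move=> ar xr; have r0 : 0 <= r by rewrite ltW// (le_lt_trans _ xr).
split => /=.
- under [X in limn (pseries X _)]eq_fun do rewrite diffsC_Re.
  exact: rad_is_derive (radC_Re r0 ar) xr.
- under [X in limn (pseries X _)]eq_fun do rewrite diffsC_Im.
  exact: rad_is_derive (radC_Im r0 ar) xr.
Qed.

Lemma radC_diffs a r r' : 0 < r' < r -> radC a r -> radC (diffsC a) r'.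
Proof.
move=> rr' /radC_norm ar; apply/radC_norm.
have [C aC] := rad_diffs rr' ar; exists C => n; have := aC n.
rewrite /pseries_diffs /diffsC normCM -(rmorph_nat (real_complex R)).
by rewrite normC_real normr_nat.
Qed.

(** Multiplying the recurrence by powers of x and summing turns it into a
    linear differential equation. *)
Lemma psumC_ode a r (v z : R[i]) x : radC a r -> `|x| < r ->
  (forall n, n.+1%:R * a n.+1 = v * a n + z * (n%:R * a n)) ->
  (1 - x%:C * z) * psumC (diffsC a) x = v * psumC a x.
Proof.
move=> ar xr rec.
have r0 : 0 < r by rewrite (le_lt_trans _ xr).
pose r' := (`|x| + r) / 2.
have xr' : `|x| < r' by rewrite /r'; lra.
have r'r : 0 < r' < r by rewrite (le_lt_trans _ xr')//= /r'; lra.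
have dar := radC_diffs r'r ar.
have S := psumC_cvg ar xr; have S' := psumC_cvg dar xr'.
have xS' : cvgS (fun n => n%:R * a n * (x ^+ n)%:C) (x%:C * psumC (diffsC a) x).
  rewrite /cvgS.
  have [h1 h2] := cvgCM (cvgC_cst x%:C) S'.
  split; rewrite -cvg_shiftS.
  - rewrite [X in X @ _ --> _](_ : _ = (fun n => complex.Re (x%:C *
      series (fun n => diffsC a n * (x ^+ n)%:C) n)))//.
    apply/funext => n; congr complex.Re.
    rewrite /series /= big_nat_recl// !mul0r add0r mulr_sumr.
    by apply: eq_bigr => i _; rewrite /diffsC exprS rmorphM/=; ring.
  - rewrite [X in X @ _ --> _](_ : _ = (fun n => complex.Im (x%:C *
      series (fun n => diffsC a n * (x ^+ n)%:C) n)))//.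
    apply/funext => n; congr complex.Im.
    rewrite /series /= big_nat_recl// !mul0r add0r mulr_sumr.
    by apply: eq_bigr => i _; rewrite /diffsC exprS rmorphM/=; ring.
have H : cvgC \oo (fun n => v * series (fun n => a n * (x ^+ n)%:C) n +
    z * series (fun n => n%:R * a n * (x ^+ n)%:C) n)
    (v * psumC a x + z * (x%:C * psumC (diffsC a) x)).
  by apply: cvgCD; apply: cvgCM => //; exact: cvgC_cst.
move: H; rewrite (_ : (fun _ => _) = series (fun n => diffsC a n * (x ^+ n)%:C)).
  by move=> H; rewrite mulrBl mul1r {1}(cvgC_unique S' H); ring.
apply/funext => n; rewrite /series/= !mulr_sumr -big_split/=.
by apply: eq_bigr => i _; rewrite /diffsC rec; ring.
Qed.

Lemma psumC0 a : psumC a 0 = a 0%N.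
Proof.
rewrite /psumC.
have H (b : nat -> R) : limn (pseries b 0) = b 0%N.
  apply: cvg_lim => //; rewrite -cvg_shiftS.
  rewrite [X in X @ _ --> _](_ : _ = (fun=> b 0%N)); first exact: cvg_cst.
  apply/funext => n; rewrite /pseries /series /= big_nat_recl// expr0 mulr1.
  by rewrite big1 ?addr0// => i _; rewrite exprS mul0r mulr0.
by rewrite !H; case: (a 0%N).
Qed.

(** The product of the series with a solution Q of the adjoint equation has
    zero derivative on the segment from 0 to 1. This identifies the
    exponential and the binomial series. *)
Lemma ode_pseries a r (v z : R[i]) (Q : R -> R[i]) : 1 < r -> radC a r ->
  (forall n, n.+1%:R * a n.+1 = v * a n + z * (n%:R * a n)) ->
  (forall x, 0 <= x <= 1 -> 1 - x%:C * z != 0) ->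
  (forall x, 0 <= x <= 1 -> is_deriveC x Q (- (v / (1 - x%:C * z)) * Q x)) ->
  Q 0 = 1 -> psumC a 1 * Q 1 = a 0%N.
Proof.
move=> r1 ar rec z0 dQ Q0.
rewrite -[RHS]mulr1 -Q0 -(psumC0 a).
apply: (@is_deriveC0_eq _ (fun x => psumC a x * Q x)) => x x01.
have xr : `|x| < r.
  by case/andP: x01 => x0 x1; rewrite ger0_norm// (le_lt_trans x1).
apply: is_deriveC_eq; first by apply: is_deriveCM (psumC_derive ar xr) (dQ _ x01).
have := psumC_ode ar xr rec.
move=> /(canRL (mulKf (z0 _ x01))) ->.
have := z0 _ x01; set w := 1 - _ => w0.
by field.
Qed.

End ComplexSeries.

Section ComplexExponential.
Context {R : realType}.
Implicit Types (z w : R[i]).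

Lemma rad_ratio (a : nat -> R[i]) (r : R) J : 0 <= r ->
  (forall n, (J <= n)%N -> normC (a n.+1) * r <= normC (a n)) -> radC a r.
Proof.
move=> r0 H; have [|n Jn|C] := @nonincr_bounded _ (fun n => normC (a n) * r ^+ n) J.
- by move=> n; rewrite mulr_ge0 ?normC_ge0 ?exprn_ge0.
- by rewrite exprS mulrA ler_wpM2r ?exprn_ge0// H.
- by move=> aC; exists C.
Qed.

Definition expC_coef z n : R[i] := z ^+ n / n`!%:R.

Lemma radC_expC_coef z (r : R) : 0 <= r -> radC (expC_coef z) r.
Proof.
move=> r0; pose J := Num.trunc (normC z * r).
apply: (@rad_ratio _ _ J) => // n Jn.
have zr : normC z * r <= n.+1%:R.
  rewrite ltW// (lt_le_trans (truncnS_gt _))// ler_nat ltnS//.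
have -> : expC_coef z n.+1 = z / n.+1%:R * expC_coef z n.
  by rewrite /expC_coef exprS factS natrM invfM mulrACA.
rewrite normCM mulrAC -[leRHS]mul1r ler_wpM2r ?normC_ge0// normCM normCV.
rewrite -(rmorph_nat (real_complex R)) normC_real normr_nat mulrAC.
by rewrite ler_pdivrMr// mul1r.
Qed.

Lemma expC_series z : cvgS (expC_coef z) (expC z).
Proof.
have ar : radC (expC_coef z) 2 by exact: radC_expC_coef.
have := @ode_pseries R (expC_coef z) 2 z 0 (fun x => expC (0 + x%:C * (- z))).
move=> /(_ _ ar) -/(_ _ _ _ _ _)/wrap[].
- by rewrite ltr1n.
- move=> n; rewrite mul0r addr0 /expC_coef exprS factS natrM invfM mulrACA mulrA.
  have n0 : n.+1%:R != 0 :> R[i] by rewrite pnatr_eq0.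
  by rewrite !mulrA [n.+1%:R * z]mulrC mulfK.
- by move=> x _; rewrite mulr0 subr0 oner_eq0.
- move=> x _; rewrite mulr0 subr0 divr1.
  by apply: is_deriveC_exp; exact: is_deriveC_linear.
- by rewrite mul0r addr0 expC0.
rewrite add0r mul1r expCN => H.
have E : psumC (expC_coef z) 1 = expC z.
  move: H; rewrite {2}/expC_coef expr0 fact0 divr1.
  by move=> /(canRL (divfK (expC_neq0 _))); rewrite mul1r.
have := psumC_cvg ar; move=> /(_ 1); rewrite normr1 ltr1n => /(_ erefl).
by rewrite E; under eq_fun do rewrite expr1n mulr1.
Qed.

End ComplexExponential.

Section ComplexPower.
Context {R : realType}.
Implicit Types (z w : R[i]) (r s : R).

(** The arc tangent is smooth across the real axis, where the defining arc
    cosine is not; this form is the one to differentiate. *)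
Lemma logC_right z : 0 < complex.Re z ->
  logC z = (ln (complex.Re z ^+ 2 + complex.Im z ^+ 2) / 2) +i*
           atan (complex.Im z / complex.Re z).
Proof.
move=> x0; rewrite /logC Re_norm normCE; congr (_ +i* _).
  set t := _ + _; have t0 : 0 < t by rewrite ltr_wpDr ?sqr_ge0// exprn_gt0.
  by rewrite -{2}(sqr_sqrtr (ltW t0)) lnXn ?sqrtr_gt0// mulr2n; lra.
rewrite /argC Re_norm normCE.
set x := complex.Re z in x0 *; set y := complex.Im z.
have -> : x / Num.sqrt (x ^+ 2 + y ^+ 2) = cos (atan (y / x)).
  rewrite cos_atan.
  have -> : x ^+ 2 + y ^+ 2 = x ^+ 2 * (1 + (y / x) ^+ 2).
    by field; rewrite gt_eqF.
  rewrite sqrtrM ?sqr_ge0// sqrtr_sqr (gtr0_norm x0) invfM mulrA divff ?gt_eqF//.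
  by rewrite mul1r.
have [a1 a2] := (atan_gtNpi2 (y / x), atan_ltpi2 (y / x)).
have p0 := @pi_gt0 R.
case: ifPn => [y0|]; last rewrite -ltNge => y0.
  have : 0 <= atan (y / x) by rewrite -atan0 le_atan// divr_ge0// ltW.
  by move=> h; rewrite cosK// in_itv/= h /=; lra.
have : atan (y / x) <= 0 by rewrite -atan0 le_atan// ler_pdivrMr// mul0r ltW.
by move=> h; rewrite cosKN ?opprK//; apply/andP; split; lra.
Qed.

Lemma is_deriveC_logC (w : R -> R[i]) w' x : is_deriveC x w w' ->
  0 < complex.Re (w x) -> is_deriveC x (fun t => logC (w t)) (w' / w x).
Proof.
move=> [wr wi] w0.
have nw : \forall t \near x, 0 < complex.Re (w t).
  have : {for x, continuous (fun t => complex.Re (w t))}.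
    by apply: differentiable_continuous; apply/derivable1_diffP; exact: ex_derive.
  by move=> /cvgr_gt; apply.
have wx : complex.Re (w x) ^+ 2 + complex.Im (w x) ^+ 2 != 0.
  by rewrite gt_eqF// ltr_wpDr ?sqr_ge0// exprn_gt0.
have t0 : 0 < complex.Re (w x) ^+ 2 + complex.Im (w x) ^+ 2.
  by rewrite ltr_wpDr ?sqr_ge0// exprn_gt0.
have w0' : complex.Re (w x) != 0 by rewrite gt_eqF.
split.
- apply: (@near_eq_is_derive _ _ _ (fun t => ln (complex.Re (w t) * complex.Re (w t) +
    complex.Im (w t) * complex.Im (w t)) * 2^-1)).
    by apply: filterS nw => t tw; rewrite logC_right// -!expr2.
  rewrite !expr2 in t0.
  have d1 := is_derive1D (is_derive1M wr wr) (is_derive1M wi wi).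
  have d2 := is_derive1comp (q := fun t => complex.Re (w t) * complex.Re (w t) +
    complex.Im (w t) * complex.Im (w t)) (is_derive1_ln t0) d1.
  have d3 := is_derive1M d2 (is_derive_cst (2^-1 : R) x 1).
  apply: (is_derive_eq d3).
  rewrite /=; rewrite !cReM; case: (w x) wx t0 w0' => a b /= ? ? ?.
  by field.
- apply: (@near_eq_is_derive _ _ _ (fun t => atan (complex.Im (w t) * (complex.Re (w t))^-1))).
    by apply: filterS nw => t tw; rewrite logC_right.
  have d1 := is_derive1M wi (is_derive1V w0' wr).
  have d2 := is_derive1comp (q := fun t => complex.Im (w t) * (complex.Re (w t))^-1)
    (is_derive1_atan _) d1.
  apply: (is_derive_eq d2).
  rewrite /=; rewrite !cImM; case: (w x) wx t0 w0' => a b /= ? ta a0.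
  by field; rewrite a0 gt_eqF.
Qed.

Lemma expC_logC z : 0 < complex.Re z -> expC (logC z) = z.
Proof.
move=> x0; rewrite logC_right// /expC/=.
set x := complex.Re z in x0 *; set y := complex.Im z.
have x20 : 0 < x ^+ 2 + y ^+ 2 by rewrite ltr_wpDr ?sqr_ge0// exprn_gt0.
have -> : expR (ln (x ^+ 2 + y ^+ 2) / 2) = Num.sqrt (x ^+ 2 + y ^+ 2).
  by rewrite -powR12_sqrt ?(ltW x20)// /powR gt_eqF// mulrC.
have c : cos (atan (y / x)) = x / Num.sqrt (x ^+ 2 + y ^+ 2).
  rewrite cos_atan.
  have -> : x ^+ 2 + y ^+ 2 = x ^+ 2 * (1 + (y / x) ^+ 2).
    by field; rewrite gt_eqF.
  rewrite sqrtrM ?sqr_ge0// sqrtr_sqr (gtr0_norm x0) invfM mulrA divff ?gt_eqF//.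
  by rewrite mul1r.
have s0 : Num.sqrt (x ^+ 2 + y ^+ 2) != 0 by rewrite gt_eqF// sqrtr_gt0.
have -> : sin (atan (y / x)) = y / x * cos (atan (y / x)).
  rewrite -{2}(atanK (y / x)) /tan divfK// c mulf_neq0 ?invr_eq0// gt_eqF//.
rewrite c; apply: cplx_eq => /=; rewrite -/x -/y; field => //.
by rewrite s0 gt_eqF.
Qed.

Lemma right_neq0 z : 0 < complex.Re z -> z != 0.
Proof. by apply: contraTneq => ->; rewrite ltxx. Qed.

Lemma logCM_pos r z : 0 < r -> 0 < complex.Re z ->
  logC (r%:C * z) = (ln r)%:C + logC z.
Proof.
move=> r0 z0.
have rz : complex.Re (r%:C * z) = r * complex.Re z by rewrite cReM/= mul0r subr0.
have iz : complex.Im (r%:C * z) = r * complex.Im z by rewrite cImM/= mul0r addr0.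
have rz0 : 0 < complex.Re (r%:C * z) by rewrite rz mulr_gt0.
have t0 : 0 < complex.Re z ^+ 2 + complex.Im z ^+ 2.
  by rewrite ltr_wpDr ?sqr_ge0// exprn_gt0.
rewrite !logC_right// rz iz; apply: cplx_eq => /=.
  rewrite !exprMn -mulrDr lnM ?posrE ?exprn_gt0// mulrDl lnXn// mulr2n.
  by lra.
by rewrite add0r -mulf_div divff ?mul1r// gt_eqF.
Qed.

Lemma powCD z (r s : R[i]) : powC z (r + s) = powC z r * powC z s.
Proof. by rewrite /powC mulrDl expCD. Qed.

Lemma powC0 z : powC z 0 = 1.
Proof. by rewrite /powC mul0r expC0. Qed.

Lemma powC1 z : 0 < complex.Re z -> powC z 1 = z.
Proof. by move=> z0; rewrite /powC mul1r expC_logC. Qed.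

Lemma powC_neq0 z (r : R[i]) : powC z r != 0.
Proof. exact: expC_neq0. Qed.

Lemma powCN z (r : R[i]) : powC z (- r) = (powC z r)^-1.
Proof. by rewrite /powC mulNr expCN. Qed.

Lemma powCX z (r : R[i]) n : powC z (n%:R * r) = powC z r ^+ n.
Proof.
elim: n => [|n IH]; first by rewrite mul0r powC0 expr0.
by rewrite -nat1r mulrDl mul1r powCD IH exprS.
Qed.

Lemma powC_posM r z (s : R) : 0 < r -> 0 < complex.Re z ->
  powC (r%:C * z) s%:C = (r `^ s)%:C * powC z s%:C.
Proof.
move=> r0 z0; rewrite /powC logCM_pos// mulrDr expCD -rmorphM/= expC_real.
by rewrite /powR gt_eqF.
Qed.

Lemma powC_pos r (s : R) : 0 < r -> powC r%:C s%:C = (r `^ s)%:C.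
Proof.
move=> r0; rewrite -[r%:C]mulr1 powC_posM//=.
rewrite /powC logC_right//= expr0n expr1n/= addr0 ln1 mul0r mul0r atan0.
by rewrite mulr0 expC0 mulr1.
Qed.

Lemma normC_powC z (s : R) : 0 < complex.Re z ->
  normC (powC z s%:C) = normC z `^ s.
Proof.
move=> z0; rewrite /powC normC_expC cReM mul0r subr0.
rewrite -[complex.Re (logC z)]/(ln (complex.Re `|z|)) Re_norm.
by rewrite /powR gt_eqF// normC_gt0 right_neq0.
Qed.

End ComplexPower.

Section Binomial.
Context {R : realType}.
Implicit Types (z : R[i]) (g : R).

(** Coefficients of the binomial series of exponent [- g]. *)
Definition bin_coef (g : R) (n : nat) : R := \prod_(i < n) (g + i%:R) / n`!%:R.

Lemma bin_coefS g n : n.+1%:R * bin_coef g n.+1 = (g + n%:R) * bin_coef g n.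
Proof.
rewrite /bin_coef big_ord_recr/= factS natrM; field.
by rewrite nat1r !pnatr_eq0 -lt0n fact_gt0.
Qed.

Lemma radC_bin g z (r : R) : 0 <= r -> normC z * r < 1 ->
  radC (fun n => (bin_coef g n)%:C * z ^+ n) r.
Proof.
move=> r0; set q := normC z * r => q1.
have q0 : 0 <= q by rewrite mulr_ge0// normC_ge0.
pose J := Num.trunc (`|g| / (1 - q)).
apply: (@rad_ratio _ _ _ J) => // n Jn.
have n0 : n.+1%:R != 0 :> R by rewrite pnatr_eq0.
have E : bin_coef g n.+1 = (g + n%:R) / n.+1%:R * bin_coef g n.
  by rewrite mulrAC -bin_coefS mulrC mulKf.
rewrite E !normCM !normC_real normrM exprS normCM.
have -> : `|(g + n%:R) / n.+1%:R| * `|bin_coef g n| * (normC z * normC (z ^+ n)) * r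
  = `|(g + n%:R) / n.+1%:R| * q * (`|bin_coef g n| * normC (z ^+ n)).
  by rewrite /q; ring.
rewrite -[leRHS]mul1r ler_wpM2r ?mulr_ge0 ?normC_ge0//.
rewrite normrM normfV normr_nat mulrAC ler_pdivrMr// mul1r.
have gJ : `|g| <= n.+1%:R * (1 - q).
  rewrite -ler_pdivrMr ?subr_gt0// ltW// (lt_le_trans (truncnS_gt _))//.
  by rewrite ler_nat ltnS.
rewrite (le_trans (ler_wpM2r q0 (ler_normD _ _)))// normr_nat.
rewrite -nat1r in gJ *.
have : 0 <= `|g| * (1 - q) by rewrite mulr_ge0// subr_ge0 ltW.
lra.
Qed.

Lemma norm_lt1_right z (x : R) : normC z < 1 -> 0 <= x <= 1 ->
  0 < complex.Re (1 - x%:C * z).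
Proof.
move=> z1 /andP[x0 x1]; rewrite cReD cReN cReM/= mul0r subr0.
have := normr_Re z; rewrite ler_norml => /andP[_ h].
have : x * complex.Re z <= x * normC z by rewrite ler_wpM2l.
have : x * normC z <= normC z by rewrite ler_piMl// normC_ge0.
lra.
Qed.

(** The binomial series: both sides solve the same linear equation along the
    segment from 0 to z. *)
Lemma binomial_series g z : normC z < 1 ->
  cvgS (fun n => (bin_coef g n)%:C * z ^+ n) (powC (1 - z) (- g)%:C).
Proof.
move=> z1; set a := (fun n => _).
pose r := 2 / (1 + normC z).
have nz0 := normC_ge0 z.
have r0 : 0 < 1 + normC z by lra.
have r1 : 1 < r by rewrite ltr_pdivlMr//; lra.
have ar : radC a r.
  by apply: radC_bin; rewrite ?divr_ge0 ?ltW// mulrA ltr_pdivrMr//; lra.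
have := @ode_pseries R a r (g%:C * z) z
  (fun x => expC (g%:C * logC (1 + x%:C * (- z)))) r1 ar.
have zE x : 1 + x%:C * - z = 1 - x%:C * z by rewrite mulrN.
move=> H; have {}H : psumC a 1 * powC (1 - z) g%:C = a 0%N.
  rewrite /powC; have <- : 1 + 1%:C * - z = 1 - z by rewrite mul1r.
  apply: H.
  - move=> n; rewrite /a exprS.
    have -> : n.+1%:R = (n.+1%:R : R)%:C by rewrite rmorph_nat.
    rewrite mulrA -rmorphM bin_coefS.
    have -> : n%:R = (n%:R : R)%:C by rewrite rmorph_nat.
    rewrite rmorphM rmorphD; ring.
  - by move=> x x01; apply: right_neq0; exact: norm_lt1_right.
  - move=> x x01; apply: is_deriveC_eq.
      apply: is_deriveC_exp; apply: is_deriveCM; first exact: is_deriveC_cst.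
      apply: is_deriveC_logC; first exact: is_deriveC_linear.
      by rewrite zE; exact: norm_lt1_right.
    rewrite mul0r addr0 !zE; congr (_ * _).
    by rewrite mulNr mulrN mulrA.
  - by rewrite mul0r addr0 logC_right//= expr1n expr0n/= addr0 ln1 !mul0r atan0 mulr0 expC0.
have a0 : a 0%N = 1 by rewrite /a expr0 mulr1 /bin_coef big_ord0 fact0 divr1.
rewrite a0 in H.
have E : psumC a 1 = powC (1 - z) (- g)%:C.
  rewrite rmorphN powCN; apply: (mulIf (powC_neq0 (1 - z) g%:C)).
  by rewrite H mulVf// powC_neq0.
have := psumC_cvg ar; move=> /(_ 1); rewrite normr1 => /(_ r1).
by rewrite E; under eq_fun do rewrite expr1n mulr1.
Qed.

End Binomial.

(** * Convolution on the half-line *)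

Section Convolution.
Context {R : realType}.
Implicit Types (a b f g : R -> R) (t x c T : R).
Local Notation mu := (@lebesgue_measure R).

Lemma ge0_integral_reflect c (f : R -> \bar R) : measurable_fun [set: R] f ->
  (forall x, 0 <= f x)%E ->
  (\int[mu]_x f (c - x)%R = \int[mu]_x f x)%E.
Proof.
move=> mf f0.
have mphi : measurable_fun [set: measurableTypeR R]
    ((fun x => c - x) : _ -> measurableTypeR R).
  by apply: measurable_funB => //; exact: measurable_cst.
transitivity (\int[pushforward mu ((fun x => (c - x)%R) : _ -> measurableTypeR R)]_x f x)%E.
  by rewrite (ge0_integral_pushforward mphi)//= => x _; exact: f0.
apply: eq_measure_integral => //= A mA _; apply/esym.
apply: lebesgue_measure_unique => //= _ [[u v]] _ <-.
rewrite /pushforward/=.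
have -> : (fun x => c - x) @^-1` `]u, v]%classic = `[c - v, c - u[%classic.
  apply/seteqP; split => x /=; rewrite !in_itv/= => /andP[h1 h2];
    apply/andP; split; lra.
rewrite !lebesgue_measure_itv/= !lte_fin ltrD2l ltrN2.
by case: ifPn => // _; rewrite -!EFinD; congr EFin; ring.
Qed.

Lemma integral_reflect c (f : R -> \bar R) : measurable_fun [set: R] f ->
  (\int[mu]_x f (c - x)%R = \int[mu]_x f x)%E.
Proof.
move=> mf; rewrite [LHS]integralE [RHS]integralE; congr (_ - _)%E.
- rewrite -[RHS](ge0_integral_reflect c (measurable_funepos mf))//.
  by rewrite (funepos_comp f (fun x : R => c - x)).
- rewrite -[RHS](ge0_integral_reflect c (measurable_funeneg mf))//.
  by rewrite (funeneg_comp f (fun x : R => c - x)).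
Qed.

Lemma integral_translate c (f : R -> \bar R) : measurable_fun [set: R] f ->
  (\int[mu]_x f (x - c)%R = \int[mu]_x f x)%E.
Proof.
move=> mf; rewrite -(integral_reflect 0 mf).
rewrite -(integral_reflect c (f := fun x => f (0 - x))).
  by apply: eq_integral => x _; congr f; ring.
apply: measurableT_comp => //; apply: measurable_funB => //.
Qed.

Definition conv a b t : R := \int[mu]_x (a (t - x) * b x).

Lemma measurable_conv_kernel a b : measurable_fun setT a -> measurable_fun setT b ->
  measurable_fun [set: R * R] (fun tx : R * R => a (tx.1 - tx.2) * b tx.2).
Proof.
move=> ma mb; apply: measurable_funM; last first.
  by apply: measurableT_comp => //; exact: measurable_snd.
apply: measurableT_comp => //; apply: measurable_funB.
  exact: measurable_fst.
exact: measurable_snd.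
Qed.

Lemma conv_comm a b t : measurable_fun setT a -> measurable_fun setT b ->
  conv a b t = conv b a t.
Proof.
move=> ma mb; rewrite /conv /Rintegral; congr fine.
rewrite -(integral_reflect t); last first.
  apply/measurable_EFinP; apply: measurable_funM => //.
  by apply: measurableT_comp => //; apply: measurable_funB.
by apply: eq_integral => x _; rewrite mulrC; congr (_ * a _)%:E; ring.
Qed.

Lemma measurable_conv a b : measurable_fun setT a -> measurable_fun setT b ->
  measurable_fun setT (conv a b).
Proof.
move=> ma mb.
have mF := measurable_conv_kernel ma mb.
have mFE : measurable_fun setT (EFin \o (fun tx : R * R => a (tx.1 - tx.2) * b tx.2)).
  exact/measurable_EFinP.
rewrite /conv /Rintegral.
apply: (measurableT_comp (f := fine)) => //.
rewrite (_ : (fun x => _) = (fun t =>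
   \int[mu]_x ((EFin \o (fun tx : R * R => a (tx.1 - tx.2) * b tx.2)%R)^\+ (t, x)) -
   \int[mu]_x ((EFin \o (fun tx : R * R => a (tx.1 - tx.2) * b tx.2)%R)^\- (t, x)))%E).
  apply: emeasurable_funB.
  - apply: (@measurable_fun_fubini_tonelli_F _ _ _ _ _ mu) => //.
    exact: measurable_funepos.
  - apply: (@measurable_fun_fubini_tonelli_F _ _ _ _ _ mu) => //.
    exact: measurable_funeneg.
apply/funext => t; rewrite integralE.
rewrite (funepos_comp (EFin \o (fun tx : R * R => a (tx.1 - tx.2) * b tx.2)) (fun x : R => (t, x))).
by rewrite (funeneg_comp (EFin \o (fun tx : R * R => a (tx.1 - tx.2) * b tx.2)) (fun x : R => (t, x))).
Qed.

Lemma integrable_conv_kernel a b : mu.-integrable setT (EFin \o a) ->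
  mu.-integrable setT (EFin \o b) ->
  (mu \x mu)%E.-integrable setT
    (EFin \o (fun tx : R * R => a (tx.1 - tx.2) * b tx.2)).
Proof.
move=> ia ib.
have ma : measurable_fun setT a by apply/measurable_EFinP; exact: measurable_int ia.
have mb : measurable_fun setT b by apply/measurable_EFinP; exact: measurable_int ib.
have mF := measurable_conv_kernel ma mb.
apply/integrable21ltyP; first exact/measurable_EFinP.
have -> : (\int[mu]_y \int[mu]_x `|(a (x - y) * b y)%:E| =
    \int[mu]_y ((\int[mu]_x `|(a x)%:E|) * `|(b y)%:E|))%E.
  apply: eq_integral => y _ /=.
  under eq_integral do rewrite normrM EFinM.
  rewrite ge0_integralZr//=.
  - congr (_ * _)%E.
    rewrite (integral_translate y (f := fun x => `|(a x)%:E|%E))//.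
    by apply: measurableT_comp => //; exact/measurable_EFinP.
  - apply/measurable_EFinP; apply: measurableT_comp => //.
    by apply: measurableT_comp => //; exact: measurable_funB.
rewrite ge0_integralZl//=.
- by apply: lte_mul_pinfty; [exact: integral_ge0| |];
    [rewrite ge0_fin_numE ?integral_ge0//|]; case/integrableP : ia ib => _ ia /integrableP[].
- by apply/measurable_EFinP; exact: measurableT_comp.
- exact: integral_ge0.
Qed.

Lemma integrable_conv a b : mu.-integrable setT (EFin \o a) ->
  mu.-integrable setT (EFin \o b) -> mu.-integrable setT (EFin \o conv a b).
Proof.
move=> ia ib; have iab := integrable_conv_kernel ia ib.
have ma : measurable_fun setT a by apply/measurable_EFinP; exact: measurable_int ia.
have mb : measurable_fun setT b by apply/measurable_EFinP; exact: measurable_int ib.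
have := integrable_fubini_F iab => iF.
apply: (le_integrable measurableT _ _ iF).
  by apply/measurable_EFinP; exact: measurable_conv.
move=> t _; rewrite /= /fubini_F /conv /Rintegral.
case: (\int[mu]_y _)%E => [r|//|//] /=; first by [].
- by rewrite normr0 leey.
- by rewrite normr0 leey.
Qed.

(** Weight 1 gives the convolution theorem, the indicator of a half-line gives
    the primitive of a convolution. *)
Lemma conv_fubini a b (w : R -> R) : mu.-integrable setT (EFin \o a) ->
  mu.-integrable setT (EFin \o b) -> measurable_fun setT w ->
  (forall t, `|w t| <= 1) ->
  \int[mu]_t (w t * conv a b t) =
  \int[mu]_x ((\int[mu]_t (w (t + x) * a t)) * b x).
Proof.
move=> ia ib mw w1; have iab := integrable_conv_kernel ia ib.
have ma : measurable_fun setT a by apply/measurable_EFinP; exact: measurable_int ia.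
have mb : measurable_fun setT b by apply/measurable_EFinP; exact: measurable_int ib.
have iG : (mu \x mu)%E.-integrable setT
    (EFin \o (fun tx : R * R => w tx.1 * (a (tx.1 - tx.2) * b tx.2))).
  apply: (le_integrable measurableT _ _ iab).
    apply/measurable_EFinP; apply: measurable_funM; last exact: measurable_conv_kernel.
    by apply: measurableT_comp => //; exact: measurable_fst.
  by move=> tx _; rewrite /= lee_fin normrM ler_piMl.
have := Fubini iG; rewrite /fubini_F /fubini_G/= => fub.
have aeF := ae_integrable1 iab.
rewrite /Rintegral; congr fine.
transitivity (\int[mu]_x \int[mu]_y (w x * (a (x - y)%R * b y))%:E)%E.
  apply: ae_eq_integral.
  - exact: measurableT.
  - apply/measurable_EFinP; apply: measurable_funM => //; exact: measurable_conv.
  - exact: measurable_fubini_F iG.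
  - apply: filterS aeF => t /= it _.
    rewrite /conv -(RintegralZl _ measurableT it) /Rintegral fineK//.
    apply: integrable_fin_num => //.
    have := integrableZl measurableT (w t) it.
    by apply: eq_integrable => // x _ /=; rewrite EFinM.
rewrite fub; apply: eq_integral => y _.
transitivity (\int[mu]_x (w (x + y) * a x * b y)%:E)%E.
  have := @integral_translate y (fun x => (w (x + y) * a x * b y)%:E).
  move=> <-.
    by apply: eq_integral => x _; rewrite subrK mulrA.
  apply/measurable_EFinP; apply: measurable_funM; last exact: measurable_cst.
  apply: measurable_funM; last exact: ma.
  by apply: measurableT_comp; [exact: mw | exact: measurable_funD].
have iwa : mu.-integrable setT (fun x => (w (x + y) * a x)%:E).
  apply: (le_integrable measurableT _ _ ia).
    apply/measurable_EFinP; apply: measurable_funM => //.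
    by apply: measurableT_comp => //; exact: measurable_funD.
  by move=> x _; rewrite /= lee_fin normrM ler_piMl.
under [LHS]eq_integral do rewrite EFinM.
rewrite (integralZr measurableT iwa) EFinM /Rintegral fineK//.
exact: integrable_fin_num.
Qed.

Definition primitive f t : R := \int[mu]_(x in `[0, t]) f x.

Definition causal_conv a b t : R := \int[mu]_(x in `[0, t]) (a (t - x) * b x).

Definition locint f := forall T, mu.-integrable `[0, T] (EFin \o f).

Lemma causal_convE a b t T : t <= T ->
  causal_conv a b t = conv (a \_ `[0, T]) (b \_ `[0, T]) t.
Proof.
move=> tT; rewrite /causal_conv /conv Rintegral_mkcond.
apply: eq_Rintegral => x _; rewrite !patchE.
case: ifPn; rewrite ?inE ?notin_setE/= !in_itv/=.
  move=> /andP[x0 xt]; rewrite !mem_set//= in_itv/=; apply/andP; split; lra.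
move=> xt; case: ifPn; last by rewrite mul0r.
rewrite inE/= in_itv/= => /andP[h1 h2].
case: ifPn; last by rewrite mulr0.
rewrite inE/= in_itv/= => /andP[h3 h4].
by exfalso; apply: xt; apply/andP; split; lra.
Qed.

Lemma locint_restrict f T : locint f ->
  mu.-integrable setT (EFin \o (f \_ `[0, T])).
Proof.
by move=> /(_ T) /(integrable_mkcond _ _).1 => H; rewrite -restrict_EFin; exact: H.
Qed.

Lemma locint_measurable f T : locint f -> measurable_fun `[0, T] f.
Proof. by move=> /(_ T)/measurable_int/measurable_EFinP. Qed.

Lemma locint_causal_conv a b : locint a -> locint b -> locint (causal_conv a b).
Proof.
move=> ia ib T.
have h := integrable_conv (locint_restrict T ia) (locint_restrict T ib).
have := @integrableS _ _ _ mu setT `[0, T] _ measurableT (measurable_itv _) (@subsetT _ _) h.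
apply: eq_integrable => // x; rewrite inE/= in_itv/= => /andP[_ xT].
by rewrite -causal_convE.
Qed.

Lemma causal_conv_comm a b t : locint a -> locint b ->
  causal_conv a b t = causal_conv b a t.
Proof.
move=> ia ib; rewrite !(causal_convE _ _ (lexx t)) conv_comm//.
- by apply/measurable_EFinP; exact: measurable_int (locint_restrict t ia).
- by apply/measurable_EFinP; exact: measurable_int (locint_restrict t ib).
Qed.

Lemma primitive_restrict f t : primitive f t = \int[mu]_x (f \_ `[0, t]) x.
Proof. by rewrite /primitive Rintegral_mkcond. Qed.

(** Fubini on the triangle below the diagonal of the square of side t. *)
Lemma primitive_causal_conv a b t : locint a -> locint b ->
  primitive (causal_conv a b) t = causal_conv (primitive a) b t.
Proof.
move=> ia ib.
pose A := a \_ `[0, t]; pose B := b \_ `[0, t].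
have iA : mu.-integrable setT (EFin \o A) by exact: locint_restrict.
have iB : mu.-integrable setT (EFin \o B) by exact: locint_restrict.
pose w : R -> R := \1_`]-oo, t].
have mw : measurable_fun setT w by apply: measurable_indic; exact: measurable_itv.
have w1 x : `|w x| <= 1.
  by rewrite /w indicE; case: (_ \in _); rewrite ?normr1 ?normr0.
transitivity (\int[mu]_x (w x * conv A B x)).
  rewrite /primitive Rintegral_mkcond; apply: eq_Rintegral => x _.
  rewrite patchE /w indicE; case: ifPn; rewrite ?inE ?notin_setE/= !in_itv/=.
    by move=> /andP[x0 xt]; rewrite mem_set/= ?in_itv//= mul1r (causal_convE _ _ xt).
  move=> xt; have [x0|x0] := leP 0 x.
    by rewrite memNset ?mul0r//= in_itv/= => h; apply: xt; rewrite x0.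
  rewrite /conv (_ : (fun y => _) = cst 0) ?Rintegral_cst// ?mul0r ?mulr0//.
  apply/funext => y; rewrite /A /B !patchE.
  case: ifPn; last by rewrite mul0r.
  rewrite inE/= in_itv/= => /andP[h1 h2].
  case: ifPn; last by rewrite mulr0.
  by rewrite inE/= in_itv/= => /andP[h3 h4]; lra.
rewrite (conv_fubini iA iB mw w1) /causal_conv [RHS]Rintegral_mkcond.
apply: eq_Rintegral => y _; rewrite [RHS]patchE /B [X in _ * X]patchE.
case: ifPn; rewrite ?mulr0// inE/= in_itv/= => /andP[y0 yt].
congr (_ * _); rewrite primitive_restrict; apply: eq_Rintegral => x _.
rewrite /w indicE /A !patchE -/(0 : R).
case: (boolP (0 <= x <= t - y)) => [/andP[x0 xt]|xn].
  rewrite (mem_set (A := `]-oo, t]%classic)) ?mul1r; last by rewrite /= in_itv/=; lra.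
  rewrite (mem_set (A := `[0, t]%classic)); last by rewrite /= in_itv/=; apply/andP; split; lra.
  by rewrite mem_set//= in_itv/= x0.
rewrite (memNset (A := `[0, t - y]%classic)) ?in_itv//=; last exact/negP.
case: ifPn; last by rewrite mulr0.
rewrite inE/= in_itv/= => /andP[x0 xt].
rewrite memNset ?mul0r//= in_itv/= => h; move: xn; rewrite x0/= -ltNge; lra.
Qed.

Lemma locint_cst c : locint (cst c).
Proof.
move=> T; apply: continuous_compact_integrable; first exact: segment_compact.
by apply: continuous_subspaceT => x; exact: cst_continuous.
Qed.

Lemma primitiveE f t : primitive f t = causal_conv (cst 1) f t.
Proof. by apply: eq_Rintegral => x _; rewrite mul1r. Qed.

Lemma locint_primitive f : locint f -> locint (primitive f).
Proof.
move=> fi; rewrite (funext (primitiveE f)).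
exact: locint_causal_conv (locint_cst 1) fi.
Qed.

Lemma primitive_causal_convr a b t : locint a -> locint b ->
  primitive (causal_conv a b) t = causal_conv a (primitive b) t.
Proof.
move=> ia ib; rewrite (causal_conv_comm _ ia (locint_primitive ib)).
rewrite -(primitive_causal_conv _ ib ia); apply: eq_Rintegral => x _.
exact: causal_conv_comm.
Qed.

End Convolution.

(** * Complex integrals and Laplace integrals *)

Section ComplexIntegral.
Context {R : realType}.
Local Notation mu := (@lebesgue_measure R).
Variables (D : set R) (mD : @measurable _ (measurableTypeR R) D).
Implicit Types (g h : R -> R[i]) (f G : R -> R).

Definition measurableC g :=
  measurable_fun D (fun t => complex.Re (g t)) /\
  measurable_fun D (fun t => complex.Im (g t)).

Definition integrableC g :=
  mu.-integrable D (fun t => (complex.Re (g t))%:E) /\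
  mu.-integrable D (fun t => (complex.Im (g t))%:E).

Lemma integrableC_measurable g : integrableC g -> measurableC g.
Proof. by move=> [/measurable_int/measurable_EFinP ? /measurable_int/measurable_EFinP ?]. Qed.

Lemma measurableC_cst (z : R[i]) : measurableC (fun=> z).
Proof. by split; exact: measurable_cst. Qed.

Lemma measurableC_real f : measurable_fun D f -> measurableC (fun t => (f t)%:C).
Proof. by move=> mf; split => //=; exact: measurable_cst. Qed.

Lemma measurableCD g h : measurableC g -> measurableC h ->
  measurableC (fun t => g t + h t).
Proof.
move=> [gr gi] [hr hi]; split; under eq_fun do rewrite ?cReD ?cImD;
  exact: measurable_funD.
Qed.

Lemma measurableCN g : measurableC g -> measurableC (fun t => - g t).
Proof.
move=> [gr gi]; split; under eq_fun do rewrite ?cReN ?cImN;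
  by apply: measurableT_comp.
Qed.

Lemma measurableCM g h : measurableC g -> measurableC h ->
  measurableC (fun t => g t * h t).
Proof.
move=> [gr gi] [hr hi]; split; under eq_fun do rewrite ?cReM ?cImM.
- by apply: measurable_funB; exact: measurable_funM.
- by apply: measurable_funD; exact: measurable_funM.
Qed.

Lemma measurableC_exp g : measurableC g -> measurableC (fun t => expC (g t)).
Proof.
move=> [gr gi]; split; rewrite /expC/=; apply: measurable_funM.
- exact: (measurableT_comp (@measurable_expR R)).
- by apply: (measurableT_comp _ gi); apply: continuous_measurable_fun; exact: continuous_cos.
- exact: (measurableT_comp (@measurable_expR R)).
- by apply: (measurableT_comp _ gi); apply: continuous_measurable_fun; exact: continuous_sin.
Qed.

Lemma measurableC_kernel (s : R[i]) :
  measurableC (fun t => expC (- (s * t%:C))).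
Proof.
apply: measurableC_exp; apply: measurableCN; apply: measurableCM.
  exact: measurableC_cst.
by apply: measurableC_real; exact: measurable_id.
Qed.

Lemma measurable_normC g : measurableC g -> measurable_fun D (fun t => normC (g t)).
Proof.
move=> [gr gi]; under eq_fun do rewrite normCE.
apply: (measurableT_comp (f := @Num.sqrt R)).
  by apply: continuous_measurable_fun; exact: sqrt_continuous.
by apply: measurable_funD; exact: measurable_funX.
Qed.

Lemma integrableC_le g G : measurableC g ->
  mu.-integrable D (fun t => (G t)%:E) ->
  (forall t, D t -> normC (g t) <= G t) -> integrableC g.
Proof.
move=> [gr gi] iG gG; split; apply: (le_integrable mD _ _ iG).
- exact/measurable_EFinP.
- move=> t Dt /=; rewrite lee_fin (le_trans (normr_Re _))//.
  by rewrite (le_trans (gG _ Dt))// ler_norm.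
- exact/measurable_EFinP.
- move=> t Dt /=; rewrite lee_fin (le_trans (normr_Im _))//.
  by rewrite (le_trans (gG _ Dt))// ler_norm.
Qed.

Lemma integrable_normC g : integrableC g ->
  mu.-integrable D (fun t => (normC (g t))%:E).
Proof.
move=> ig; have [ir ii] := ig.
have := integrableD mD (integrable_abse ir) (integrable_abse ii).
apply: le_integrable => //.
  by apply/measurable_EFinP; apply: measurable_normC; exact: integrableC_measurable.
move=> t _ /=; rewrite lee_fin ger0_norm ?normC_ge0// ger0_norm ?addr_ge0//.
exact: normC_le_ReIm.
Qed.

Lemma integrableCD g h : integrableC g -> integrableC h ->
  integrableC (fun t => g t + h t).
Proof.
move=> [gr gi] [hr hi]; split.
- have := integrableD mD gr hr.
  by apply: eq_integrable => // t _; rewrite /= cReD EFinD.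
- have := integrableD mD gi hi.
  by apply: eq_integrable => // t _; rewrite /= cImD EFinD.
Qed.

Lemma integrableCZ (z : R[i]) g : integrableC g -> integrableC (fun t => z * g t).
Proof.
move=> ig; apply: (@integrableC_le _ (fun t => normC z * normC (g t))).
- by apply: measurableCM; [exact: measurableC_cst | exact: integrableC_measurable].
- have := integrableZl mD (normC z) (integrable_normC ig).
  by apply: eq_integrable => // t _; rewrite /= EFinM.
- by move=> t _; rewrite normCM.
Qed.

Lemma integralCD g h : integrableC g -> integrableC h ->
  integralC D (fun t => g t + h t) = integralC D g + integralC D h.
Proof.
move=> [gr gi] [hr hi]; apply: cplx_eq; rewrite ?cReD ?cImD/=.
- by under eq_Rintegral do rewrite cReD; exact: RintegralD.
- by under eq_Rintegral do rewrite cImD; exact: RintegralD.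
Qed.

Lemma integralCZ (z : R[i]) g : integrableC g ->
  integralC D (fun t => z * g t) = z * integralC D g.
Proof.
move=> [gr gi]; apply: cplx_eq; rewrite ?cReM ?cImM/=.
- under eq_Rintegral do rewrite cReM.
  rewrite RintegralB//= ?RintegralZl//.
  + by have := integrableZl mD (complex.Re z) gr;
      apply: eq_integrable => // t _; rewrite /= EFinM.
  + by have := integrableZl mD (complex.Im z) gi;
      apply: eq_integrable => // t _; rewrite /= EFinM.
- under eq_Rintegral do rewrite cImM.
  rewrite RintegralD//= ?RintegralZl//.
  + by have := integrableZl mD (complex.Re z) gi;
      apply: eq_integrable => // t _; rewrite /= EFinM.
  + by have := integrableZl mD (complex.Im z) gr;
      apply: eq_integrable => // t _; rewrite /= EFinM.
Qed.

Lemma eq_integralC g h : (forall t, D t -> g t = h t) ->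
  integralC D g = integralC D h.
Proof.
by move=> gh; congr (_ +i* _); apply: eq_Rintegral => t; rewrite inE => /gh ->.
Qed.

Lemma eq_integrableC g h : (forall t, D t -> g t = h t) ->
  integrableC g -> integrableC h.
Proof.
move=> gh [ir ii]; split.
- by apply: eq_integrable ir => // t; rewrite inE => /gh ->.
- by apply: eq_integrable ii => // t; rewrite inE => /gh ->.
Qed.

(** The factor 2 comes from bounding the two components separately. *)
Lemma normC_integralC g G : measurableC g ->
  mu.-integrable D (fun t => (G t)%:E) ->
  (forall t, D t -> normC (g t) <= G t) ->
  normC (integralC D g) <= 2 * \int[mu]_(t in D) G t.
Proof.
move=> mg iG gG; have [ir ii] := integrableC_le mg iG gG.
rewrite (le_trans (normC_le_ReIm _))//= [2]mulr2n mulrDl mul1r lerD//.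
- rewrite (le_trans (le_normr_Rintegral mD ir))// le_Rintegral//.
    by have := integrable_abse ir; apply: eq_integrable.
  by move=> t Dt; rewrite (le_trans (normr_Re _)) ?gG.
- rewrite (le_trans (le_normr_Rintegral mD ii))// le_Rintegral//.
    by have := integrable_abse ii; apply: eq_integrable.
  by move=> t Dt; rewrite (le_trans (normr_Im _)) ?gG.
Qed.

Lemma dominated_convergence_real (f_ : (R -> R)^nat) f G :
  (forall n, measurable_fun D (f_ n)) -> measurable_fun D f ->
  (forall t, D t -> f_ ^~ t @ \oo --> f t) ->
  mu.-integrable D (fun t => (G t)%:E) ->
  (forall n t, D t -> `|f_ n t| <= G t) ->
  mu.-integrable D (fun t => (f t)%:E) /\
  \int[mu]_(t in D) f_ n t @[n --> \oo] --> \int[mu]_(t in D) f t.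
Proof.
move=> mf_ mf cf iG fG.
have [|||||ii _ cv] := @dominated_convergence _ _ _ mu D mD
  (fun n t => (f_ n t)%:E) (fun t => (f t)%:E) (fun t => (G t)%:E) => //.
- by move=> n; apply/measurable_EFinP; exact: mf_.
- by apply/measurable_EFinP; exact: mf.
- by apply: aeW => t Dt; apply: cvg_EFin; [exact: nearW | exact: cf].
- by apply: aeW => t n Dt /=; rewrite lee_fin fG.
split => //; rewrite /Rintegral; apply: fine_cvg.
by rewrite fineK//; exact: integrable_fin_num.
Qed.

Lemma dominated_convergenceC (g_ : nat -> R -> R[i]) g G :
  (forall n, measurableC (g_ n)) -> measurableC g ->
  (forall t, D t -> cvgC \oo (g_ ^~ t) (g t)) ->
  mu.-integrable D (fun t => (G t)%:E) ->
  (forall n t, D t -> normC (g_ n t) <= G t) ->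
  integrableC g /\ cvgC \oo (fun n => integralC D (g_ n)) (integralC D g).
Proof.
move=> mg_ mg cg iG gG.
have [|||||ir cr] := @dominated_convergence_real
    (fun n t => complex.Re (g_ n t)) (fun t => complex.Re (g t)) G.
- by move=> n; case: (mg_ n).
- by case: mg.
- by move=> t /cg[].
- exact: iG.
- by move=> n t Dt; rewrite (le_trans (normr_Re _))// gG.
have [|||||ii ci] := @dominated_convergence_real
    (fun n t => complex.Im (g_ n t)) (fun t => complex.Im (g t)) G.
- by move=> n; case: (mg_ n).
- by case: mg.
- by move=> t /cg[].
- exact: iG.
- by move=> n t Dt; rewrite (le_trans (normr_Im _))// gG.
by [].
Qed.

Lemma measurableC_sum (g_ : nat -> R -> R[i]) n :
  (forall i, measurableC (g_ i)) ->
  measurableC (fun t => \sum_(0 <= i < n) g_ i t).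
Proof.
move=> mg; elim: n => [|n IH].
  by under eq_fun do rewrite big_nil; exact: measurableC_cst.
by under eq_fun do rewrite big_nat_recr//=; exact: measurableCD.
Qed.

Lemma integralC_sum (g_ : nat -> R -> R[i]) n :
  (forall i, integrableC (g_ i)) ->
  integrableC (fun t => \sum_(0 <= i < n) g_ i t) /\
  integralC D (fun t => \sum_(0 <= i < n) g_ i t) =
  \sum_(0 <= i < n) integralC D (g_ i).
Proof.
move=> ig; elim: n => [|n [IHi IH]].
  rewrite big_nil; under eq_fun do rewrite big_nil.
  split; first by split; exact: integrable0.
  by apply: cplx_eq; rewrite /= Rintegral_cst// mul0r.
split.
  by under eq_fun do rewrite big_nat_recr//=; exact: integrableCD.
rewrite big_nat_recr//= -IH -integralCD//.
by apply: eq_integralC => t _; rewrite big_nat_recr.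
Qed.

Lemma integralC_series (g_ : nat -> R -> R[i]) g G :
  (forall n, measurableC (g_ n)) -> measurableC g ->
  (forall t, D t -> cvgS (g_ ^~ t) (g t)) ->
  mu.-integrable D (fun t => (G t)%:E) ->
  (forall n t, D t -> \sum_(0 <= i < n) normC (g_ i t) <= G t) ->
  integrableC g /\ cvgS (fun n => integralC D (g_ n)) (integralC D g).
Proof.
move=> mg_ mg cg iG gG.
have ig_ n : integrableC (g_ n).
  apply: (integrableC_le (mg_ n) iG) => t Dt.
  rewrite (le_trans _ (gG n.+1 _ Dt))// big_nat_recr//= lerDr.
  by rewrite sumr_ge0// => i _; exact: normC_ge0.
have [|||||ig cv] := @dominated_convergenceC
    (fun n t => \sum_(0 <= i < n) g_ i t) g G => //.
- by move=> n; exact: measurableC_sum.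
- by move=> n t Dt; rewrite (le_trans (normC_sum _ _ _))// gG.
split => //; rewrite /cvgS.
rewrite (_ : series _ = (fun n => integralC D (fun t => \sum_(0 <= i < n) g_ i t)))//.
by apply/funext => n; rewrite (integralC_sum _ ig_).2.
Qed.

End ComplexIntegral.

Section LaplaceIntegral.
Context {R : realType}.
Local Notation mu := (@lebesgue_measure R).
Local Notation P := (`[0, +oo[%classic : set R).
Implicit Types (g h : R -> R[i]) (a b f : R -> R) (s z : R[i]).

Let mP : @measurable _ (measurableTypeR R) P.
Proof. exact: measurable_itv. Qed.

Definition lapI g s := integrableC P (fun t => expC (- (s * t%:C)) * g t).

Definition lap g s : R[i] := integralC P (fun t => expC (- (s * t%:C)) * g t).

Lemma normC_kernel s t : normC (expC (- (s * t%:C))) = expR (- (complex.Re s * t)).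
Proof. by rewrite normC_expC cReN cReM/= mulr0 subr0. Qed.

Lemma lapI_le g G s (sigma : R) : measurableC P g -> sigma <= complex.Re s ->
  mu.-integrable P (fun t => (expR (- (sigma * t)) * G t)%:E) ->
  (forall t, 0 <= t -> normC (g t) <= G t) -> lapI g s.
Proof.
move=> mg ss iG gG; apply: (integrableC_le mP _ iG).
  by apply: measurableCM => //; exact: measurableC_kernel.
move=> t; rewrite /= in_itv/= andbT => t0.
rewrite normCM normC_kernel ler_pM ?expR_ge0 ?normC_ge0 ?gG//.
by rewrite ler_expR lerN2 ler_wpM2r.
Qed.

Lemma lapI_measurable g s : lapI g s -> measurableC P g.
Proof.
move=> /integrableC_measurable H.
have : measurableC P (fun t => expC (s * t%:C) * (expC (- (s * t%:C)) * g t)).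
  apply: measurableCM => //; have := measurableC_kernel P (- s).
  by rewrite (_ : (fun t => _) = (fun t : R => expC (s * t%:C)))//;
    apply/funext => t; rewrite mulNr opprK.
suff -> : (fun t : R => expC (s * t%:C) * (expC (- (s * t%:C)) * g t)) = g by [].
by apply/funext => t; rewrite mulrA -expCD subrr expC0 mul1r.
Qed.

Lemma lapI_mono g s s' : complex.Re s <= complex.Re s' -> lapI g s -> lapI g s'.
Proof.
move=> ss ig; have mg := lapI_measurable ig.
apply: (lapI_le mg ss (G := fun t => normC (g t))) => //.
have := integrable_normC mP ig.
by apply: eq_integrable => // t _; rewrite normCM normC_kernel.
Qed.

Lemma lapID g h s : lapI g s -> lapI h s -> lapI (fun t => g t + h t) s.
Proof.
move=> ig ih; have := integrableCD mP ig ih.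
by apply: (eq_integrableC mP) => t _; rewrite mulrDr.
Qed.

Lemma lapIZ z g s : lapI g s -> lapI (fun t => z * g t) s.
Proof.
move=> ig; have := integrableCZ mP z ig.
by apply: (eq_integrableC mP) => t _; rewrite mulrCA.
Qed.

Lemma lapD g h s : lapI g s -> lapI h s ->
  lap (fun t => g t + h t) s = lap g s + lap h s.
Proof.
move=> ig ih; rewrite /lap -integralCD//.
by apply: eq_integralC => t _; rewrite mulrDr.
Qed.

Lemma lapZ z g s : lapI g s -> lap (fun t => z * g t) s = z * lap g s.
Proof.
move=> ig; rewrite /lap -integralCZ//.
by apply: eq_integralC => t _; rewrite mulrCA.
Qed.

Lemma eq_lap g h s : (forall t, 0 <= t -> g t = h t) -> lap g s = lap h s.
Proof.
by move=> gh; apply: eq_integralC => t; rewrite /= in_itv/= andbT => /gh ->.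
Qed.

Lemma eq_lapI g h s : (forall t, 0 <= t -> g t = h t) -> lapI g s -> lapI h s.
Proof.
by move=> gh; apply: (eq_integrableC mP) => t; rewrite /= in_itv/= andbT => /gh ->.
Qed.

Lemma integrable_ae_eq (D : set R) f (h : R -> R) : @measurable _ (measurableTypeR R) D ->
  measurable_fun D f -> mu.-integrable D (EFin \o h) ->
  {ae mu, forall t, D t -> f t = h t} ->
  mu.-integrable D (EFin \o f) /\
  \int[mu]_(t in D) f t = \int[mu]_(t in D) h t.
Proof.
move=> mD mf ih fh.
have mfE : measurable_fun D (EFin \o f) by apply/measurable_EFinP; exact: mf.
have mhE := measurable_int mu ih.
split.
  apply/integrableP; split; first exact: mfE.
  have /integrableP[_] := ih; apply: le_lt_trans.
  rewrite le_eqVlt; apply/orP; left; apply/eqP; apply: ae_eq_integral.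
  - exact: mD.
  - by apply: measurableT_comp.
  - by apply: measurableT_comp.
  - by apply: (@filterS _ _ (ae_filter_ringOfSetsType mu) _ _ _ fh) => t + Dt => /(_ Dt) /= ->.
rewrite /Rintegral; congr fine; apply: ae_eq_integral.
- exact: mD.
- exact: mfE.
- exact: mhE.
- by apply: (@filterS _ _ (ae_filter_ringOfSetsType mu) _ _ _ fh) => t + Dt => /(_ Dt) /= ->.
Qed.

Lemma conv_restrict_neg a b t : t < 0 -> conv (a \_ P) (b \_ P) t = 0.
Proof.
move=> t0; rewrite /conv (_ : (fun y => _) = cst 0) ?Rintegral_cst// ?mul0r//.
apply/funext => y; rewrite !patchE.
case: ifPn; last by rewrite mul0r.
rewrite inE/= in_itv/= => /andP[h1 _].
case: ifPn; last by rewrite mulr0.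
by rewrite inE/= in_itv/= => /andP[h3 _]; lra.
Qed.

Lemma causal_conv_restrict a b t :
  causal_conv a b t = conv (a \_ P) (b \_ P) t.
Proof.
rewrite /causal_conv /conv Rintegral_mkcond.
apply: eq_Rintegral => x _; rewrite !patchE.
case: ifPn; rewrite ?inE ?notin_setE/= !in_itv/=.
  move=> /andP[x0 xt]; rewrite !mem_set//= in_itv/=; apply/andP; split => //; lra.
move=> xt; case: ifPn; last by rewrite mul0r.
rewrite inE/= in_itv/= => /andP[h1 h2].
case: ifPn; last by rewrite mulr0.
rewrite inE/= in_itv/= => /andP[h3 h4].
by exfalso; apply: xt; apply/andP; split; lra.
Qed.

Lemma measurable_restrictP a : measurable_fun P a -> measurable_fun setT (a \_ P).
Proof. by move=> ma; apply/(measurable_restrictT _ _).1. Qed.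

(** The kernel is multiplicative in t, so that the damped convolution is the
    convolution of the damped factors. *)
Lemma lap_conv a b s : lapI (fun t => (a t)%:C) s -> lapI (fun t => (b t)%:C) s ->
  lapI (fun t => (causal_conv a b t)%:C) s /\
  lap (fun t => (causal_conv a b t)%:C) s =
  lap (fun t => (a t)%:C) s * lap (fun t => (b t)%:C) s.
Proof.
move=> ia ib.
have ma : measurable_fun P a by case: (lapI_measurable ia).
have mb : measurable_fun P b by case: (lapI_measurable ib).
pose A t := expC (- (s * t%:C)) * (a t)%:C; pose B t := expC (- (s * t%:C)) * (b t)%:C.
pose A1 := (fun t => complex.Re (A t)) \_ P; pose A2 := (fun t => complex.Im (A t)) \_ P.
pose B1 := (fun t => complex.Re (B t)) \_ P; pose B2 := (fun t => complex.Im (B t)) \_ P.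
have mk f : mu.-integrable P (fun t => (f t)%:E) -> mu.-integrable setT (EFin \o (f \_ P)).
  by move=> /(integrable_mkcond _ mP).1 => H; rewrite -restrict_EFin; exact: H.
have [iA1 iA2] : mu.-integrable setT (EFin \o A1) /\ mu.-integrable setT (EFin \o A2).
  by case: ia => /mk ? /mk ?.
have [iB1 iB2] : mu.-integrable setT (EFin \o B1) /\ mu.-integrable setT (EFin \o B2).
  by case: ib => /mk ? /mk ?.
pose c1 t := conv A1 B1 t - conv A2 B2 t.
pose c2 t := conv A1 B2 t + conv A2 B1 t.
have ic1 : mu.-integrable setT (EFin \o c1).
  have := integrableB measurableT (integrable_conv iA1 iB1) (integrable_conv iA2 iB2).
  exact: eq_integrable.
have ic2 : mu.-integrable setT (EFin \o c2).
  have := integrableD measurableT (integrable_conv iA1 iB2) (integrable_conv iA2 iB1).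
  exact: eq_integrable.
have intconv p q : mu.-integrable setT (EFin \o p) -> mu.-integrable setT (EFin \o q) ->
    \int[mu]_x conv p q x = (\int[mu]_x p x) * (\int[mu]_x q x).
  move=> ip iq; have := conv_fubini ip iq (w := cst 1) (measurable_cst _).
  move=> H; have {}H := H (fun=> ltac:(by rewrite normr1)).
  rewrite -(RintegralZl _ measurableT iq) (_ : (\int[mu]_x conv p q x) = \int[mu]_t (cst 1 t * conv p q t)).
    by rewrite H; apply: eq_Rintegral => x _; congr (_ * _); apply: eq_Rintegral => y _; rewrite mul1r.
  by apply: eq_Rintegral => x _; rewrite mul1r.
pose c := causal_conv a b.
have mc : measurable_fun P c.
  rewrite /c (funext (causal_conv_restrict a b)).
  by apply: measurable_funTS; apply: measurable_conv; exact: measurable_restrictP.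
have ae_c : {ae mu, forall t, P t -> expC (- (s * t%:C)) * (c t)%:C = c1 t +i* c2 t}.
  have h11 := ae_integrable1 (integrable_conv_kernel iA1 iB1).
  have h22 := ae_integrable1 (integrable_conv_kernel iA2 iB2).
  have h12 := ae_integrable1 (integrable_conv_kernel iA1 iB2).
  have h21 := ae_integrable1 (integrable_conv_kernel iA2 iB1).
  apply: filterS2 (filterI h11 h22) (filterI h12 h21) => t [/= i11 i22] [/= i12 i21].
  rewrite /= in_itv/= andbT => t0.
  pose E := expC (s * t%:C).
  have E1 : (c t)%:C = E * (c1 t +i* c2 t).
    have c1E : c1 t = \int[mu]_x (A1 (t - x) * B1 x - A2 (t - x) * B2 x).
      by rewrite RintegralB.
    have c2E : c2 t = \int[mu]_x (A1 (t - x) * B2 x + A2 (t - x) * B1 x).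
      by rewrite RintegralD.
    have i1 : mu.-integrable setT (EFin \o (fun x => A1 (t - x) * B1 x - A2 (t - x) * B2 x)).
      by have := integrableB measurableT i11 i22; exact: eq_integrable.
    have i2 : mu.-integrable setT (EFin \o (fun x => A1 (t - x) * B2 x + A2 (t - x) * B1 x)).
      by have := integrableD measurableT i12 i21; exact: eq_integrable.
    have key x : (((a \_ P) (t - x) * (b \_ P) x)%:C : R[i]) =
        E * ((A1 (t - x) * B1 x - A2 (t - x) * B2 x) +i*
             (A1 (t - x) * B2 x + A2 (t - x) * B1 x)).
      have -> : (A1 (t - x) * B1 x - A2 (t - x) * B2 x) +i*
             (A1 (t - x) * B2 x + A2 (t - x) * B1 x) =
             (A1 (t - x) +i* A2 (t - x)) * (B1 x +i* B2 x) :> R[i] by [].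
      rewrite /A1 /A2 /B1 /B2 !patchE; case: ifPn => _; last first.
        by rewrite mul0r (_ : point +i* point = 0 :> R[i])// mul0r mulr0.
      case: ifPn => _; last first.
        by rewrite mulr0 (_ : point +i* point = 0 :> R[i])// !mulr0.
      have reim (z : R[i]) : complex.Re z +i* complex.Im z = z by case: z.
      rewrite !reim.
      have -> : E * (A (t - x) * B x) = expC (s * t%:C) *
          (expC (- (s * (t - x)%:C)) * expC (- (s * x%:C))) *
          ((a (t - x))%:C * (b x)%:C) by rewrite /A /B /E; ring.
      rewrite -!expCD.
      have -> : s * t%:C + (- (s * (t - x)%:C) + - (s * x%:C)) = 0.
        by rewrite rmorphB/=; ring.
      by rewrite expC0 mul1r -rmorphM.
    rewrite /c causal_conv_restrict /conv; apply: cplx_eq.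
    - rewrite cReM/= c1E c2E -!RintegralZl// -RintegralB//.
      + by apply: eq_Rintegral => x _; have /(congr1 (@complex.Re R)) := key x; rewrite cReM.
      + by have := integrableZl measurableT (complex.Re E) i1; exact: eq_integrable.
      + by have := integrableZl measurableT (complex.Im E) i2; exact: eq_integrable.
    - rewrite cImM/= c1E c2E -!RintegralZl// -RintegralD//.
      + rewrite -[LHS](mul0r (fine (mu setT))) -Rintegral_cst//.
        by apply: eq_Rintegral => x _; have /(congr1 (@complex.Im R)) := key x; rewrite cImM.
      + by have := integrableZl measurableT (complex.Re E) i2; exact: eq_integrable.
      + by have := integrableZl measurableT (complex.Im E) i1; exact: eq_integrable.
  by rewrite E1 mulrA -expCD addNr expC0 mul1r.
have mC : measurableC P (fun t => expC (- (s * t%:C)) * (c t)%:C).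
  by apply: measurableCM; [exact: measurableC_kernel | exact: measurableC_real].
have iPc f : mu.-integrable setT (EFin \o f) -> mu.-integrable P (EFin \o f).
  by apply: integrableS => //; exact: mP.
have ae1 : {ae mu, forall t, P t -> complex.Re (expC (- (s * t%:C)) * (c t)%:C) = c1 t}.
  by apply: (@filterS _ _ (ae_filter_ringOfSetsType mu) _ _ _ ae_c) => t H Pt; rewrite H.
have ae2 : {ae mu, forall t, P t -> complex.Im (expC (- (s * t%:C)) * (c t)%:C) = c2 t}.
  by apply: (@filterS _ _ (ae_filter_ringOfSetsType mu) _ _ _ ae_c) => t H Pt; rewrite H.
have [J1 J1E] := integrable_ae_eq mP mC.1 (iPc _ ic1) ae1.
have [J2 J2E] := integrable_ae_eq mP mC.2 (iPc _ ic2) ae2.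
split; first by split.
have fullP f : (forall t, t < 0 -> f t = 0) -> \int[mu]_(t in P) f t = \int[mu]_t f t.
  move=> f0; rewrite Rintegral_mkcond; apply: eq_Rintegral => t _; rewrite patchE.
  by case: ifPn => //; rewrite notin_setE/= in_itv/= andbT => /negP; rewrite -ltNge => /f0 ->.
have LA : lap (fun t => (a t)%:C) s = (\int[mu]_t A1 t) +i* (\int[mu]_t A2 t).
  by rewrite /A1 /A2 -!Rintegral_mkcond.
have LB : lap (fun t => (b t)%:C) s = (\int[mu]_t B1 t) +i* (\int[mu]_t B2 t).
  by rewrite /B1 /B2 -!Rintegral_mkcond.
rewrite LA LB; apply: cplx_eq; rewrite ?cReM ?cImM/=.
- rewrite [LHS]J1E fullP; last by move=> t t0; rewrite /c1 !conv_restrict_neg// subrr.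
  by rewrite RintegralB ?intconv//; exact: integrable_conv.
- rewrite [LHS]J2E fullP; last by move=> t t0; rewrite /c2 !conv_restrict_neg// addr0.
  by rewrite RintegralD ?intconv//; exact: integrable_conv.
Qed.

Lemma exp_partial_sum_le (x : R) n : 0 <= x ->
  \sum_(0 <= i < n) x ^+ i / i`!%:R <= expR x.
Proof.
move=> x0; apply: (@nondecreasing_cvgn_le _ (fun n => \sum_(0 <= i < n) x ^+ i / i`!%:R)).
  by apply/nondecreasing_seqP => m; rewrite big_nat_recr//= lerDl divr_ge0// exprn_ge0.
exact: is_cvg_series_exp_coeff.
Qed.

(** Expand the kernel in powers of z: the sum of the moduli of the terms is at
    most exp (rho * t), which the integrability hypothesis absorbs. *)
Lemma lap_taylor g s0 (rho : R) : 0 < rho -> measurableC P g ->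
  mu.-integrable P (fun t => (expR (- ((complex.Re s0 - rho) * t)) * normC (g t))%:E) ->
  exists m : nat -> R[i], forall z, normC z <= rho ->
    lapI g (s0 + z) /\ cvgS (fun n => m n * z ^+ n) (lap g (s0 + z)).
Proof.
move=> rho0 mg iG.
pose k n t := expC_coef (- t%:C) n * (expC (- (s0 * t%:C)) * g t).
exists (fun n => integralC P (k n)) => z zr.
have mh : measurableC P (fun t => expC (- (s0 * t%:C)) * g t).
  by apply: measurableCM => //; exact: measurableC_kernel.
have mcoef n : measurableC P (fun t => expC_coef (- t%:C) n : R[i]).
  rewrite /expC_coef; apply: measurableCM; last exact: measurableC_cst.
  elim: n => [|n IH]; first exact: measurableC_cst.
  rewrite (_ : (fun t => _) = (fun t => - t%:C * (- t%:C) ^+ n)); last first.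
    by apply/funext => t; rewrite exprS.
  apply: measurableCM => //.
  by apply: measurableCN; apply: measurableC_real; exact: measurable_id.
have mk n : measurableC P (k n) by exact: measurableCM.
have ncoef n t : 0 <= t -> normC (expC_coef (- t%:C) n : R[i]) = t ^+ n / n`!%:R.
  move=> t0; rewrite /expC_coef normCM normCX normCN normC_real ger0_norm// normCV.
  by rewrite -(rmorph_nat (real_complex R)) normC_real normr_nat.
have eE t : expR (- (complex.Re s0 * t)) * expR (rho * t) =
    expR (- ((complex.Re s0 - rho) * t)) by rewrite -expRD; congr expR; ring.
have bound n t : 0 <= t -> \sum_(0 <= i < n) (rho ^+ i * normC (k i t)) <=
    expR (- ((complex.Re s0 - rho) * t)) * normC (g t).
  move=> t0.
  have -> : \sum_(0 <= i < n) (rho ^+ i * normC (k i t)) =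
      (\sum_(0 <= i < n) (rho * t) ^+ i / i`!%:R) *
      (expR (- (complex.Re s0 * t)) * normC (g t)).
    rewrite mulr_suml; apply: eq_bigr => i _.
    by rewrite /k normCM (ncoef _ _ t0) normCM normC_kernel exprMn; ring.
  rewrite -eE [_ * expR (rho * t)]mulrC -mulrA ler_wpM2r ?mulr_ge0 ?expR_ge0 ?normC_ge0//.
  by rewrite exp_partial_sum_le// mulr_ge0// ltW.
have ik n : integrableC P (k n).
  apply: (integrableC_le mP (mk n) (G := fun t => rho ^- n *
    (expR (- ((complex.Re s0 - rho) * t)) * normC (g t)))).
    have := integrableZl mP (rho ^- n) iG.
    by apply: eq_integrable => // t _; rewrite EFinM.
  move=> t; rewrite /= in_itv/= andbT => t0.
  rewrite -ler_pdivrMl ?invr_gt0 ?exprn_gt0// invrK.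
  rewrite (le_trans _ (bound n.+1 t t0))// big_nat_recr//= lerDr.
  by rewrite sumr_ge0// => i _; rewrite mulr_ge0 ?normC_ge0// exprn_ge0// ltW.
have [|||||J1 J2] := @integralC_series _ P mP (fun n t => z ^+ n * k n t)
  (fun t => expC (- ((s0 + z) * t%:C)) * g t)
  (fun t => expR (- ((complex.Re s0 - rho) * t)) * normC (g t)).
- by move=> n; apply: measurableCM => //; exact: measurableC_cst.
- by apply: measurableCM => //; exact: measurableC_kernel.
- move=> t _.
  have -> : expC (- ((s0 + z) * t%:C)) * g t =
      expC (- t%:C * z) * (expC (- (s0 * t%:C)) * g t).
    by rewrite mulrA -expCD; congr (expC _ * _); ring.
  rewrite /cvgS (_ : series _ = (fun n => series (expC_coef (- t%:C * z)) n *
      (expC (- (s0 * t%:C)) * g t))).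
    by apply: cvgCM; [exact: expC_series | exact: cvgC_cst].
  apply/funext => n; rewrite /series/= mulr_suml; apply: eq_bigr => i _.
  by rewrite /k /expC_coef exprMn; ring.
- exact: iG.
- move=> n t; rewrite /= in_itv/= andbT => t0.
  rewrite (le_trans _ (bound n t t0))// ler_sum// => i _.
  rewrite normCM normCX ler_wpM2r ?normC_ge0//.
  by rewrite lerXn2r ?nnegrE ?normC_ge0// ltW.
split; first exact: J1.
rewrite (_ : (fun n => _) = (fun n => integralC P (fun t => z ^+ n * k n t)))//.
by apply/funext => n; rewrite integralCZ// mulrC.
Qed.

(** The Taylor expansion in the direction w; a complex w gives analyticity
    along a ray. *)
Lemma lap_analytic g (w v : R[i]) (y r : R) : 0 < r -> w != 0 ->
  measurableC P g ->
  mu.-integrable P (fun t =>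
    (expR (- ((complex.Re (y%:C * w + v) - r * normC w) * t)) * normC (g t))%:E) ->
  analytic_at (fun x => complex.Re (lap g (x%:C * w + v))) y r /\
  analytic_at (fun x => complex.Im (lap g (x%:C * w + v))) y r.
Proof.
move=> r0 w0 mg iG.
have rw : 0 < r * normC w by rewrite mulr_gt0// normC_gt0.
have [m mP'] := lap_taylor rw mg iG.
have H (h : R) : `|h| < r -> cvgS (fun n => m n * w ^+ n * (h ^+ n)%:C)
    (lap g ((y + h)%:C * w + v)).
  move=> hr; have [|_] := mP' (h%:C * w).
    by rewrite normCM normC_real ler_wpM2r ?normC_ge0// ltW.
  rewrite rmorphD/= (_ : y%:C * w + v + h%:C * w = (y%:C + h%:C) * w + v); last by ring.
  suff -> : (fun n => m n * (h%:C * w) ^+ n) = (fun n => m n * w ^+ n * (h ^+ n)%:C) by [].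
  by apply/funext => n; rewrite exprMn rmorphXn/=; ring.
split.
- exists (fun n => complex.Re (m n * w ^+ n)) => h hr.
  have /cvgSP[+ _] := H h hr.
  rewrite /pseries; suff -> : (fun i => complex.Re (m i * w ^+ i * (h ^+ i)%:C)) =
    (fun i => complex.Re (m i * w ^+ i) * h ^+ i) by [].
  by apply/funext => n; rewrite [LHS]cReM/= mulr0 subr0.
- exists (fun n => complex.Im (m n * w ^+ n)) => h hr.
  have /cvgSP[_] := H h hr.
  rewrite /pseries; suff -> : (fun i => complex.Im (m i * w ^+ i * (h ^+ i)%:C)) =
    (fun i => complex.Im (m i * w ^+ i) * h ^+ i) by [].
  by apply/funext => n; rewrite [LHS]cImM/= mulr0 add0r.
Qed.

End LaplaceIntegral.

(** * The k-gamma integral *)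

Section PowerSubstitution.
Context {R : realType}.
Local Notation mu := (@lebesgue_measure R).
Implicit Types (l p c x : R).

Lemma bigcup_itv_pos (u v : nat -> R) :
  (forall n, 0 < u n) -> (forall x, 0 < x -> exists n, u n <= x <= v n) ->
  \bigcup_n `[u n, v n]%classic = `]0, +oo[%classic.
Proof.
move=> u0 uv; apply/seteqP; split => x /=.
  move=> [n _] /=; rewrite !in_itv/= andbT => /andP[h _].
  exact: lt_le_trans (u0 n) h.
by rewrite in_itv/= andbT => /uv[n h]; exists n => //=; rewrite in_itv.
Qed.

(** Change of variables on compact intervals that exhaust the half-line, then
    monotone convergence. *)
Lemma pow_substitution (G : R -> R) l p : 0 < l -> 0 < p ->
  {in `]0, +oo[, continuous G} -> (forall x, 0 < x -> 0 <= G x) ->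
  (\int[mu]_(x in `]0%R, +oo[) (G x)%:E =
   \int[mu]_(x in `]0%R, +oo[) (G (l * x `^ p)%R * (l * p * x `^ (p - 1)%R))%:E)%E.
Proof.
move=> l0 p0 cG G0.
pose F x := l * x `^ p.
pose a n : R := n.+1%:R^-1; pose b n : R := n.+1%:R.
have a0 n : 0 < a n by rewrite invr_gt0.
have b0 n : 0 < b n by [].
have F0 x : 0 < x -> 0 < F x by move=> x0; rewrite mulr_gt0// powR_gt0.
have Finc x y : 0 <= x -> x < y -> F x < F y.
  by move=> x0 xy; rewrite ltr_pM2l// gt0_ltr_powR// nnegrE ltW// (le_lt_trans x0).
have Fle x y : 0 <= x -> x <= y -> F x <= F y.
  by move=> x0; rewrite le_eqVlt => /predU1P[->//|/(Finc _ _ x0)/ltW].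
have arch x : 0 < x -> exists n, a n <= x <= b n.
  move=> x0; pose n := Num.trunc (Num.max x x^-1); exists n.
  have : Num.max x x^-1 <= n.+1%:R by rewrite ltW// truncnS_gt.
  rewrite ge_max => /andP[h1 h2]; rewrite h1 andbT.
  by rewrite /a -[x]invrK lef_pV2 ?posrE// invr_gt0.
have dF x : 0 < x -> is_derive x (1 : R) F (l * p * x `^ (p - 1)).
  move=> x0; have := is_derive1_powR p x0 => d.
  have := is_derive1M (is_derive_cst l x (1 : R)) d.
  by move=> H; apply: (is_derive_eq H); rewrite /= mulr0 addr0 mulrA.
have dF' x : 0 < x -> (derive1 F) x = l * p * x `^ (p - 1).
  by move=> /dF H; rewrite derive1E; exact: derive_val.
have cF x : 0 < x -> {for x, continuous F}.
  move=> /dF H; apply: differentiable_continuous; apply/derivable1_diffP; exact: ex_derive.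
have cpow q x : 0 < x -> {for x, continuous (fun x : R => x `^ q)}.
  move=> x0; apply: differentiable_continuous; apply/derivable1_diffP.
  by apply: derivable_powR; rewrite in_itv/= x0.
have cF' x : 0 < x -> {for x, continuous (fun x => l * p * x `^ (p - 1))}.
  by move=> x0; apply: cvgM; [exact: cvg_cst | exact: cpow].
have cF'E x : 0 < x -> {for x, continuous (derive1 F)}.
  move=> x0; rewrite /prop_for /continuous_at dF'//.
  apply: cvg_trans (cF' x x0); apply: near_eq_cvg.
  by near=> y; rewrite dF'//; near: y; exact: lt_nbhsr.
have step n : (\int[mu]_(x in `[F (a n), F (b n)]) (G x)%:E =
    \int[mu]_(x in `[a n, b n]) (G (F x) * (l * p * x `^ (p - 1)%R))%:E)%E.
  have ab : a n < b n \/ a n = b n.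
    have : a n <= b n by rewrite (@le_trans _ _ 1)// ?invf_le1// ler1n.
    by rewrite le_eqVlt => /predU1P[->|]; [right|left].
  case: ab => [ab|->]; last by rewrite !set_itv1 !integral_set1.
  rewrite (@integration_by_substitution_increasing _ F G (a n) (b n)) ?ltW//.
  - apply: eq_integral => x; rewrite inE/= in_itv/= => /andP[ax _].
    rewrite -[LHS]/((G (F x) * derive1 F x)%:E) dF'//.
    exact: lt_le_trans (a0 n) ax.
  - move=> x y; rewrite !in_itv/= => /andP[ax _] _; apply: Finc.
    by rewrite (le_trans _ ax)// ltW.
  - by move=> x; rewrite in_itv/= => /andP[ax _]; apply: cF'E; rewrite (lt_trans (a0 n)).
  - apply/cvg_ex; exists ((derive1 F) (a n)); apply: cvg_at_right_filter.
    exact: cF'E.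
  - apply/cvg_ex; exists ((derive1 F) (b n)); apply: cvg_at_left_filter.
    exact: cF'E.
  - split.
    + by move=> x; rewrite in_itv/= => /andP[ax _]; apply: ex_derive; apply: dF; rewrite (lt_trans (a0 n)).
    + by apply: cvg_at_right_filter; exact: cF.
    + by apply: cvg_at_left_filter; exact: cF.
  - apply: continuous_in_subspaceT => x; rewrite inE/= in_itv/= => /andP[ax _].
    by apply: cG; rewrite in_itv/= andbT (lt_le_trans _ ax)// F0.
have mG : measurable_fun (`]0, +oo[%classic : set R) G.
  by apply: open_continuous_measurable_fun => // x; rewrite inE/=; exact: cG.
have mGF : measurable_fun (`]0, +oo[%classic : set R) (fun x => G (F x) * (l * p * x `^ (p - 1))).
  apply: open_continuous_measurable_fun => // x; rewrite inE/= in_itv/= andbT => x0.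
  apply: cvgM; last exact: cF'.
  by apply: (cvg_comp _ _ (cF x x0)); apply: cG; rewrite in_itv/= andbT F0.
have UF : \bigcup_n `[F (a n), F (b n)]%classic = `]0, +oo[%classic.
  apply: bigcup_itv_pos => [n|x x0]; first exact: F0.
  have [n /andP[h1 h2]] := arch ((x / l) `^ p^-1) ltac:(by rewrite powR_gt0// divr_gt0).
  exists n; have E : F ((x / l) `^ p^-1) = x.
    rewrite /F -powRrM mulVf ?gt_eqF// powRr1 ?divr_ge0 ?ltW//.
    by rewrite mulrC divfK// gt_eqF.
  by rewrite -{1 2}E !Fle// ?powR_ge0// ltW.
have Ua : \bigcup_n `[a n, b n]%classic = `]0, +oo[%classic by exact: bigcup_itv_pos.
have ale m n : (m <= n)%N -> a n <= a m.
  by move=> mn; rewrite lef_pV2 ?posrE// ler_nat.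
have ble m n : (m <= n)%N -> b m <= b n by move=> mn; rewrite ler_nat.
have c1 := @ge0_nondecreasing_set_cvg_integral _ (measurableTypeR R) R (fun n => `[F (a n), F (b n)]%classic)
  (fun x => (G x)%:E) mu.
have c2 := @ge0_nondecreasing_set_cvg_integral _ (measurableTypeR R) R (fun n => `[a n, b n]%classic)
  (fun x => (G (F x) * (l * p * x `^ (p - 1)))%:E) mu.
rewrite -{1}UF -Ua.
have c1' : (\int[mu]_(x in `[F (a i), F (b i)]) (G x)%:E)%E @[i --> \oo] -->
    (\int[mu]_(x in \bigcup_i `[F (a i), F (b i)]%classic) (G x)%:E)%E.
  apply: c1.
  - apply/nondecreasing_seqP => n; rewrite subsetEset; apply: subset_itv; by rewrite bnd_simp Fle ?ale ?ble// ltW ?a0 ?b0.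
  - by move=> i; exact: measurable_itv.
  - move=> i; apply/measurable_EFinP; apply: measurable_funS mG => //.
    by rewrite -UF => x xi; exists i.
  - move=> i x /=; rewrite in_itv/= lee_fin => /andP[h _]; apply: G0.
    by rewrite (lt_le_trans _ h)// F0.
have c2' : (\int[mu]_(x in `[F (a i), F (b i)]) (G x)%:E)%E @[i --> \oo] -->
    (\int[mu]_(x in \bigcup_i `[a i, b i]%classic) (G (F x) * (l * p * x `^ (p - 1)))%:E)%E.
  under eq_fun do rewrite step.
  apply: c2.
  - apply/nondecreasing_seqP => n; rewrite subsetEset; apply: subset_itv; rewrite bnd_simp ?ale ?ble//.
  - by move=> i; exact: measurable_itv.
  - move=> i; apply/measurable_EFinP; apply: measurable_funS mGF => //.
    by rewrite -Ua => x xi; exists i.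
  - move=> i x /=; rewrite in_itv/= lee_fin => /andP[h _].
    have x0 : 0 < x by rewrite (lt_le_trans _ h).
    by rewrite mulr_ge0 ?G0 ?F0// !mulr_ge0 ?powR_ge0// ltW.
exact: (cvg_unique (@ereal_hausdorff R) c1' c2').
Unshelve. all: by end_near. Qed.

Local Notation P := (`[0, +oo[%classic : set R).
Local Notation P' := (`]0, +oo[%classic : set R).

Lemma exp_ge_pow (y : R) m : 0 <= y -> y ^+ m <= m`!%:R * expR y.
Proof.
move=> y0; rewrite mulrC -ler_pdivrMr ?ltr0n ?fact_gt0//.
rewrite (le_trans _ (exp_partial_sum_le m.+1 y0))// big_nat_recr//= lerDr.
by rewrite sumr_ge0// => i _; rewrite divr_ge0// exprn_ge0.
Qed.

Lemma oneDsqr_exp_bound c q : 0 < c -> 0 < q -> exists C, forall x, 0 < x ->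
  (1 + x ^+ 2) * expR (- (c * x `^ q)) <= C.
Proof.
move=> c0 q0; pose m := (Num.trunc (2 / q)).+1.
have mq : 2 / q <= m%:R by rewrite ltW// truncnS_gt.
exists (2 + m`!%:R / c ^+ m) => x x0.
rewrite expRN ler_pdivrMr ?expR_gt0//.
have y0 : 0 < c * x `^ q by rewrite mulr_gt0// powR_gt0.
have e1 : 1 <= expR (c * x `^ q) by rewrite -expR0 ler_expR ltW.
have xq : x ^+ 2 <= 1 + (x `^ q) ^+ m.
  have [x1|x1] := leP x 1.
    rewrite (@le_trans _ _ 1)//; first by rewrite expr_le1// ltW.
    by rewrite lerDl exprn_ge0// powR_ge0.
  rewrite (@le_trans _ _ ((x `^ q) ^+ m))//; last by rewrite lerDr.
  have -> : (x `^ q) ^+ m = x `^ (q * m%:R) by rewrite -powR_mulrn ?powR_ge0// -powRrM.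
  rewrite -powR_mulrn ?(ltW x0)// ler_powR ?(ltW x1)//.
  by move: mq; rewrite ler_pdivrMr// mulrC.
have := exp_ge_pow m (ltW y0).
rewrite exprMn -ler_pdivlMl ?exprn_gt0// => h.
rewrite (@le_trans _ _ (2 + (c ^+ m)^-1 * (m`!%:R * expR (c * x `^ q))))//; first by lra.
rewrite mulrDl lerD//; first lra.
by rewrite mulrA [_^-1 * _]mulrC.
Qed.

Let measP' (f : R -> R) : measurable_fun setT f ->
  measurable_fun P' (fun x => (f x)%:E).
Proof. by move=> mf; apply/measurable_EFinP; exact: measurable_funTS. Qed.

Lemma measurable_exp_pow c q : measurable_fun setT (fun x : R => expR (- (c * x `^ q))).
Proof.
apply: (measurableT_comp (@measurable_expR R)); apply: measurableT_comp => //.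
by apply: measurable_funM; [exact: measurable_cst | exact: measurable_powR].
Qed.

Lemma continuous_exp_pow c q x : 0 < x ->
  {for x, continuous (fun x : R => expR (- (c * x `^ q)))}.
Proof.
move=> x0.
have d1 := is_derive1M (is_derive_cst c x (1 : R)) (is_derive1_powR q x0).
have d2 := is_deriveN d1.
have d3 := is_derive1comp (q := fun x : R => - (c * x `^ q)) (is_derive_expR _) d2.
by apply: differentiable_continuous; apply/derivable1_diffP; exact: ex_derive.
Qed.

Lemma exp_pow_integral c q : 0 < c -> 0 < q ->
  (0 < \int[mu]_(x in P') (expR (- (c * x `^ q)%R))%:E < +oo)%E.
Proof.
move=> c0 q0; apply/andP; split.
  have sub : `]0, 1]%classic `<=` P'.
    by move=> x /=; rewrite !in_itv/= andbT => /andP[].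
  apply: (@lt_le_trans _ _ (\int[mu]_(x in `]0%R, 1%R]) (expR (- c))%:E)%E).
    rewrite integral_cst//= lebesgue_measure_itv/= lte_fin ltr01.
    by rewrite -EFinB -EFinM lte_fin subr0 mulr1 expR_gt0.
  apply: (@le_trans _ _ (\int[mu]_(x in `]0%R, 1%R]) (expR (- (c * x `^ q)%R))%:E)%E).
    apply: ge0_le_integral => //.
    - by apply/measurable_EFinP; apply: measurable_funTS; exact: measurable_exp_pow.
    - move=> x /=; rewrite in_itv/= => /andP[x0 x1].
      rewrite lee_fin ler_expR lerN2 ler_piMr ?(ltW c0)//.
      rewrite (_ : 1 = 1 `^ q); last by rewrite powR1.
      by rewrite ge0_ler_powR ?nnegrE// ltW.
  apply: ge0_subset_integral => //.
  - exact: measP' (measurable_exp_pow c q).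
have [C CP] := oneDsqr_exp_bound c0 q0.
have C0 : 0 <= C by rewrite (le_trans _ (CP 1 ltr01))// mulr_ge0 ?expR_ge0// addr_ge0.
have md : measurable_fun P' (fun x : R => (oneDsqr x)^-1%:E).
  apply/measurable_EFinP; apply: measurable_funTS; apply: continuous_measurable_fun.
  exact: continuous_oneDsqrV.
apply: (@le_lt_trans _ _ (\int[mu]_(x in P') (C%:E * (oneDsqr x)^-1%:E))%E).
  apply: ge0_le_integral => //.
  - exact: measP' (measurable_exp_pow c q).
  - by apply: emeasurable_funM.
  - move=> x /=; rewrite in_itv/= andbT => x0; rewrite -EFinM lee_fin.
    by rewrite ler_pdivlMr ?oneDsqr_gt0// mulrC; exact: CP.
rewrite ge0_integralZl//.
by rewrite integral_itv_obnd_cbnd// integral0y_oneDsqr -EFinM ltry.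
Qed.

(** The substitution of the z-th power of x removes the factor that is
    singular at 0 when z < 1. *)
Lemma integral_gamma_pow c k z : 0 < c -> 0 < k -> 0 < z ->
  (\int[mu]_(x in P') (expR (- (c * x `^ (k / z))%R))%:E =
   z%:E * \int[mu]_(x in P') (expR (- (c * x `^ k)%R) * x `^ (z - 1)%R)%:E)%E.
Proof.
move=> c0 k0 z0.
have cG : {in `]0, +oo[, continuous (fun x : R => expR (- (c * x `^ (k / z))))}.
  by move=> x; rewrite in_itv/= andbT; exact: continuous_exp_pow.
rewrite (pow_substitution ltr01 z0 cG); last by move=> x _; exact: expR_ge0.
rewrite -ge0_integralZl//; last 3 first.
- apply/measurable_EFinP; apply: measurable_funTS; apply: measurable_funM.
    exact: measurable_exp_pow.
  exact: measurable_powR.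
- by move=> x _; rewrite lee_fin mulr_ge0 ?expR_ge0 ?powR_ge0.
- by rewrite lee_fin ltW.
apply: eq_integral => x; rewrite inE/= in_itv/= andbT => x0.
rewrite !mul1r -powRrM (_ : z * (k / z) = k); last by field; rewrite gt_eqF.
by rewrite -EFinM; congr EFin; ring.
Qed.

Lemma integral_exp_pow_scale c q l : 0 < c -> 0 < q -> 0 < l ->
  (\int[mu]_(x in P') (expR (- (c * x `^ q)%R))%:E =
   l%:E * \int[mu]_(x in P') (expR (- ((c * l `^ q) * x `^ q)%R))%:E)%E.
Proof.
move=> c0 q0 l0.
have cG : {in `]0, +oo[, continuous (fun x : R => expR (- (c * x `^ q)))}.
  by move=> x; rewrite in_itv/= andbT; exact: continuous_exp_pow.
rewrite (pow_substitution l0 ltr01 cG); last by move=> x _; exact: expR_ge0.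
rewrite -ge0_integralZl//; last 2 first.
- exact: measP' (measurable_exp_pow _ q).
- by rewrite lee_fin ltW.
apply: eq_integral => x; rewrite inE/= in_itv/= andbT => x0.
rewrite subrr powRr0 !mulr1 powRr1 ?(ltW x0)// powRM ?ltW// -EFinM mulrA; congr EFin.
by rewrite mulrC.
Qed.

(** After substitution the Gamma integral becomes that of a bounded function
    with fast decay, visibly finite and positive. *)
Lemma kGammaP k z : 0 < k -> 0 < z -> 0 < kGamma k z /\
  (\int[mu]_(x in P') (expR (- (k^-1 * x `^ (k / z))%R))%:E = (z * kGamma k z)%:E)%E.
Proof.
move=> k0 z0.
have k'0 : 0 < k^-1 by rewrite invr_gt0.
have kz0 : 0 < k / z by rewrite divr_gt0.
have /andP[I0 I1] := exp_pow_integral k'0 kz0.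
have E : (z%:E * \int[mu]_(x in P) (expR (- (x `^ k / k)%R) * x `^ (z - 1)%R)%:E =
    \int[mu]_(x in P') (expR (- (k^-1 * x `^ (k / z))%R))%:E)%E.
  rewrite (integral_gamma_pow k'0 k0 z0); congr (_ * _)%E.
  rewrite -integral_itv_obnd_cbnd.
    by apply: eq_integral => x _; rewrite [k^-1 * _]mulrC.
  apply/measurable_EFinP; apply: measurable_funTS; apply: measurable_funM.
    have := measurable_exp_pow k^-1 k.
    by under eq_fun do rewrite mulrC.
  exact: measurable_powR.
set J := (\int[mu]_(x in P) _)%E in E.
have J0 : (0 <= J)%E.
  by apply: integral_ge0 => x _; rewrite lee_fin mulr_ge0 ?expR_ge0 ?powR_ge0.
have Jfin : J \is a fin_num.
  rewrite ge0_fin_numE//; move: I1; rewrite -E; move: J0; generalize J => -[r||]//=.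
    by move=> _ _; exact: ltry.
  by rewrite gt0_muley ?lte_fin.
have JE : J = (kGamma k z)%:E by rewrite /kGamma /Rintegral fineK.
move: E I0; rewrite JE -EFinM => <-; rewrite lte_fin => h; split => //.
by rewrite -(pmulr_rgt0 _ z0).
Qed.

(** Once the powers of x are removed by substitution, this integral and the
    Gamma integral are scalings of each other. *)
Lemma integral_exp_powR k beta sigma : 0 < k -> 0 < beta -> 0 < sigma ->
  (\int[mu]_(x in P) (expR (- (sigma * x)%R) * x `^ (beta - 1)%R)%:E =
   (k * (k * sigma) `^ (- beta) * kGamma k (k * beta))%:E)%E.
Proof.
move=> k0 b0 s0.
have k'0 : 0 < k^-1 by rewrite invr_gt0.
have kb0 : 0 < k * beta by rewrite mulr_gt0.
have [g0 gE] := kGammaP k0 kb0.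
have m1 : measurable_fun setT (fun x : R => expR (- (sigma * x)) * x `^ (beta - 1)).
  apply: measurable_funM; last exact: measurable_powR.
  apply: (measurableT_comp (@measurable_expR R)).
  apply: (@measurableT_comp _ _ _ _ _ _ (@GRing.opp R)) => //.
rewrite -integral_itv_obnd_cbnd; last first.
  by apply/measurable_EFinP; exact: measurable_funTS m1.
have H := integral_gamma_pow s0 ltr01 b0.
have b'0 : 0 < 1 / beta by rewrite divr_gt0.
pose l := (k * sigma) `^ (- beta).
have l0 : 0 < l by rewrite powR_gt0// mulr_gt0.
have ll : sigma * l `^ (1 / beta) = k^-1.
  rewrite /l -powRrM mulNr div1r mulfV ?gt_eqF// powR_inv1 ?mulr_ge0 ?ltW//.
  by field; rewrite !gt_eqF.
rewrite (integral_exp_pow_scale s0 b'0 l0) ll in H.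
have kbE : k / (k * beta) = 1 / beta by field; rewrite !gt_eqF.
rewrite -kbE gE -EFinM in H.
have -> : (\int[mu]_(x in P') (expR (- (sigma * x)%R) * x `^ (beta - 1)%R)%:E =
  \int[mu]_(x in P') (expR (- (sigma * x `^ 1)%R) * x `^ (beta - 1)%R)%:E)%E.
  apply: eq_integral => x; rewrite inE/= in_itv/= andbT => x0.
  by rewrite powRr1// ltW.
set J := (\int[mu]_(x in P') _)%E in H *.
have J0 : (0 <= J)%E.
  by apply: integral_ge0 => x _; rewrite lee_fin mulr_ge0 ?expR_ge0 ?powR_ge0.
case: J J0 H => [r||]// _.
- rewrite -EFinM => -[] H; congr EFin; apply: (mulfI (lt0r_neq0 b0)).
  by rewrite -H -/l; ring.
- by rewrite gt0_muley ?lte_fin.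
Qed.

End PowerSubstitution.

(** * Laplace integrals of powers *)

Section PowerKernels.
Context {R : realType}.
Local Notation mu := (@lebesgue_measure R).
Local Notation P := (`[0, +oo[%classic : set R).
Local Notation P' := (`]0, +oo[%classic : set R).
Implicit Types (k sigma t g : R) (s w z : R[i]).

Lemma eq_cvgC (T : Type) (F : set_system T) (f h : T -> R[i]) (l : R[i]) :
  f = h -> cvgC F f l -> cvgC F h l.
Proof. by move=> ->. Qed.

Lemma eq_cvgS (a b : nat -> R[i]) l : (forall n, a n = b n) -> cvgS a l -> cvgS b l.
Proof. by move=> ab; have -> : a = b by apply/funext. Qed.

Lemma cvgSZ (a : nat -> R[i]) z l : cvgS a l -> cvgS (fun n => z * a n) (z * l).
Proof.
move=> al; apply: (eq_cvgC (f := fun n => z * series a n)).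
  by apply/funext => n; rewrite /series /= mulr_sumr.
by apply: cvgCM => //; exact: cvgC_cst.
Qed.

Lemma cvgSB (a b : nat -> R[i]) l m : cvgS a l -> cvgS b m ->
  cvgS (fun n => a n - b n) (l - m).
Proof.
move=> al bm; apply: (eq_cvgC (f := fun n => series a n + - series b n)).
  by apply/funext => n; rewrite /series /= -sumrN -big_split.
by apply: cvgCD => //; exact: cvgCN.
Qed.

Lemma measurable_exp_linear sigma :
  measurable_fun [set: R] (fun t => expR (- (sigma * t))).
Proof.
apply: (measurableT_comp (@measurable_expR R)).
by apply: (@measurableT_comp _ _ _ _ _ _ (@GRing.opp R)).
Qed.

(** Normalized so that its Laplace transform is the power - b of k * s. *)
Definition gpow k (b t : R) : R := t `^ (b - 1) / (k * kGamma k (k * b)).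

Lemma gpow_ge0 k b t : 0 < k -> 0 < b -> 0 <= gpow k b t.
Proof.
move=> k0 b0; have [g0 _] := kGammaP k0 (mulr_gt0 k0 b0).
by rewrite divr_ge0 ?powR_ge0// ltW// mulr_gt0.
Qed.

Lemma measurable_gpow k b : measurable_fun [set: R] (gpow k b).
Proof.
by apply: measurable_funM; [exact: measurable_powR | exact: measurable_cst].
Qed.

Lemma measurable_exp_gpow k b sigma :
  measurable_fun [set: R] (fun t => expR (- (sigma * t)) * gpow k b t).
Proof.
apply: measurable_funM; last exact: measurable_gpow.
exact: measurable_exp_linear.
Qed.

Lemma integral_exp_gpow k b sigma : 0 < k -> 0 < b -> 0 < sigma ->
  (\int[mu]_(t in P) (expR (- (sigma * t)%R) * gpow k b t)%:E =
   ((k * sigma) `^ (- b))%:E)%E.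
Proof.
move=> k0 b0 s0; have [g0 _] := kGammaP k0 (mulr_gt0 k0 b0).
have := integral_exp_powR k0 b0 s0; set c := k * kGamma k (k * b).
have c0 : 0 < c by rewrite mulr_gt0.
under [in X in _ -> X]eq_integral.
  move=> t _; rewrite /gpow -/c mulrA mulrC EFinM; over.
rewrite ge0_integralZl//.
- move=> ->; rewrite -EFinM; congr EFin; rewrite mulrAC -/c.
  by rewrite mulrA mulVf ?mul1r// gt_eqF.
- apply/measurable_EFinP; apply: measurable_funTS; apply: measurable_funM.
    exact: measurable_exp_linear.
  exact: measurable_powR.
- by move=> t _; rewrite lee_fin mulr_ge0 ?expR_ge0 ?powR_ge0.
- by rewrite lee_fin invr_ge0 ltW.
Qed.

Lemma integrable_exp_gpow k b sigma : 0 < k -> 0 < b -> 0 < sigma ->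
  mu.-integrable P (fun t => (expR (- (sigma * t)) * gpow k b t)%:E).
Proof.
move=> k0 b0 s0; apply/integrableP; split.
  by apply/measurable_EFinP; apply: measurable_funTS; exact: measurable_exp_gpow.
have -> : (\int[mu]_(t in P) `|(expR (- (sigma * t)%R) * gpow k b t)%:E| =
    \int[mu]_(t in P) (expR (- (sigma * t)%R) * gpow k b t)%:E)%E.
  apply: eq_integral; by move=> t _; rewrite gee0_abs// lee_fin mulr_ge0 ?expR_ge0 ?gpow_ge0.
by rewrite integral_exp_gpow// ltry.
Qed.

Lemma measurableC_gpow k b : measurableC P (fun t => (gpow k b t)%:C).
Proof.
by apply: measurableC_real; apply: measurable_funTS; exact: measurable_gpow.
Qed.

Lemma lapI_gpow k b s : 0 < k -> 0 < b -> 0 < complex.Re s ->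
  lapI (fun t => (gpow k b t)%:C) s.
Proof.
move=> k0 b0 s0; apply: (lapI_le (G := gpow k b) (measurableC_gpow k b) (lexx _)).
  exact: integrable_exp_gpow.
by move=> t t0; rewrite normC_real ger0_norm ?gpow_ge0.
Qed.

Lemma lap_gpow_real k b sigma : 0 < k -> 0 < b -> 0 < sigma ->
  lap (fun t => (gpow k b t)%:C) sigma%:C = ((k * sigma) `^ (- b))%:C.
Proof.
move=> k0 b0 s0; have H := integral_exp_gpow k0 b0 s0.
apply: cplx_eq; rewrite /lap /integralC /=.
- rewrite -[RHS]/(fine _%:E) -H /Rintegral; congr fine; apply: eq_integral => t _.
  by rewrite !(mul0r, mulr0, subr0, addr0) oppr0 cos0 mulr1.
- rewrite /Rintegral integral0_eq// => t _; congr EFin.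
  by rewrite !(mul0r, mulr0, subr0, addr0, add0r) oppr0 sin0 mulr0 mul0r.
Qed.

(** For real s this is the Gamma integral. The Taylor series of the left-hand
    side at a real point s0 reaches s when s0 is large, and its coefficients are
    those of a binomial series because both sides agree on a real segment. *)
Lemma lap_gpow k b s : 0 < k -> 0 < b -> 0 < complex.Re s ->
  lap (fun t => (gpow k b t)%:C) s = powC (k%:C * s) (- b)%:C.
Proof.
move=> k0 b0 a0; set a := complex.Re s in a0 *.
pose n2 := a ^+ 2 + complex.Im s ^+ 2.
(* The disc of radius s0 about s0 contains s exactly when 2 * a * s0 exceeds
   n2. *)
pose s0 := n2 / a.
have n20 : 0 < n2 by rewrite ltr_pwDl ?exprn_gt0// sqr_ge0.
have s00 : 0 < s0 by rewrite divr_gt0.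
have ds : normC (s - s0%:C) < s0.
  rewrite normCE -[ltRHS]ger0_norm ?(ltW s00)// -sqrtr_sqr ltr_sqrt ?exprn_gt0//.
  rewrite !ReImE /= -/a oppr0 addr0.
  have E : s0 * a = n2 by rewrite /s0 divfK// gt_eqF.
  have -> : (a - s0) ^+ 2 + complex.Im s ^+ 2 = n2 - 2 * (s0 * a) + s0 ^+ 2.
    by rewrite /n2; ring.
  by rewrite E; lra.
pose rho := (normC (s - s0%:C) + s0) / 2.
have rho0 : 0 < rho by rewrite divr_gt0// ltr_wpDl ?normC_ge0.
have rhos : rho < s0 by rewrite /rho; lra.
have drho : normC (s - s0%:C) <= rho by rewrite /rho; lra.
have [|m mP] := @lap_taylor R (fun t => (gpow k b t)%:C) s0%:C rho rho0 (measurableC_gpow k b).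
  have := @integrable_exp_gpow k b (s0 - rho) k0 b0.
  rewrite subr_gt0 => /(_ rhos); apply: eq_integrable => // t _.
  by rewrite normC_real ger0_norm ?gpow_ge0.
pose bc n : R[i] := ((k * s0) `^ (- b))%:C * ((bin_coef b n)%:C * (- s0^-1%:C) ^+ n).
have bcP z : normC z < s0 -> cvgS (fun n => bc n * z ^+ n) (powC (k%:C * (s0%:C + z)) (- b)%:C).
  move=> zs0; pose z' := - (s0^-1%:C * z).
  have z'1 : normC z' < 1.
    by rewrite normCN normCM normC_real ger0_norm ?invr_ge0 ?ltW// ltr_pdivrMl// mulr1.
  have E : k%:C * (s0%:C + z) = (k * s0)%:C * (1 - z').
    have e : s0%:C * (s0^-1)%:C = 1 :> R[i] by rewrite -rmorphM mulfV ?gt_eqF.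
    have e2 : (k * s0)%:C = k%:C * s0%:C :> R[i] by rewrite -rmorphM.
    by rewrite e2 /z' opprK -mulrA (mulrDr s0%:C) mulr1 (mulrA s0%:C) e mul1r.
  have ks0 : 0 < k * s0 by exact: mulr_gt0.
  rewrite E (powC_posM _ ks0); last first.
    have := norm_lt1_right (x := 1) z'1; rewrite mul1r; apply.
    by rewrite ler01 lexx.
  apply: eq_cvgS (cvgSZ _ (binomial_series b z'1)) => n.
  by rewrite /bc /z' -!mulrA; congr (_ * (_ * _)); rewrite -exprMn mulNr.
have mbc n : m n = bc n.
  apply/eqP; rewrite -subr_eq0; apply/eqP.
  have main x : 0 < x < rho -> cvgS (fun n => (m n - bc n) * (x ^+ n)%:C) 0.
    move=> /andP[x0 xr].
    have nx : normC x%:C = x by rewrite normC_real ger0_norm// ltW.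
    have [|_ H1] := mP x%:C; first by rewrite nx ltW.
    have H2 := bcP x%:C; rewrite nx in H2.
    have {}H2 := H2 (lt_trans xr rhos).
    have E : lap (fun t => (gpow k b t)%:C) (s0%:C + x%:C) =
             powC (k%:C * (s0%:C + x%:C)) (- b)%:C.
      by rewrite -rmorphD lap_gpow_real ?addr_gt0// -rmorphM powC_pos// mulr_gt0// addr_gt0.
    rewrite E in H1; have := cvgSB H1 H2; rewrite subrr.
    by apply: eq_cvgS => i; rewrite rmorphXn/= mulrBl.
  apply: cplx_eq.
  - apply: (@pseries_eq0 _ (fun n => complex.Re (m n - bc n)) _ rho0) => x /main/cvgSP[h _].
    have E i : complex.Re ((m i - bc i) * (x ^+ i)%:C) = complex.Re (m i - bc i) * x ^+ i.
      by rewrite cReM /= mulr0 subr0.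
    by rewrite (funext E) in h.
  - apply: (@pseries_eq0 _ (fun n => complex.Im (m n - bc n)) _ rho0) => x /main/cvgSP[_ h].
    have E i : complex.Im ((m i - bc i) * (x ^+ i)%:C) = complex.Im (m i - bc i) * x ^+ i.
      by rewrite cImM /= mulr0 add0r.
    by rewrite (funext E) in h.
have [_ H1] := mP _ drho.
have H2 := bcP _ ds.
rewrite [s0%:C + _]addrC subrK in H1 H2.
apply: cvgC_unique H1 _.
by apply: eq_cvgS H2 => n; rewrite mbc.
Qed.

End PowerKernels.

(** * Series of powers and the Prabhakar kernel *)

Section SeriesKernels.
Context {R : realType}.
Local Notation mu := (@lebesgue_measure R).
Local Notation P := (`[0, +oo[%classic : set R).
Local Notation P' := (`]0, +oo[%classic : set R).
Implicit Types (g : R -> R[i]) (s z w : R[i]).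

Lemma is_cvgS_abs (a : nat -> R[i]) : cvgn (series (fun n => normC (a n))) ->
  exists l, cvgS a l.
Proof.
move=> h.
have hr : cvgn (series (fun n => complex.Re (a n))).
  apply: normed_cvg; apply: series_le_cvg h => n //=; first exact: normC_ge0.
  exact: normr_Re.
have hi : cvgn (series (fun n => complex.Im (a n))).
  apply: normed_cvg; apply: series_le_cvg h => n //=; first exact: normC_ge0.
  exact: normr_Im.
exists (limn (series (fun n => complex.Re (a n))) +i*
        limn (series (fun n => complex.Im (a n)))).
by apply/cvgSP; split.
Qed.

Lemma integrable_obnd_cbnd (f : R -> \bar R) :
  mu.-integrable P' f -> mu.-integrable P f.
Proof.
move=> /integrableP[mf lf]; apply/integrableP; split.
  exact/emeasurable_fun_itv_obnd_cbndP.
by rewrite -integral_itv_obnd_cbnd//; exact: measurableT_comp.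
Qed.

Lemma integrableC_obnd_cbnd g : integrableC P' g ->
  integrableC P g /\ integralC P' g = integralC P g.
Proof.
move=> [hr hi]; split; first by split; exact: integrable_obnd_cbnd.
by apply: cplx_eq; rewrite /integralC /= Rintegral_itv_obnd_cbnd.
Qed.

Variables (k : R) (b : nat -> R) (c : nat -> R[i]) (sigma : R).
Hypotheses (k0 : 0 < k) (b0 : 0 < b 0%N) (b_ge : forall n, b 0%N <= b n).
Hypothesis (sigma0 : 0 < sigma).
Hypothesis summable : cvgn (series (fun n => normC (c n) * (k * sigma) `^ (- b n))).

Let bn0 n : 0 < b n. Proof. exact: lt_le_trans (b_ge n). Qed.
Let e n t := expR (- (sigma * t)) * (normC (c n) * gpow k (b n) t).
Let e0 n t : 0 <= e n t.
Proof.
apply: mulr_ge0; first exact: expR_ge0.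
by apply: mulr_ge0; [exact: normC_ge0 | exact: gpow_ge0].
Qed.
Let S t : \bar R := (\sum_(n <oo) (e n t)%:E)%E.
Let mP' : @measurable _ (measurableTypeR R) P'.
Proof. exact: measurable_itv. Qed.
Let me n : measurable_fun P' (fun t => (e n t)%:E).
Proof.
apply/measurable_EFinP; apply: measurable_funTS; apply: measurable_funM.
  exact: measurable_exp_linear.
by apply: measurable_funM; [exact: measurable_cst | exact: measurable_gpow].
Qed.

Let integral_e n : (\int[mu]_(t in P') (e n t)%:E =
  (normC (c n) * (k * sigma) `^ (- b n))%:E)%E.
Proof.
rewrite integral_itv_obnd_cbnd// EFinM -(integral_exp_gpow k0 (bn0 n) sigma0).
rewrite -ge0_integralZl//.
- by apply: eq_integral => t _; rewrite -EFinM /e mulrCA.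
- apply/measurable_EFinP; apply: measurable_funTS; exact: measurable_exp_gpow.
- by move=> t _; rewrite lee_fin mulr_ge0 ?expR_ge0 ?gpow_ge0.
- by rewrite lee_fin normC_ge0.
Qed.

Let S0 t : (0 <= S t)%E.
Proof. by apply: nneseries_ge0 => n _ _; rewrite lee_fin. Qed.

Let mS : measurable_fun P' S.
Proof.
have -> : S = fun t => (\sum_(i <oo | i \in xpredT) (e i t)%:E)%E.
  by apply/funext => t; apply: eq_eseriesl.
have H := @ge0_emeasurable_sum _ (measurableTypeR R) R P' (fun n t => (e n t)%:E) xpredT.
by apply H => [n t _ _|n _]; [rewrite lee_fin | exact: me].
Qed.

Let iS : mu.-integrable P' S.
Proof.
apply/integrableP; split; first exact: mS.
have -> : (\int[mu]_(t in P') `|S t| = \int[mu]_(t in P') S t)%E.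
  by apply: eq_integral => t _; rewrite gee0_abs.
rewrite integral_nneseries//; last by move=> n t _; rewrite lee_fin.
under eq_eseriesr => n _ do rewrite integral_e.
pose u n := normC (c n) * (k * sigma) `^ (- b n).
have -> : (\sum_(n <oo) (u n)%:E)%E = (limn (series u))%:E.
  rewrite -EFin_lim//; congr (limn _); apply/funext => n /=.
  by rewrite /series /= sumEFin.
exact: ltry.
Qed.

Let S_scale t t' : 0 < t -> t < t' -> exists2 C, 0 <= C & (S t <= C%:E * S t')%E.
Proof.
move=> t0 tt'; have t'0 := lt_trans t0 tt'.
pose C := expR (- (sigma * t)) * t `^ (b 0%N - 1) /
  (expR (- (sigma * t')) * t' `^ (b 0%N - 1)).
have C0 : 0 <= C.
  by rewrite /C divr_ge0// mulr_ge0 ?expR_ge0 ?powR_ge0.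
exists C => //; rewrite /S -nneseriesZl; last by move=> n _; rewrite lee_fin.
apply: lee_nneseries => [n _ _|n _]; first by rewrite lee_fin.
rewrite -EFinM lee_fin /e /gpow /C.
have bE : b n - 1 = (b 0%N - 1) + (b n - b 0%N) by ring.
have [g0 _] := kGammaP k0 (mulr_gt0 k0 (bn0 n)).
rewrite bE (@powRD _ t (b 0%N - 1)) ?(gt_eqF t0) ?implybT//.
rewrite (@powRD _ t' (b 0%N - 1)) ?(gt_eqF t'0) ?implybT//.
have h : t `^ (b n - b 0%N) <= t' `^ (b n - b 0%N).
  by rewrite ge0_ler_powR ?nnegrE ?subr_ge0// ltW.
set x := t `^ (b n - b 0%N) in h *; set y := t' `^ (b n - b 0%N) in h *.
have p0 : 0 < t' `^ (b 0%N - 1) by rewrite powR_gt0.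
have ex0 := expR_gt0 (- (sigma * t')).
set D := k * kGamma k (k * b n).
have D0 : 0 < D by rewrite mulr_gt0.
rewrite [leRHS](_ : _ = expR (- (sigma * t)) * t `^ (b 0%N - 1) * normC (c n) / D * y); last first.
  by field; rewrite !gt_eqF.
rewrite [leLHS](_ : _ = expR (- (sigma * t)) * t `^ (b 0%N - 1) * normC (c n) / D * x); last by ring.
by rewrite ler_wpM2l// divr_ge0 ?(ltW D0)// !mulr_ge0 ?expR_ge0 ?powR_ge0 ?normC_ge0.
Qed.

(** The integrable sum S is finite at arbitrarily large points, hence at every
    point: up to a factor independent of n its terms increase with t. *)
Let S_fin t : 0 < t -> S t \is a fin_num.
Proof.
move=> t0; suff [t' tt' fS] : exists2 t', t < t' & S t' \is a fin_num.
  have [C C0 le] := S_scale t0 tt'.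
  rewrite ge0_fin_numE//; apply: le_lt_trans le _.
  by rewrite -(fineK fS) -EFinM ltry.
apply/not_exists2P => H.
have sub : `]t, (t + 1)%R]%classic `<=` ~` [set x | P' x -> S x \is a fin_num].
  move=> x /=; rewrite in_itv/= => /andP[tx _] h.
  have [//|] := H x; apply; apply: h; rewrite in_itv/= andbT; exact: lt_trans tx.
have : mu.-negligible `]t, (t + 1)%R]%classic.
  have [N [mN N0 sN]] := integrable_ae mP' iS.
  by exists N; split => //; exact: subset_trans sub sN.
move/measure_negligible => /(_ (measurable_itv _)) N0.
have : mu `]t, (t + 1)%R]%classic = 0%E by [].
rewrite lebesgue_measure_itv/= lte_fin ltrDl ltr01 -EFinB addrAC subrr add0r.
by move=> -[] /eqP; rewrite oner_eq0.
Qed.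

Lemma gpow_series_summable t : 0 < t ->
  cvgn (series (fun n => normC (c n * (gpow k (b n) t)%:C))).
Proof.
move=> t0; have ex0 := expR_gt0 (- (sigma * t)).
apply: nondecreasing_is_cvgn.
  by apply/nondecreasing_series => n _ _; exact: normC_ge0.
exists (fine (S t) / expR (- (sigma * t))) => _ [n _ <-].
rewrite ler_pdivlMr// mulrC /series /= mulr_sumr.
rewrite -lee_fin (fineK (S_fin t0)) -sumEFin.
have -> : (\sum_(0 <= i < n) (expR (- (sigma * t)) * normC (c i * (gpow k (b i) t)%:C))%:E =
  \sum_(0 <= i < n) (e i t)%:E)%E.
  by apply: eq_bigr => i _; rewrite normCM normC_real ger0_norm ?gpow_ge0.
by apply: nneseries_lim_ge => i _ _; rewrite lee_fin.
Qed.

Lemma lap_gpow_series g s :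
  (forall t, 0 < t -> cvgS (fun n => c n * (gpow k (b n) t)%:C) (g t)) ->
  sigma <= complex.Re s ->
  lapI g s /\ cvgS (fun n => c n * powC (k%:C * s) (- b n)%:C) (lap g s).
Proof.
move=> gP ss; have s0 : 0 < complex.Re s by exact: lt_le_trans ss.
pose g_ n t := expC (- (s * t%:C)) * (c n * (gpow k (b n) t)%:C).
have mg_ n : measurableC P' (g_ n).
  apply: measurableCM; first exact: measurableC_kernel.
  apply: measurableCM; first exact: measurableC_cst.
  by apply: measurableC_real; apply: measurable_funTS; exact: measurable_gpow.
pose h t := expC (- (s * t%:C)) * g t.
have hP t : P' t -> cvgS (g_ ^~ t) (h t).
  rewrite /= in_itv/= andbT => t0; exact: cvgSZ (gP t t0).
have mh : measurableC P' h.
  split.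
  - apply: (@measurable_fun_cvg _ (measurableTypeR R) _ P' (fun n t => series (fun i => complex.Re (g_ i t)) n)).
      move=> n; rewrite /series /=.
      by apply: measurable_sum => i; have [] := mg_ i.
    by move=> t /hP/cvgSP[].
  - apply: (@measurable_fun_cvg _ (measurableTypeR R) _ P' (fun n t => series (fun i => complex.Im (g_ i t)) n)).
      move=> n; rewrite /series /=.
      by apply: measurable_sum => i; have [] := mg_ i.
    by move=> t /hP/cvgSP[].
have iG : mu.-integrable P' (fun t => (fine (S t))%:E).
  apply: eq_integrable iS => // t; rewrite inE/= in_itv/= andbT => t0.
  by rewrite fineK// S_fin.
have [|I1 I2] := integralC_series mP' mg_ mh hP iG.
  move=> n t; rewrite /= in_itv/= andbT => t0.
  rewrite -lee_fin (fineK (S_fin t0)) -sumEFin.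
  apply: (@le_trans _ _ (\sum_(0 <= i < n) (e i t)%:E)%E).
    apply: lee_sum => i _; rewrite lee_fin !normCM normC_kernel normC_real.
    rewrite ger0_norm ?gpow_ge0// ler_wpM2r//.
      by apply: mulr_ge0; [exact: normC_ge0 | exact: gpow_ge0].
    by rewrite ler_expR lerN2 ler_wpM2r// ltW.
  by apply: nneseries_lim_ge => i _ _; rewrite lee_fin.
have [J1 J2] := integrableC_obnd_cbnd I1.
split; first exact: J1.
rewrite /lap -J2; apply: eq_cvgS I2 => n.
have ign : integrableC P' (g_ n).
  apply: (integrableC_le mP' (mg_ n) iG) => t; rewrite /= in_itv/= andbT => t0.
  rewrite -lee_fin (fineK (S_fin t0)).
  apply: (@le_trans _ _ (\sum_(0 <= i < n.+1) (e i t)%:E)%E).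
    rewrite big_nat_recr//= lee_paddl//.
      by apply: sume_ge0 => i _; rewrite lee_fin.
    rewrite lee_fin !normCM normC_kernel normC_real ger0_norm ?gpow_ge0// ler_wpM2r//.
      by apply: mulr_ge0; [exact: normC_ge0 | exact: gpow_ge0].
    by rewrite ler_expR lerN2 ler_wpM2r// ltW.
  by apply: nneseries_lim_ge => i _ _; rewrite lee_fin.
have [_ ->] := integrableC_obnd_cbnd ign.
have -> : g_ n = fun t => c n * (expC (- (s * t%:C)) * (gpow k (b n) t)%:C).
  by apply/funext => t; rewrite mulrCA.
rewrite (@integralCZ _ P (measurable_itv _)); last exact: lapI_gpow.
by congr (_ * _); exact: lap_gpow.
Qed.

End SeriesKernels.

Section PrabhakarKernel.
Context {R : realType}.
Local Notation mu := (@lebesgue_measure R).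
Local Notation P := (`[0, +oo[%classic : set R).
Implicit Types (k a b g alpha m gam omega sigma t : R) (s w z : R[i]).

Lemma bin_summable g z : normC z < 1 ->
  cvgn (series (fun n => normC ((bin_coef g n)%:C * z ^+ n))).
Proof.
move=> z1; have z0 := normC_ge0 z; pose r := 2 / (1 + normC z).
have p1 : 0 < 1 + normC z by lra.
have r1 : 1 < r by rewrite /r ltr_pdivlMr//; lra.
have zr : normC z * r < 1 by rewrite /r mulrA ltr_pdivrMr//; lra.
have r0 : 0 <= r by lra.
have := rad_cvg ((radC_norm _ _).1 (radC_bin g r0 zr)).
move=> /(_ 1); rewrite normr1 => /(_ r1); rewrite /pseries /=.
by under eq_fun do rewrite expr1n mulr1.
Qed.

Lemma ler_powR_neg (x y a : R) : 0 < x -> x <= y -> 0 <= a -> y `^ (- a) <= x `^ (- a).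
Proof.
move=> x0 xy a0; have y0 : 0 < y by exact: lt_le_trans xy.
by rewrite !powRN lef_pV2 ?posrE ?powR_gt0// ge0_ler_powR ?nnegrE// ltW.
Qed.

Lemma Re_le_normC s : 0 < complex.Re s -> complex.Re s <= normC s.
Proof. by move=> s0; have := normr_Re s; rewrite ger0_norm// ltW. Qed.

Lemma normC_powC_lt1 k a w s sigma : 0 < k -> 0 < a -> 0 < sigma ->
  sigma <= complex.Re s -> normC w * (k * sigma) `^ (- a) < 1 ->
  normC (w * powC (k%:C * s) (- a)%:C) < 1.
Proof.
move=> k0 a0 s0 ss; apply: le_lt_trans.
have Rs : 0 < complex.Re s by exact: lt_le_trans ss.
have Rks : 0 < complex.Re (k%:C * s) by rewrite cReM /= mul0r subr0 mulr_gt0.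
rewrite normCM normC_powC// ler_wpM2l ?normC_ge0// ler_powR_neg ?mulr_gt0 ?(ltW a0)//.
rewrite normCM normC_real ger0_norm ?(ltW k0)// ler_pM2l//.
by rewrite (le_trans ss)// Re_le_normC.
Qed.

(** Terms of the Prabhakar kernel. A complex parameter w is allowed so that
    the same series also represents the symbol along a complex ray. *)
Definition prab_term k a b g w t n : R[i] :=
  (bin_coef g n)%:C * w ^+ n * (gpow k (a * n%:R + b) t)%:C.

Section LaplacePrab.
Variables (k a b g sigma : R) (w : R[i]).
Hypotheses (k0 : 0 < k) (a0 : 0 < a) (b0 : 0 < b) (sigma0 : 0 < sigma).
Hypothesis w_lt1 : normC w * (k * sigma) `^ (- a) < 1.

Let beta n := a * n%:R + b.
Let beta0 : 0 < beta 0%N. Proof. by rewrite /beta mulr0 add0r. Qed.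
Let beta_ge n : beta 0%N <= beta n.
Proof. by rewrite /beta mulr0 lerD2r mulr_ge0// ltW. Qed.

Let ks0 : 0 < k * sigma. Proof. exact: mulr_gt0. Qed.

Let summable : cvgn (series (fun n =>
  normC ((bin_coef g n)%:C * w ^+ n) * (k * sigma) `^ (- beta n))).
Proof.
pose z := w * ((k * sigma) `^ (- a))%:C.
have z1 : normC z < 1 by rewrite normCM normC_real ger0_norm// powR_ge0.
have -> : (fun n => normC ((bin_coef g n)%:C * w ^+ n) * (k * sigma) `^ (- beta n)) =
    (k * sigma) `^ (- b) *: (fun n => normC ((bin_coef g n)%:C * z ^+ n)).
  apply/funext => n.
  transitivity ((k * sigma) `^ (- b) * normC ((bin_coef g n)%:C * z ^+ n)); last by [].
  have -> : (k * sigma) `^ (- beta n) =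
      (k * sigma) `^ (- b) * (k * sigma) `^ (- a) ^+ n.
    rewrite -powR_mulrn ?powR_ge0// -powRrM -powRD ?(gt_eqF ks0) ?implybT//.
    by congr (_ `^ _); rewrite /beta; ring.
  rewrite /z exprMn !normCM !normCX !normC_real (ger0_norm (powR_ge0 _ (- a))).
  by ring.
apply: is_cvg_seriesZ; exact: bin_summable z1.
Qed.

Lemma prab_is_cvg t : 0 < t -> exists l, cvgS (prab_term k a b g w t) l.
Proof.
move=> t0; apply: is_cvgS_abs.
exact: (gpow_series_summable k0 beta0 beta_ge sigma0 summable t0).
Qed.

Lemma lap_prab (kappa : R -> R[i]) s :
  (forall t, 0 < t -> cvgS (prab_term k a b g w t) (kappa t)) ->
  sigma <= complex.Re s ->
  lapI kappa s /\
  lap kappa s = powC (k%:C * s) (- b)%:C *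
                powC (1 - w * powC (k%:C * s) (- a)%:C) (- g)%:C.
Proof.
move=> kP ss.
have [I1 I2] := lap_gpow_series k0 beta0 beta_ge sigma0 summable kP ss.
split=> //; apply: cvgC_unique I2 _.
have z1 := normC_powC_lt1 k0 a0 sigma0 ss w_lt1.
apply: eq_cvgS (cvgSZ _ (binomial_series g z1)) => n.
have -> : (- beta n)%:C = n%:R * (- a)%:C + (- b)%:C :> R[i].
  rewrite -(rmorph_nat (real_complex R)) -rmorphM -rmorphD /beta; congr (_%:C); ring.
by rewrite powCD powCX exprMn; ring.
Qed.

End LaplacePrab.

Definition kPrabhakar_kernel k alpha m omega gam t : R :=
  t `^ (m / k - 1) / k * kMittagLeffler k alpha m gam (omega * t `^ (alpha / k)).

Lemma kPochhammerE k gam n : 0 < k ->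
  kPochhammer k gam n = k ^+ n * \prod_(i < n) (gam / k + i%:R).
Proof.
move=> k0; rewrite /kPochhammer -[in k ^+ n](card_ord n) -prodr_const -big_split/=.
by apply: eq_bigr => i _; field; rewrite gt_eqF.
Qed.

Lemma kPrabhakar_kernelE k alpha m omega gam t l : 0 < k -> 0 < t ->
  cvgS (prab_term k (alpha / k) (m / k) (gam / k) (omega * k)%:C t) l ->
  (kPrabhakar_kernel k alpha m omega gam t)%:C = l.
Proof.
move=> k0 t0 /cvgSP[hr hi].
pose c := t `^ (m / k - 1) / k.
have c0 : c != 0 by rewrite /c gt_eqF// divr_gt0// powR_gt0.
pose u n := kPochhammer k gam n / kGamma k (alpha * n%:R + m) *
  ((omega * t `^ (alpha / k)) ^+ n / n`!%:R).
have E n : prab_term k (alpha / k) (m / k) (gam / k) (omega * k)%:C t n = (c * u n)%:C.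
  rewrite /prab_term -rmorphXn -!rmorphM; congr (_%:C).
  rewrite /bin_coef /u kPochhammerE// /gpow.
  have -> : k * (alpha / k * n%:R + m / k) = alpha * n%:R + m by field; rewrite gt_eqF.
  have -> : alpha / k * n%:R + m / k - 1 = (alpha / k) * n%:R + (m / k - 1) by ring.
  rewrite powRD ?(gt_eqF t0) ?implybT// powRrM powR_mulrn ?powR_ge0// /c !exprMn invfM.
  by ring.
apply: cplx_eq => /=; last first.
  apply/esym; apply: cvg_unique hi _ => //; rewrite (_ : series _ = fun=> 0); first exact: cvg_cst.
  by apply/funext => n; rewrite /series /= big1// => i _; rewrite E.
rewrite /kPrabhakar_kernel -/c /kMittagLeffler -/u.
have hu : series u @ \oo --> c^-1 * complex.Re l.
  have -> : series u = fun n => c^-1 * series (fun i => complex.Re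
      (prab_term k (alpha / k) (m / k) (gam / k) (omega * k)%:C t i)) n.
    apply/funext => n; rewrite /series /= mulr_sumr; apply: eq_bigr => i _.
    by rewrite E /= mulKf.
  by apply: cvgMr hr.
by rewrite (cvg_lim _ hu)// mulVKf.
Qed.

Lemma exists_sigma k a (c : R) : 0 < k -> 0 < a -> 0 <= c ->
  exists2 sigma, 0 < sigma & c * (k * sigma) `^ (- a) < 1.
Proof.
move=> k0 a0 c0; pose y := (c + 1) `^ a^-1; have y0 : 0 < y by rewrite powR_gt0 ?ltr_wpDl.
exists (y / k); first exact: divr_gt0.
rewrite mulrCA mulfV ?gt_eqF// mulr1 /y -powRrM mulrN mulVf ?gt_eqF// powR_inv1; last lra.
by rewrite ltr_pdivrMr; lra.
Qed.

Lemma lap_kPrabhakar_kernel k alpha m omega gam : 0 < k -> 0 < alpha -> 0 < m ->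
  exists2 sigma, 0 < sigma & forall s, sigma <= complex.Re s ->
  lapI (fun t => (kPrabhakar_kernel k alpha m omega gam t)%:C) s /\
  lap (fun t => (kPrabhakar_kernel k alpha m omega gam t)%:C) s =
    powC (k%:C * s) (- (m / k))%:C *
    powC (1 - (omega * k)%:C * powC (k%:C * s) (- (alpha / k))%:C) (- (gam / k))%:C.
Proof.
move=> k0 al0 m0.
have a0 : 0 < alpha / k by exact: divr_gt0.
have b0 : 0 < m / k by exact: divr_gt0.
have [sigma s0 H] := exists_sigma k0 a0 (normC_ge0 (omega * k)%:C).
exists sigma => // s ss; apply: (lap_prab k0 a0 b0 s0 H) => // t t0.
have [l lP] := prab_is_cvg (gam / k) k0 a0 b0 s0 H t0.
by rewrite (kPrabhakar_kernelE k0 t0 lP).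
Qed.

End PrabhakarKernel.

(** * Absolute continuity and total variation *)

Section AbsoluteContinuity.
Context {R : realType}.
Local Notation mu := (@lebesgue_measure R).
Local Notation TV := (@total_variation R).
Implicit Types (F G f g : R -> R) (p q : R * R) (s t : seq (R * R)).

Definition itv_apart p q := (p.1 <= q.2) || (q.1 <= p.2).
Definition itv_len p := p.1 - p.2.
Definition itv_ordered p := p.2 <= p.1.

(** Lists of intervals, given as pairs (right end, left end), can be
    concatenated and refined, as the variation argument requires. *)
Definition ac_list F := forall e, 0 < e -> exists2 d, 0 < d &
  forall s, all itv_ordered s -> pairwise itv_apart s ->
  \sum_(p <- s) itv_len p < d -> \sum_(p <- s) `|F p.1 - F p.2| <= e.

Definition contraction (phi : R -> R) := forall x y, x <= y ->
  phi x <= phi y /\ phi y - phi x <= y - x.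

Lemma contraction_map phi s : contraction phi ->
  all itv_ordered s -> pairwise itv_apart s ->
  let s' := [seq (phi p.1, phi p.2) | p <- s] in
  [/\ all itv_ordered s', pairwise itv_apart s' &
      \sum_(p <- s') itv_len p <= \sum_(p <- s) itv_len p].
Proof.
move=> cphi so sa s'; split.
- rewrite all_map; apply: sub_all so => p po; exact: (cphi _ _ po).1.
- rewrite pairwise_map; apply: sub_pairwise sa => p q.
  by rewrite /itv_apart /= => /orP[h|h]; apply/orP; [left|right]; exact: (cphi _ _ h).1.
- rewrite big_map; rewrite !big_seq; apply: ler_sum => p ps.
  by apply: (cphi _ _ _).2; exact: (allP so).
Qed.

Lemma ac_list_comp F phi : contraction phi -> ac_list F ->
  ac_list (fun x => F (phi x)).
Proof.
move=> cphi acF e /acF[d d0 H]; exists d => // s so sa sl.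
have [so' sa' sl'] := contraction_map cphi so sa.
by have := H _ so' sa' (le_lt_trans sl' sl); rewrite big_map.
Qed.

(** The projection onto the interval from 0 to b: composing with it extends a
    function by constants. *)
Definition clip (b x : R) := Num.max 0 (Num.min x b).

Lemma contraction_max (c : R) : contraction (Num.max c).
Proof.
move=> x y xy; rewrite !maxEle; case: (leP c x) => cx; case: (leP c y) => cy; lra.
Qed.

Lemma contraction_clip b : contraction (clip b).
Proof.
move=> x y xy; have [h1 h2] : Num.min x b <= Num.min y b /\
    Num.min y b - Num.min x b <= y - x.
  rewrite !minEle; case: (leP x b) => cx; case: (leP y b) => cy; lra.
have [h3 h4] := contraction_max 0 h1.
by split => //; exact: le_trans h2.
Qed.

Lemma clip_itv b x : 0 <= b -> 0 <= clip b x <= b.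
Proof. by move=> b0; rewrite /clip le_max lexx ge_max b0 ge_min lexx orbT. Qed.

Lemma clip_id b x : 0 <= x <= b -> clip b x = x.
Proof.
by move=> /andP[x0 xb]; rewrite /clip (min_idPl xb); exact/max_idPr.
Qed.

Lemma abs_continuous_clip f b : 0 < b -> abs_continuous 0 b f ->
  ac_list (fun x => f (clip b x)).
Proof.
move=> b0 fac e /fac[d d0 H]; exists d => // s so sa sl.
have [] := contraction_map (contraction_clip b) so sa.
set s' := map _ s => so' sa' sl'.
pose z : R * R := (0, 0).
rewrite -(big_map (fun p => (clip b p.1, clip b p.2)) xpredT (fun p => `|f p.1 - f p.2|)) -/s'.
rewrite (big_nth z) big_mkord ltW//.
apply: (H _ (fun i : 'I_(size s') => (nth z s' i).2) (fun i => (nth z s' i).1)).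
- move=> i; have is' : (i < size s)%N.
    by have := ltn_ord i; rewrite [X in (_ < X)%N -> _]size_map.
  rewrite (nth_map z)//=.
  have /andP[h1 h2] := clip_itv (nth z s i).1 (ltW b0).
  have /andP[h3 h4] := clip_itv (nth z s i).2 (ltW b0).
  by split => //; apply: (contraction_clip b _).1; exact: (allP so _ (mem_nth _ is')).
- apply/trivIsetP => i j _ _ ij.
  have key (m n : 'I_(size s')) : (m < n)%N ->
      `](nth z s' m).2, (nth z s' m).1[%classic `&` `](nth z s' n).2, (nth z s' n).1[%classic = set0.
    move=> mn; have /(pairwiseP z) := sa' => /(_ m n (ltn_ord m) (ltn_ord n) mn).
    rewrite /itv_apart -subset0 => h x [] /=; rewrite !in_itv/= => /andP[h1 h2] /andP[h3 h4].
    by case/orP: h => h; lra.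
  have [/key//|/key|/val_inj/eqP] := ltngtP i j; last by rewrite (negbTE ij).
  by rewrite setIC.
- rewrite -(big_mkord xpredT (fun i => (nth z s' i).1 - (nth z s' i).2)) -(big_nth z xpredT itv_len).
  exact: le_lt_trans sl' sl.
Qed.

Lemma ac_listB F G : ac_list F -> ac_list G -> ac_list (fun x => F x - G x).
Proof.
move=> acF acG e e0; have e20 : 0 < e / 2 by lra.
have [d1 d10 H1] := acF _ e20; have [d2 d20 H2] := acG _ e20.
exists (Num.min d1 d2) => [|s so sa]; first by rewrite lt_min d10.
rewrite lt_min => /andP[l1 l2].
have := lerD (H1 s so sa l1) (H2 s so sa l2); rewrite -big_split/= -splitr.
apply: le_trans; apply: ler_sum => p _.
by rewrite [X in `|X|](_ : _ = (F p.1 - F p.2) - (G p.1 - G p.2)) ?ler_normB//; ring.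
Qed.

Lemma ac_list_continuous F : ac_list F -> continuous F.
Proof.
move=> acF x; apply/cvgrPdist_le => e /acF[d d0 H]; near=> y.
have xyd : `|x - y| < d by near: y; apply: cvgr_dist_lt => //; exact: cvg_id.
have [xy|yx] := leP x y.
- rewrite distrC; have := H [:: (y, x)]; rewrite !big_seq1 /=; apply => //.
  + by rewrite /= andbT.
  + by move: xyd; rewrite distrC ger0_norm// subr_ge0.
- have := H [:: (x, y)]; rewrite !big_seq1 /=; apply => //.
  + by rewrite /= andbT; exact: ltW.
  + by move: xyd; rewrite ger0_norm// subr_ge0 ltW.
Unshelve. all: by end_near. Qed.

Lemma partition_intervals (x : R) (l : seq R) : path <%R x l ->
  let s := zip l (x :: l) in
  [/\ forall p, p \in s -> [/\ x <= p.2, p.2 <= p.1 & p.1 <= last x l],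
      pairwise itv_apart s, \sum_(p <- s) itv_len p = last x l - x & x <= last x l].
Proof.
elim: l x => [x _|y l IH x /= /andP[xy /IH]].
  by rewrite /= big_nil subrr.
have xley := ltW xy.
move=> [h1 h2 h3 h4]; split.
- move=> p; rewrite inE => /predU1P[->/=|/h1[a1 a2 a3]]; first by [].
  by split => //; exact: le_trans a1.
- rewrite h2 andbT; apply/allP => p /h1[a1 _ _].
  by rewrite /itv_apart /= a1.
- by rewrite big_cons h3 /itv_len /=; ring.
- exact: le_trans h4.
Qed.

Lemma itv_apart_sym p q : itv_apart p q = itv_apart q p.
Proof. by rewrite /itv_apart orbC. Qed.

Lemma itv_apartS p q r : r.1 <= p.1 -> p.2 <= r.2 -> itv_apart p q -> itv_apart r q.
Proof.
move=> h1 h2; rewrite /itv_apart => /orP[h|h]; apply/orP; [left|right].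
  exact: le_trans h.
exact: le_trans h2.
Qed.

(** Induction on the list s of intervals measured by their total variation.
    The supremum for the first of them is approached by its partitions, whose
    intervals are moved to the list t of intervals measured by increments. *)
Lemma total_variation_sum F e d :
  (forall s, all itv_ordered s -> pairwise itv_apart s ->
     \sum_(p <- s) itv_len p < d -> \sum_(p <- s) `|F p.1 - F p.2| <= e) ->
  (forall x y, x <= y -> TV x y F \is a fin_num) ->
  forall s t, all itv_ordered (s ++ t) -> pairwise itv_apart (s ++ t) ->
  \sum_(p <- s ++ t) itv_len p < d ->
  \sum_(p <- s) fine (TV p.2 p.1 F) + \sum_(p <- t) `|F p.1 - F p.2| <= e.
Proof.
move=> H fTV; elim=> [t so sa sl|p s IH t]; first by rewrite big_nil add0r; exact: H.
move=> /= /andP[po so] /andP[pa sa]; rewrite big_cons => sl.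
rewrite big_cons -addrA -lerBrDr -lee_fin fineK ?fTV//.
apply: ge_ereal_sup => _ [_ [l lp <-] <-]; rewrite lee_fin lerBrDr.
have [pl /eqP ll] := lp; have [h1 h2 h3 _] := partition_intervals pl.
rewrite ll in h1 h3; rewrite variation_zip//.
rewrite addrCA -(big_cat _ (zip l (p.2 :: l)) t)/=.
apply: (IH (zip l (p.2 :: l) ++ t)).
- move: so; rewrite !all_cat => /andP[-> ->]; rewrite andbT /=.
  by apply/allP => q /h1[].
- move: sa pa; rewrite !pairwise_cat allrel_catr h2 => /and3P[-> -> ->] /=.
  rewrite all_cat => /andP[/allP ps /allP pt]; rewrite !andbT /=.
  apply/andP; split; apply/allrelP => q r.
    move=> qs /h1[a1 a2 a3]; rewrite itv_apart_sym.
    by apply: (itv_apartS (p := p)) => //; exact: ps.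
  by move=> /h1[a1 a2 a3] rt; apply: (itv_apartS (p := p)) => //; exact: pt.
- move: sl; rewrite !big_cat/= h3 /itv_len; lra.
Qed.

(** Short intervals have variation at most 1, and finitely many of them
    suffice. *)
Lemma ac_list_fin_TV F x y : ac_list F -> x <= y -> TV x y F \is a fin_num.
Proof.
move=> /(_ 1 ltr01)[d d0 H].
have small u v : u <= v -> v - u < d -> TV u v F \is a fin_num.
  move=> uv uvd; rewrite ge0_fin_numE ?total_variation_ge0//.
  apply: (@le_lt_trans _ _ 1%:E); last exact: ltry.
  apply: ge_ereal_sup => _ [_ [l lp <-] <-]; rewrite lee_fin variation_zip//.
  have [pl /eqP ll] := lp; have [h1 h2 h3 _] := partition_intervals pl.
  apply: H => //; first by apply/allP => q /h1[].
  by rewrite h3 ll.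
pose n := (Num.trunc ((y - x) / (d / 2))).+1.
have : y - x <= n%:R * (d / 2).
  by rewrite -ler_pdivrMr ?divr_gt0// ltW// truncnS_gt.
move: n => n; elim: n x => [x|n IH x nxy xy].
  by rewrite mul0r subr_le0 => h1 h2; rewrite (le_anti (introT andP (conj h1 h2))) total_variationxx.
have [h|h] := ltP (y - x) d; first exact: small.
rewrite (@total_variationD _ _ _ (x + d / 2)); [|lra|lra].
rewrite fin_numD small ?IH//; try lra.
Qed.

Lemma ac_list_TV F : ac_list F ->
  ac_list (fun x => fine (TV 0 (Num.max 0 x) F)).
Proof.
move=> acF; have fTV x y := @ac_list_fin_TV F x y acF.
move=> e /acF[d d0 H]; exists d => // s so sa sl.
have [] := contraction_map (contraction_max 0) so sa.
set s' := map _ s => so' sa' sl'.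
have := @total_variation_sum F e d H fTV s' [::].
rewrite cats0 big_nil addr0 => /(_ so' sa' (le_lt_trans sl' sl)).
apply: le_trans; rewrite big_map !big_seq; apply: ler_sum => p ps /=.
have p12 : p.2 <= p.1 by exact: (allP so).
have [m12 _] := contraction_max 0 p12.
have m0 : 0 <= Num.max 0 p.2 by rewrite le_max lexx.
rewrite (total_variationD F m0 m12) fineD ?fTV// addrAC subrr add0r.
by rewrite ger0_norm// fine_ge0// total_variation_ge0.
Qed.

End AbsoluteContinuity.

(** * Densities of absolutely continuous functions *)

Section Stieltjes.
Context {R : realType}.
Local Notation mu := (@lebesgue_measure R).
Implicit Types (G : cumulative R R) (U A : set R).

Lemma lebesgue_stieltjes_itv G (x y : R) : x <= y ->
  lebesgue_stieltjes_measure G `]x, y]%classic = (G y - G x)%:E.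
Proof.
move=> xy; rewrite /lebesgue_stieltjes_measure /measure_extension.
rewrite measurable_mu_extE/=; last exact: is_ocitv.
by rewrite wlength_itv_bnd.
Qed.

Lemma open_interval_finite (I : set R) : open I -> is_interval I -> I !=set0 ->
  (mu I < +oo)%E -> inf I < sup I /\ I = `]inf I, sup I[%classic.
Proof.
move=> oI iI [x Ix] finI.
have IE := interior_id I; have {}IE : I° = I by apply/interior_id.
have [ub|nub] := pselect (has_ubound I); last first.
  exfalso; have [lb|nlb] := pselect (has_lbound I).
    have E := interval_right_unbounded_interior iI lb nub; rewrite IE in E.
    have E' : I = `]inf I, +oo[%classic.
      by apply/seteqP; split => t; [rewrite {1}E|rewrite {2}E] => /=; rewrite in_itv/= andbT.
    by move: finI; rewrite E' lebesgue_measure_itv/= ltry.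
  have E := interval_unbounded_setT iI nlb nub.
  by move: finI; rewrite E -set_itvNyy lebesgue_measure_itv/=.
have [lb|nlb] := pselect (has_lbound I); last first.
  exfalso; have E := interval_left_unbounded_interior iI nlb ub; rewrite IE in E.
  have E' : I = `]-oo, sup I[%classic.
    by apply/seteqP; split => t; [rewrite {1}E|rewrite {2}E] => /=; rewrite in_itv/=.
  by move: finI; rewrite E' lebesgue_measure_itv/= ltNyr.
have E := interval_bounded_interior iI lb ub; rewrite IE in E.
have E' : I = `]inf I, sup I[%classic.
  by rewrite {1}E; apply/seteqP; split => t /=; rewrite in_itv/=.
split=> //; move: Ix; rewrite {1}E' /= in_itv/= => /andP[]; exact: lt_trans.
Qed.

(** An open set is a countable disjoint union of open intervals; absolute
    continuity bounds every finite part of the union. *)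
Lemma stieltjes_open_le G U d e :
  (forall s, all (@itv_ordered R) s -> pairwise (@itv_apart R) s ->
     \sum_(p <- s) itv_len p < d -> \sum_(p <- s) `|G p.1 - G p.2| <= e) ->
  open U -> (mu U < d%:E)%E -> (lebesgue_stieltjes_measure G U <= e%:E)%E.
Proof.
move=> H oU Ud; pose I := open_disjoint_itv oU.
have oI i : open (I i) by exact: open_disjoint_itv_open.
have iI i : is_interval (I i) by exact: open_disjoint_itv_is_interval.
have tI : trivIset setT I by exact: open_disjoint_itv_trivIset.
have UI : U = \bigcup_i I i by exact: open_disjoint_itv_bigcup.
have mI i : @measurable _ (measurableTypeR R) (I i) by exact: open_measurable.
have mU : @measurable _ (measurableTypeR R) U by exact: open_measurable.
have finI i : (mu (I i) < +oo)%E.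
  apply: (@le_lt_trans _ _ (mu U)); last by rewrite (lt_trans Ud)// ltry.
  by apply: le_measure; rewrite ?inE//; rewrite UI => t It; exists i.
have -> : lebesgue_stieltjes_measure G U = (\sum_(i <oo) lebesgue_stieltjes_measure G (I i))%E.
  by rewrite [in LHS]UI measure_semi_bigcup//; exact: bigcup_measurable.
have sumI n : (\sum_(0 <= i < n) mu (I i) <= mu U)%E.
  rewrite [in leRHS]UI measure_semi_bigcup//; last exact: bigcup_measurable.
  by apply: nneseries_lim_ge => i _ _.
apply: lime_le; first by apply: is_cvg_nneseries => i _ _.
near=> n.
pose ne i := `[< I i !=set0 >].
have I0 i : ~~ ne i -> I i = set0.
  by move=> /asboolPn h; apply/seteqP; split => // t It; apply: h; exists t.
have IE i : ne i -> inf (I i) < sup (I i) /\ I i = `]inf (I i), sup (I i)[%classic.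
  by move=> /asboolP h; exact: open_interval_finite.
pose s := [seq (sup (I i), inf (I i)) | i <- iota 0 n & ne i].
have sE (f : R * R -> R) : \sum_(p <- s) f p = \sum_(0 <= i < n | ne i) f (sup (I i), inf (I i)).
  by rewrite big_map big_filter /index_iota subn0.
have so : all (@itv_ordered R) s.
  by rewrite all_map all_filter; apply/allP => i _; apply/implyP => /IE[h _]; exact: ltW.
have sa : pairwise (@itv_apart R) s.
  rewrite pairwise_map.
  have : pairwise ltn [seq i <- iota 0 n | ne i].
    by rewrite -sorted_pairwise ?sorted_filter ?iota_ltn_sorted//; exact: ltn_trans.
  apply: (@sub_in_pairwise _ ne); last exact: filter_all.
  move=> i j /IE[hi Ei] /IE[hj Ej] /= ij; rewrite /itv_apart /=.
  have := (trivIsetP.1 tI) i j Logic.I Logic.I; rewrite neq_ltn ij => /(_ isT) D.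
  apply: contraT; rewrite negb_or -!ltNge => /andP[h1 h2].
  have [t ti tj] : exists2 t, inf (I i) < t < sup (I i) & inf (I j) < t < sup (I j).
    exists ((Num.max (inf (I i)) (inf (I j)) + Num.min (sup (I i)) (sup (I j))) / 2);
    rewrite maxEle minEle; case: (leP (inf (I i)) (inf (I j))) => ?;
    case: (leP (sup (I i)) (sup (I j))) => ?; lra.
  suff : (I i `&` I j) t by rewrite D.
  by split; [rewrite Ei|rewrite Ej] => /=; rewrite in_itv.
have sl : \sum_(p <- s) itv_len p < d.
  rewrite sE -lte_fin (le_lt_trans _ Ud)// (le_trans _ (sumI n))// -sumEFin.
  rewrite [leRHS](bigID ne)/= [X in (_ <= _ + X)%E]big1 ?adde0; last first.
    by move=> i /I0 ->; rewrite measure0.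
  apply: lee_sum => i /IE[h E]; rewrite {3}E lebesgue_measure_itv/= lte_fin h.
  by rewrite -EFinB lee_fin.
have := H s so sa sl; rewrite -lee_fin; apply: le_trans.
rewrite sE -sumEFin (bigID ne)/= [X in (_ + X <= _)%E]big1 ?adde0; last first.
  by move=> i /I0 ->; rewrite measure0.
apply: lee_sum => i /IE[h E].
apply: (@le_trans _ _ (lebesgue_stieltjes_measure G `]inf (I i), sup (I i)]%classic)).
  by apply: le_measure; rewrite ?inE// {1}E; exact: subset_itv_oo_oc.
by rewrite lebesgue_stieltjes_itv ?(ltW h)// lee_fin /= ler_norm.
Unshelve. all: by end_near. Qed.

(** By outer regularity a null set lies in open sets of arbitrarily small
    Lebesgue measure. *)
Lemma stieltjes_null G A : ac_list G -> @measurable _ (measurableTypeR R) A -> mu A = 0%E ->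
  lebesgue_stieltjes_measure G A = 0%E.
Proof.
move=> acG mA A0; apply/eqP; rewrite eq_le measure_ge0 andbT.
apply/lee_addgt0Pr => e e0; rewrite add0e.
have [d d0 H] := acG e e0.
have Aoo : (mu A < +oo)%E by rewrite A0.
have [U [oU AU Ud]] := @lebesgue_regularity_outer R A d mA Aoo d0.
have mU : @measurable _ (measurableTypeR R) U by exact: open_measurable.
apply: (@le_trans _ _ (lebesgue_stieltjes_measure G U)).
  by apply: le_measure; rewrite ?inE.
apply: (stieltjes_open_le H oU).
apply: (@le_lt_trans _ _ (mu A + mu (U `\` A))%E); last by rewrite A0 add0e.
rewrite -[in leLHS](setDUK AU); apply: measureU2 => //.
exact: measurableD.
Qed.

(** The density is the Radon-Nikodym derivative of the Stieltjes measure
    restricted to a bounded interval. *)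
Lemma stieltjes_density G b : 0 < b -> ac_list G ->
  exists g : R -> R, mu.-integrable setT (EFin \o g) /\
    forall x, 0 <= x <= b -> G x - G 0 = \int[mu]_(t in `]0, x]) g t.
Proof.
move=> b0 acG; pose D : set R := `]0, b]%classic.
have mD : @measurable _ (measurableTypeR R) D by exact: measurable_itv.
have Doo : (lebesgue_stieltjes_measure G D < +oo)%E.
  by rewrite lebesgue_stieltjes_itv ?ltW// ltry.
pose nu : {finite_measure set (measurableTypeR R) -> \bar R} := mfrestr mD Doo.
have dom : nu `<< mu.
  apply/null_content_dominatesP => A mA A0; rewrite /nu /= /mfrestr /mrestr.
  apply: stieltjes_null => //; first exact: measurableI.
  apply/eqP; rewrite eq_le measure_ge0 andbT -[leRHS]A0.
  by apply: le_measure; rewrite ?inE//; first [exact: measurableI | exact: subIsetl].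
have [h [h0 hfin hi hE]] := radon_nikodym_sigma_finite dom.
exists (fine \o h); split.
  by apply: eq_integrable hi => // x _; rewrite /= fineK.
move=> x /andP[x0 xb]; have := hE `]0, x]%classic (measurable_itv _).
rewrite /nu /= /mfrestr /mrestr (_ : `]0, x] `&` D = `]0, x]%classic); last first.
  apply/setIidPl => t; rewrite /D /= !in_itv/= => /andP[-> tx] /=; exact: le_trans xb.
rewrite lebesgue_stieltjes_itv// => E; rewrite /Rintegral.
rewrite (eq_integral h) => [|t _]; last by rewrite fineK.
by rewrite -E.
Qed.

End Stieltjes.

Section FundamentalTheorem.
Context {R : realType}.
Local Notation mu := (@lebesgue_measure R).
Implicit Types (F f g : R -> R).

Lemma monotone_density F b : 0 < b -> ac_list F -> nondecreasing F ->
  exists g : R -> R, mu.-integrable setT (EFin \o g) /\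
    forall x, 0 <= x <= b -> F x - F 0 = \int[mu]_(t in `]0, x]) g t.
Proof.
move=> b0 acF ndF.
have rc : right_continuous F by apply: right_continuousW; exact: ac_list_continuous.
pose cF := isCumulative.Build R _ R F ndF rc.
pose G : cumulative R R := HB.pack F cF.
exact: (@stieltjes_density _ G b b0 acF).
Qed.

(** Jordan decomposition: F is the difference of its variation function V and
    of V - F, both nondecreasing and absolutely continuous. *)
Lemma ac_list_density F b : 0 < b -> ac_list F ->
  exists g : R -> R, mu.-integrable setT (EFin \o g) /\
    forall x, 0 <= x <= b -> F x - F 0 = \int[mu]_(t in `]0, x]) g t.
Proof.
move=> b0 acF0; pose F' x := F (Num.max 0 x).
have acF : ac_list F' by apply: ac_list_comp acF0; exact: contraction_max.
pose V x := fine (total_variation 0 (Num.max 0 x) F).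
have acV := ac_list_TV acF0; rewrite -/V in acV.
have VD x y : x <= y -> F' y - F' x <= V y - V x /\ 0 <= V y - V x.
  move=> xy; have [mxy _] := contraction_max 0 xy.
  have m0 : 0 <= Num.max 0 x by rewrite le_max lexx.
  have m0' : 0 <= Num.max 0 y by rewrite le_max lexx.
  have -> : V y - V x = fine (total_variation (Num.max 0 x) (Num.max 0 y) F).
    by rewrite /V (total_variationD F m0 mxy) fineD ?ac_list_fin_TV// addrAC subrr add0r.
  split; last by rewrite fine_ge0// total_variation_ge0.
  rewrite (le_trans (ler_norm _))// -lee_fin fineK ?ac_list_fin_TV//.
  exact: total_variation_ge.
have [g1 [i1 E1]] := monotone_density b0 acV (fun x y xy => ltac:(have := VD _ _ xy; lra)).
have [g2 [i2 E2]] := monotone_density b0 (ac_listB acV acF)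
  (fun x y xy => ltac:(have := VD _ _ xy; lra)).
exists (fun t => g1 t - g2 t); split.
  by have := integrableB measurableT i1 i2; apply: eq_integrable.
move=> x xb; rewrite RintegralB//; last 2 first.
- by apply: integrableS i1.
- by apply: integrableS i2.
rewrite -E1// -E2//.
have e0 : F' 0 = F 0 by rewrite /F' maxxx.
have ex : F' x = F x by rewrite /F' (max_idPr _)//; case/andP: xb.
by rewrite e0 ex; ring.
Qed.

End FundamentalTheorem.

(** * Absolutely continuous functions as primitives *)

Section FTC.
Context {R : realType}.
Local Notation mu := (@lebesgue_measure R).
Implicit Types (f g h : R -> R).

Lemma ae_neq (c : R) : {ae mu, forall x : R, x != c}.
Proof.
exists [set c]; split; [exact: measurable_set1 | exact: lebesgue_measure_set1 |].
by move=> x /= /negP; rewrite negbK => /eqP.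
Qed.

Lemma locally_integrableT g : mu.-integrable setT (EFin \o g) ->
  locally_integrable [set: R] g.
Proof. by move=> /(integrable_locally measurableT); rewrite patch_setT. Qed.

Section AC.
Variable f : R -> R.
Hypothesis f_ac : forall b : R, 0 < b -> abs_continuous 0 b f.

Let F x := f (Num.max 0 x).

Let F_clip b x : 0 < b -> x < b -> F x = f (clip b x).
Proof. by move=> b0 xb; rewrite /F /clip (min_idPl _)// ltW. Qed.

Lemma ac_continuous : continuous F.
Proof.
move=> x; pose b := Num.max 0 x + 1.
have xb : x < b by rewrite /b ltr_pwDr// le_max lexx orbT.
have b0 : 0 < b by rewrite /b ltr_pwDr// le_max lexx.
have := ac_list_continuous (abs_continuous_clip b0 (f_ac b0)) (x := x).
rewrite /continuous_at -(F_clip b0 xb) => H.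
apply: cvg_trans H; apply: near_eq_cvg; near=> y; rewrite (@F_clip b)//.
by near: y; exact: lt_nbhsl.
Unshelve. all: by end_near. Qed.

(** The upper Dini derivative is measurable and equals the derivative wherever
    the latter exists, so that one density serves all bounded intervals. *)
Let dini n x := ((n.+1%:R * (F (x + n.+1%:R^-1) - F x))%:E : \bar R).
Let h x := fine (limn_esup (dini ^~ x)).

Let measurable_h : measurable_fun [set: R] h.
Proof.
apply: (measurableT_comp (@fine_measurable R _ _)) => //.
apply: measurable_fun_limn_esup => n; apply/measurable_EFinP.
apply: measurable_funM; first exact: measurable_cst.
apply: measurable_funB.
- apply: continuous_measurable_fun => x; apply: continuous_comp; last exact: ac_continuous.
  by apply: cvgD; [exact: cvg_id | exact: cvg_cst].
- apply: continuous_measurable_fun; exact: ac_continuous.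
Qed.

Let h_derive x : 0 < x -> derivable f x 1 -> h x = derive1 f x.
Proof.
move=> x0 /cvg_ex[l fl].
have -> : derive1 f x = l by rewrite derive1E; apply/cvg_lim.
pose u n : R := n.+1%:R^-1.
have u0 : u @ \oo --> (0 : R).
  by have := @cvg_harmonic R.
have ul : (u n)^-1 *: (f (u n *: 1 + x) - f x) @[n --> \oo] --> l.
  by apply: ((cvgr_dnbhsP _ _ _).1 fl); split => // n; rewrite /u invr_neq0.
have dl : dini ^~ x @ \oo --> l%:E.
  apply: cvg_EFin; first by near=> n.
  apply: cvg_trans ul; apply: near_eq_cvg; near=> n.
  rewrite /dini /= /u invrK /F !(max_idPr _) ?(ltW x0)//; last by rewrite addr_ge0// ltW.
  by rewrite -[_ *: _]/(_ * _) -[(_ *: 1)]/(_ * 1) mulr1 [x + _]addrC.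
rewrite /h limn_esup_lim.
by have /cvg_lim -> := cvg_esups dl.
Unshelve. all: by end_near. Qed.

(** Lebesgue differentiation of the indefinite integral of the density. *)
Let ac_local b : 0 < b -> exists g, mu.-integrable setT (EFin \o g) /\
  (forall x, 0 <= x <= b -> f x - f 0 = \int[mu]_(t in `]0, x]) g t) /\
  {ae mu, forall t, `[0, b]%classic t -> derive1 f t = g t /\ h t = g t}.
Proof.
move=> b0; have b10 : 0 < b + 1 by rewrite addr_gt0.
have [g [ig gE]] := ac_list_density b10 (abs_continuous_clip b10 (f_ac b10)).
have {}gE x : 0 <= x <= b + 1 -> f x - f 0 = \int[mu]_(t in `]0, x]) g t.
  by move=> xb; rewrite -gE// !clip_id// lexx ltW.
exists g; split=> //; split.
  by move=> x /andP[x0 xb]; apply: gE; rewrite x0 (le_trans xb)// lerDl.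
have ftc := @FTC1 R g (BRight 0) _ (locally_integrableT ig).
have ftc' := ftc (fun y => ltac:(by apply: integrableS ig)).
move: (ae_neq 0) ftc'; apply: (@filterS2 _ _ (ae_filter_ringOfSetsType mu)) => x x0 H.
rewrite /= in_itv/= => /andP[x0' xb].
have {x0'}x0 : 0 < x by rewrite lt_neqAle eq_sym x0.
have br : (BRight (0 : R) < BRight (x : R))%O by rewrite bnd_simp.
have [d1 d2] := H br.
pose Phi y := f 0 + \int[mu]_(t in `]0, y]) g t.
have near_f : {near x, Phi =1 f}.
  near=> y; rewrite /Phi -gE ?subrKC//; apply/andP; split.
    by rewrite ltW//; near: y; exact: lt_nbhsr.
  by rewrite ltW//; near: y; apply: lt_nbhsl; rewrite (le_lt_trans xb)// ltrDl.
have dPhi : is_derive x (1 : R) Phi (g x).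
  have := is_derive1D (is_derive_cst (f 0) x (1 : R)) (DeriveDef d1 (esym (derive1E _ _))).
  by rewrite d2 add0r.
have fx : is_derive x (1 : R) f (g x).
  by apply: near_eq_is_derive dPhi => //; rewrite oner_neq0.
have df : derivable f x 1 by apply: ex_derive.
have E : derive1 f x = g x by rewrite derive1E; exact: derive_val.
by rewrite h_derive// E.
Unshelve. all: by end_near. Qed.

Lemma ac_primitive : exists h : R -> R, [/\ locint h,
  forall x, 0 <= x -> f x = f 0 + primitive h x &
  forall T, {ae mu, forall t, `[0, T]%classic t -> derive1 f t = h t}].
Proof.
have key b : 0 < b -> mu.-integrable `[0, b]%classic (EFin \o h) /\
    f b = f 0 + primitive h b /\
    {ae mu, forall t, `[0, b]%classic t -> derive1 f t = h t}.
  move=> b0; have [g [ig [gE gae]]] := ac_local b0.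
  have [] := @integrable_ae_eq R `[0, b]%classic h g (measurable_itv _).
  - exact: measurable_funTS measurable_h.
  - by apply: integrableS ig.
  - by move: gae; apply: (@filterS _ _ (ae_filter_ringOfSetsType mu)) => x H /H[].
  move=> ih hg; split => //; split; last first.
    by move: gae; apply: (@filterS _ _ (ae_filter_ringOfSetsType mu)) => x H /H[-> ->].
  rewrite /primitive hg -Rintegral_itv_obnd_cbnd; last by apply: integrableS ig.
  by rewrite -gE ?subrKC// lexx ltW.
exists h; split.
- move=> T; have [T0|T0] := ltP 0 T; first exact: (key _ T0).1.
  have [i _] := key 1 ltr01; apply: integrableS i => // x /=.
  by rewrite !in_itv/= => /andP[-> xT]; rewrite (le_trans xT)// (le_trans T0).
- move=> x; rewrite le_eqVlt => /predU1P[<-|x0]; last exact: (key _ x0).2.1.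
  by rewrite /primitive set_itv1 Rintegral_set1 addr0.
- move=> T; have [T0|T0] := ltP 0 T; first exact: (key _ T0).2.2.
  have [_ [_ i]] := key 1 ltr01; move: i.
  apply: (@filterS _ _ (ae_filter_ringOfSetsType mu)) => x H xT; apply: H.
  move: xT; rewrite /= !in_itv/= => /andP[-> xT].
  by rewrite (le_trans xT)// (le_trans T0).
Qed.

Lemma ac_right_limit : f x @[x --> 0^'+] --> f 0.
Proof.
have F0 : F 0 = f 0 by rewrite /F maxxx.
have H : F x @[x --> 0^'+] --> F 0 by apply: cvg_at_right_filter; exact: ac_continuous.
rewrite -F0; apply: cvg_trans H; apply: near_eq_cvg; near=> x.
by rewrite /F (max_idPr _).
Unshelve. all: by end_near. Qed.

End AC.
End FTC.

(** * Primitives and improper Laplace integrals *)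

Lemma shift_algebra (K : fieldType) (s a b i x y : K) : s != 0 -> i * i = -1 ->
  0 = y + - a * (s^-1 * y) + - b * (s^-1 * x) ->
  x + - a * (s^-1 * x) + b * (s^-1 * y) = (s - (a + i * b)) / s * (x + i * y).
Proof.
move=> s0 ii E; rewrite -[LHS]addr0 -(mulr0 i) [in X in _ + i * X]E.
have -> : (s - (a + i * b)) / s * (x + i * y) = x + i * y - (a * x + a * (i * y)
  + i * b * x + (i * i) * b * y) / s by field.
by rewrite ii; field.
Qed.

Section ComplexSplit.
Context {R : realType}.
Implicit Types (x y a b : R) (z : R[i]).

Lemma cplx_split z : z = (complex.Re z)%:C + (0 +i* 1) * (complex.Im z)%:C.
Proof. by case: z => p q; apply: cplx_eq; rewrite !ReImE /=; ring. Qed.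

Lemma cplx_ii : (0 +i* 1) * (0 +i* 1) = -1 :> R[i].
Proof. by apply: cplx_eq; rewrite !ReImE /=; ring. Qed.

Lemma real_combination (x y t a b : R) :
  x%:C + - a%:C * y%:C + b%:C * t%:C = (x - (a * y - b * t))%:C :> R[i].
Proof. by apply: cplx_eq; rewrite !ReImE /=; ring. Qed.

End ComplexSplit.

Section LaplacePrimitive.
Context {R : realType}.
Local Notation mu := (@lebesgue_measure R).
Local Notation P := (`[0, +oo[%classic : set R).
Implicit Types (f g h : R -> R) (s u z : R[i]).

Lemma kGamma11 : kGamma 1 1 = 1 :> R.
Proof.
have := integral_exponential_pdf (@ltr01 R).
have -> : (\int[mu]_x (exponential_pdf 1 x)%:E)%E =
    (\int[mu]_(t in P) (expR (- (t `^ 1 / 1)%R) * t `^ (1 - 1)%R)%:E)%E.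
  rewrite [RHS]integral_mkcond; apply: eq_integral => t _.
  rewrite /exponential_pdf !patchE; case: ifPn => //; rewrite inE/= in_itv/= andbT => t0.
  by rewrite subrr powRr0 mulr1 divr1 powRr1// mul1r mulN1r.
by rewrite /kGamma /Rintegral => ->.
Qed.

Lemma gpow11 t : gpow 1 1 t = 1 :> R.
Proof. by rewrite /gpow subrr powRr0 !mul1r kGamma11 invr1. Qed.

(** The constant 1 is the power function of exponent 0. *)
Lemma lap_one s : 0 < complex.Re s -> lapI (fun=> 1%:C) s /\ lap (fun=> 1%:C) s = s^-1.
Proof.
move=> s0; have E : (fun t : R => (gpow 1 1 t)%:C) = (fun=> 1%:C).
  by apply/funext => t; rewrite gpow11.
rewrite -E; split; first exact: lapI_gpow.
by rewrite lap_gpow// mul1r rmorphN powCN powC1.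
Qed.

Lemma exp_integral (sigma : R) : 0 < sigma ->
  mu.-integrable P (fun t => (expR (- (sigma * t)))%:E) /\
  \int[mu]_(t in P) expR (- (sigma * t)) = sigma^-1.
Proof.
move=> s0; have E t : expR (- (sigma * t)) = expR (- (sigma * t)) * gpow 1 1 t.
  by rewrite gpow11 mulr1.
split.
  have := integrable_exp_gpow (k := 1) (b := 1) ltr01 ltr01 s0.
  by apply: eq_integrable => // t _; rewrite -E.
rewrite /Rintegral; under eq_integral do rewrite E.
by rewrite integral_exp_gpow//= mul1r powRN powRr1// ltW.
Qed.

Lemma lap_primitive g s : 0 < complex.Re s -> lapI (fun t => (g t)%:C) s ->
  lapI (fun t => (primitive g t)%:C) s /\
  lap (fun t => (primitive g t)%:C) s = s^-1 * lap (fun t => (g t)%:C) s.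
Proof.
move=> s0 ig; have [i1 <-] := lap_one s0.
have E : (fun t => (primitive g t)%:C) = (fun t => (causal_conv (cst 1) g t)%:C).
  by apply/funext => t; rewrite primitiveE.
by rewrite E; exact: lap_conv.
Qed.

Lemma lapI_locint g s : lapI (fun t => (g t)%:C) s -> locint g.
Proof.
move=> ig T; have [mg _] := lapI_measurable ig.
have := integrable_normC (measurable_itv _) ig => iN.
have iN' : mu.-integrable `[0, T]%classic (fun t => (normC (expC (- (s * t%:C)) * (g t)%:C))%:E).
  apply: integrableS iN => // t /=; rewrite !in_itv/= => /andP[-> _]//.
have mT : @measurable _ (measurableTypeR R) `[0, T]%classic by exact: measurable_itv.
have := integrableZl mT (expR (`|complex.Re s| * T)) iN'.
apply: le_integrable => //.
  apply/measurable_EFinP; apply: measurable_funS mg => // t /=.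
  by rewrite !in_itv/= => /andP[-> _].
move=> t tD; have /andP[t0 tT] : 0 <= t <= T by move: tD; rewrite /= in_itv.
rewrite lee_fin [leRHS]ger0_norm; last by rewrite mulr_ge0 ?expR_ge0 ?normC_ge0.
rewrite normCM normC_kernel normC_real mulrA ler_peMl// -expRD -[leLHS]expR0 ler_expR.
rewrite subr_ge0 (@le_trans _ _ (`|complex.Re s| * t))//.
  by rewrite ler_wpM2r// ler_norm.
by rewrite ler_wpM2l.
Qed.

Lemma measurable_fun_halfline g : (forall T : R, measurable_fun `[0, T]%classic g) ->
  measurable_fun P g.
Proof.
move=> mg; have -> : P = \bigcup_n `[0, n%:R]%classic.
  apply/seteqP; split => t /=; last by move=> [n _] /=; rewrite !in_itv/= => /andP[->].
  rewrite in_itv/= andbT => t0; exists (Num.trunc t).+1 => //=.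
  by rewrite in_itv/= t0 ltW// truncnS_gt.
by apply/measurable_fun_bigcup.
Qed.

Lemma locint_measurableP g : locint g -> measurable_fun P g.
Proof.
move=> lg; apply: measurable_fun_halfline => T; exact: locint_measurable.
Qed.

Variable u : R[i].
Let a := complex.Re u.
Let b := complex.Im u.
Let c t : R := complex.Re (expC (u * t%:C)).
Let d t : R := complex.Im (expC (u * t%:C)).

Let expC_cd t : expC (u * t%:C) = c t +i* d t.
Proof. exact: cplx_eq. Qed.

Let expC_derive t : is_deriveC t (fun t => expC (u * t%:C)) (u * expC (u * t%:C)).
Proof.
have H := is_deriveC_exp (is_deriveC_linear 0 u t).
have E x : 0 + x%:C * u = u * x%:C by rewrite add0r mulrC.
by rewrite E in H; apply: is_deriveC_ext H => x; rewrite E.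
Qed.

Let v t := a * c t - b * d t.
Let w t := a * d t + b * c t.

Let dc t : is_derive t (1 : R) c (v t).
Proof. by have [H _] := expC_derive t; rewrite cReM in H. Qed.

Let dd t : is_derive t (1 : R) d (w t).
Proof. by have [_ H] := expC_derive t; rewrite cImM in H. Qed.

Let continuous_is_derive (f f' : R -> R) : (forall t, is_derive t (1 : R) f (f' t)) ->
  continuous f.
Proof.
move=> H t; apply: differentiable_continuous; apply/derivable1_diffP.
by have [] := H t.
Qed.

Let cc : continuous c. Proof. exact: continuous_is_derive dc. Qed.
Let cd : continuous d. Proof. exact: continuous_is_derive dd. Qed.

Lemma locint_continuous g : continuous g -> locint g.
Proof.
move=> cg T; apply: continuous_compact_integrable; first exact: segment_compact.
exact: continuous_subspaceT.
Qed.

Lemma primitive_derive f f' t : (forall x, is_derive x (1 : R) f (f' x)) ->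
  continuous f' -> 0 <= t -> primitive f' t = f t - f 0.
Proof.
move=> df cf'; rewrite le_eqVlt => /predU1P[<-|t0].
  by rewrite /primitive set_itv1 Rintegral_set1 subrr.
rewrite /primitive /Rintegral (@continuous_FTC2 _ f' f 0 t t0)//.
- exact: continuous_subspaceT.
- have cf := continuous_is_derive df.
  split; [by move=> x _; have [] := df x | |].
  + by apply: cvg_at_right_filter; exact: cf.
  + by apply: cvg_at_left_filter; exact: cf.
- by move=> x _; rewrite derive1E; have [_] := df x.
Qed.

Let cv : continuous v.
Proof. by move=> t; apply: cvgB; apply: cvgM; (exact: cvg_cst || exact: cc || exact: cd). Qed.

Let cw : continuous w.
Proof. by move=> t; apply: cvgD; apply: cvgM; (exact: cvg_cst || exact: cc || exact: cd). Qed.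

Let c0 : c 0 = 1. Proof. by rewrite /c mulr0 expC0. Qed.
Let d0 : d 0 = 0. Proof. by rewrite /d mulr0 expC0. Qed.

Let c_bound t x : 0 <= x <= t -> `|c (t - x)| <= expR (`|a| * t) /\
  `|d (t - x)| <= expR (`|a| * t).
Proof.
move=> /andP[x0 xt].
have h : normC (expC (u * (t - x)%:C)) <= expR (`|a| * t).
  rewrite normC_expC ler_expR cReM /= mulr0 subr0 -/a.
  rewrite (@le_trans _ _ (`|a| * (t - x)))//; first by rewrite ler_wpM2r ?subr_ge0// ler_norm.
  by rewrite ler_wpM2l// gerBl.
by split; apply: le_trans h; [exact: normr_Re | exact: normr_Im].
Qed.

Variable g : R -> R.
Hypothesis lg : locint g.

Let integrable_cont_mul (k : R -> R) t M : continuous k ->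
  (forall x, 0 <= x <= t -> `|k (t - x)| <= M) ->
  mu.-integrable `[0, t]%classic (fun x => (k (t - x) * g x)%:E).
Proof.
move=> ck kM; have [t0|t0] := ltP t 0.
  by rewrite set_itv_ge ?bnd_simp -?ltNge//; exact: integrable_set0.
have M0 : 0 <= M by rewrite (le_trans _ (kM 0 _))// lexx.
have mt : @measurable _ (measurableTypeR R) `[0, t]%classic by exact: measurable_itv.
apply: le_integrable (integrableZl mt M (lg t)) => //.
  apply/measurable_EFinP; apply: measurable_funM; last exact: locint_measurable.
  apply: measurable_funTS; apply: continuous_measurable_fun => x.
  by apply: continuous_comp; [apply: cvgB; [exact: cvg_cst | exact: cvg_id] | exact: ck].
move=> x; rewrite /= in_itv/= => xt; rewrite lee_fin !normrM ler_wpM2r//.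
by rewrite (le_trans (kM x xt))// ler_norm.
Qed.

Let Qr := causal_conv c g.
Let Qi := causal_conv d g.

Let lQr : locint Qr.
Proof. by apply: locint_causal_conv => //; exact: locint_continuous cc. Qed.
Let lQi : locint Qi.
Proof. by apply: locint_causal_conv => //; exact: locint_continuous cd. Qed.

Let causal_convB (k1 k2 : R -> R) (t M1 M2 : R) : continuous k1 -> continuous k2 ->
  (forall x, 0 <= x <= t -> `|k1 (t - x)| <= M1) ->
  (forall x, 0 <= x <= t -> `|k2 (t - x)| <= M2) ->
  forall p q : R, causal_conv (fun x => p * k1 x + q * k2 x) g t =
  p * causal_conv k1 g t + q * causal_conv k2 g t.
Proof.
move=> ck1 ck2 b1 b2 p q; rewrite /causal_conv.
have mt : @measurable _ (measurableTypeR R) `[0, t]%classic by exact: measurable_itv.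
have i1 := integrable_cont_mul ck1 b1; have i2 := integrable_cont_mul ck2 b2.
rewrite -(RintegralZl p mt i1) -(RintegralZl q mt i2) -RintegralD//.
- by apply: eq_Rintegral => x _; ring.
- by apply: eq_integrable (integrableZl mt p i1).
- by apply: eq_integrable (integrableZl mt q i2).
Qed.

Let primitive_lin (f1 f2 : R -> R) (p q t : R) : locint f1 -> locint f2 ->
  primitive (fun x => p * f1 x + q * f2 x) t = p * primitive f1 t + q * primitive f2 t.
Proof.
move=> l1 l2; rewrite /primitive.
have mt : @measurable _ (measurableTypeR R) `[0, t]%classic by exact: measurable_itv.
rewrite -(RintegralZl p mt (l1 t)) -(RintegralZl q mt (l2 t)) -RintegralD//.
- by apply: eq_integrable (integrableZl mt p (l1 t)).
- by apply: eq_integrable (integrableZl mt q (l2 t)).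
Qed.

Let eq_causal_conv k1 k2 t : (forall x, 0 <= x <= t -> k1 x = k2 x) ->
  causal_conv k1 g t = causal_conv k2 g t.
Proof.
move=> E; apply: eq_Rintegral => x; rewrite inE/= in_itv/= => /andP[x0 xt].
by rewrite E// subr_ge0 xt gerBl.
Qed.

Let eq_primitive f1 f2 t : (forall x, 0 <= x <= t -> f1 x = f2 x) ->
  primitive f1 t = primitive f2 t.
Proof. by move=> E; apply: eq_Rintegral => x; rewrite inE/= in_itv/=; exact: E. Qed.

(** [QrE] and [QiE] are the two components of [primitive g = q - u * primitive q]
    for [q = Qr +i* Qi], the convolution of [exp (u * t)] with g. It comes from the
    same identity with 1 and [exp (u * t)] in place of [primitive g] and q. *)
Let QrE t : 0 <= t -> primitive g t = Qr t - (a * primitive Qr t - b * primitive Qi t).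
Proof.
move=> t0.
have ccst : continuous (cst 1 : R -> R) by exact: cst_continuous.
have b1 x : 0 <= x <= t -> `|(cst 1 : R -> R) (t - x)| <= 1 by rewrite normr1.
have bc x (h : 0 <= x <= t) := (c_bound h).1.
have E1 : causal_conv (primitive v) g t = 1 * Qr t + (-1) * primitive g t.
  rewrite primitiveE -(causal_convB cc ccst bc b1).
  apply: eq_causal_conv => x /andP[x0 _].
  by rewrite (primitive_derive dc cv x0) c0 /=; ring.
have E2 : primitive (causal_conv v g) t = a * primitive Qr t + (- b) * primitive Qi t.
  rewrite -primitive_lin//; apply: eq_primitive => x _; rewrite /Qr /Qi.
  have bc' y (h : 0 <= y <= x) := (c_bound h).1.
  have bd' y (h : 0 <= y <= x) := (c_bound h).2.
  rewrite -(causal_convB cc cd bc' bd'); congr (causal_conv _ g x).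
  by apply/funext => y; rewrite /v mulNr.
have := primitive_causal_conv t (locint_continuous cv) lg.
by rewrite E1 E2 mulN1r mulNr mul1r => ->; rewrite opprB addrC subrK.
Qed.

Let QiE t : 0 <= t -> 0 = Qi t - (a * primitive Qi t + b * primitive Qr t).
Proof.
move=> t0.
have E1 : causal_conv (primitive w) g t = Qi t.
  apply: eq_causal_conv => x /andP[x0 _].
  by rewrite (primitive_derive dd cw x0) d0 subr0.
have E2 : primitive (causal_conv w g) t = a * primitive Qi t + b * primitive Qr t.
  rewrite -primitive_lin//; apply: eq_primitive => x _; rewrite /Qr /Qi.
  have bc' y (h : 0 <= y <= x) := (c_bound h).1.
  have bd' y (h : 0 <= y <= x) := (c_bound h).2.
  by rewrite -(causal_convB cd cc bd' bc').
have := primitive_causal_conv t (locint_continuous cw) lg.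
by rewrite E1 E2 => ->; rewrite subrr.
Qed.

Let H t := laplace_partial g u t.

Lemma integrableC_laplace_kernel T : integrableC `[0, T]%classic
  (fun t => expC (- (u * t%:C)) * (g t)%:C).
Proof.
have mt : @measurable _ (measurableTypeR R) `[0, T]%classic by exact: measurable_itv.
have iG := integrableZl mt (expR (`|a| * T)) (integrable_abse (lg T)).
apply: (@integrableC_le _ _ mt _ (fun t => expR (`|a| * T) * `|g t|)) => //.
  apply: measurableCM; first exact: measurableC_kernel.
  by apply: measurableC_real; exact: locint_measurable.
move=> t tD; have /andP[t0 tT] : 0 <= t <= T by move: tD; rewrite /= in_itv.
rewrite normCM normC_kernel normC_real ler_wpM2r// ler_expR -/a.
rewrite -mulNr (le_trans (ler_wpM2r t0 (ler_norm _)))// normrN.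
by rewrite ler_wpM2l.
Qed.

Lemma measurableC_laplace_partial : measurableC P (laplace_partial g u).
Proof.
split.
- rewrite (_ : (fun t => _) = primitive (fun t => complex.Re (expC (- (u * t%:C)) * (g t)%:C)))//.
  by apply: locint_measurableP; apply: locint_primitive => T; have [] := integrableC_laplace_kernel T.
- rewrite (_ : (fun t => _) = primitive (fun t => complex.Im (expC (- (u * t%:C)) * (g t)%:C)))//.
  by apply: locint_measurableP; apply: locint_primitive => T; have [] := integrableC_laplace_kernel T.
Qed.

Let expH t : expC (u * t%:C) * H t = Qr t +i* Qi t.
Proof.
have mt : @measurable _ (measurableTypeR R) `[0, t]%classic by exact: measurable_itv.
rewrite /H /laplace_partial -(integralCZ mt _ (integrableC_laplace_kernel t)).
have E x : expC (u * t%:C) * (expC (- (u * x%:C)) * (g x)%:C) =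
    (c (t - x) * g x) +i* (d (t - x) * g x).
  rewrite mulrA -expCD -mulrBr -rmorphB expC_cd.
  by apply: cplx_eq; rewrite !ReImE /= !mulr0 ?subr0 ?add0r.
by apply: cplx_eq; apply: eq_Rintegral => x _; rewrite E.
Qed.

Variable B : R.
Hypothesis HB : forall t, 0 <= t -> normC (laplace_partial g u t) <= B.

(** The improper integral of g may converge only conditionally, but q, the
    product of [exp (u * t)] with the bounded partial integrals, is of
    exponential order, and [primitive g = q - u * primitive q]. So the
    primitive has an absolutely convergent Laplace integral, expressed by that
    of the partial integrals. Components are treated separately because the
    convolutions are of real functions. *)
Lemma lap_primitive_improper s : 0 < complex.Re s -> complex.Re u < complex.Re s ->
  lapI (fun t => (primitive g t)%:C) s /\
  lap (fun t => (primitive g t)%:C) s = (s - u) / s * lap (laplace_partial g u) (s - u).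
Proof.
move=> s0 us; have su0 : 0 < complex.Re s - a by rewrite subr_gt0.
have [e1 _] := exp_integral su0.
have mP : @measurable _ (measurableTypeR R) P by exact: measurable_itv.
have iB := integrableZl mP B e1.
have bQ t : 0 <= t -> normC (Qr t +i* Qi t) <= B * expR (a * t).
  move=> t0; rewrite -expH normCM normC_expC cReM /= mulr0 subr0 mulrC.
  by rewrite ler_wpM2r ?expR_ge0// HB.
have lapI_Q (Q : R -> R) : locint Q -> (forall t, 0 <= t -> `|Q t| <= B * expR (a * t)) ->
    lapI (fun t => (Q t)%:C) s.
  move=> lQ Qb; apply: (lapI_le (G := fun t => B * expR (a * t)) (sigma := complex.Re s)) => //.
  - by apply: measurableC_real; exact: locint_measurableP.
  - apply: eq_integrable iB => // t _; rewrite /= -EFinM mulrCA -expRD.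
    by congr (_ * expR _)%:E; rewrite /a; ring.
  - by move=> t t0; rewrite normC_real Qb.
have ir : lapI (fun t => (Qr t)%:C) s.
  by apply: lapI_Q => // t t0; exact: le_trans (normr_Re _) (bQ t t0).
have ii : lapI (fun t => (Qi t)%:C) s.
  by apply: lapI_Q => // t t0; exact: le_trans (normr_Im _) (bQ t t0).
have [jr Er] := lap_primitive s0 ir; have [ji Ei] := lap_primitive s0 ii.
pose iC : R[i] := 0 +i* 1.
have LH : lap (laplace_partial g u) (s - u) =
    lap (fun t => (Qr t)%:C) s + iC * lap (fun t => (Qi t)%:C) s.
  rewrite -(lapZ iC ii) -lapD//; last exact: lapIZ.
  apply: eq_integralC => t _.
  have -> : - ((s - u) * t%:C) = - (s * t%:C) + u * t%:C by rewrite mulrBl opprB addrC.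
  have -> : expC (- (s * t%:C) + u * t%:C) * laplace_partial g u t =
      expC (- (s * t%:C)) * (expC (u * t%:C) * H t) by rewrite expCD mulrA.
  by rewrite (expH t) (cplx_split (Qr t +i* Qi t)).
have F1 t : 0 <= t -> (Qr t)%:C + - a%:C * (primitive Qr t)%:C + b%:C * (primitive Qi t)%:C
    = (primitive g t)%:C.
  by move=> t0; rewrite real_combination -QrE.
have F2 t : 0 <= t -> (Qi t)%:C + - a%:C * (primitive Qi t)%:C + (- b)%:C * (primitive Qr t)%:C
    = 0.
  by move=> t0; rewrite real_combination mulNr opprK -QiE.
have z1 := lapIZ (- a%:C) jr; have z2 := lapIZ b%:C ji.
have z3 := lapIZ (- a%:C) ji; have z4 := lapIZ (- b)%:C jr.
have i1 := lapID ir z1; have i2 := lapID ii z3.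
split; first exact: eq_lapI F1 (lapID i1 z2).
have L1 : lap (fun t => (primitive g t)%:C) s = lap (fun t => (Qr t)%:C) s +
    - a%:C * (s^-1 * lap (fun t => (Qr t)%:C) s) + b%:C * (s^-1 * lap (fun t => (Qi t)%:C) s).
  rewrite -Er -Ei -(lapZ (- a%:C) jr) -(lapZ b%:C ji) -(lapD ir z1) -(lapD i1 z2).
  by apply: eq_lap => t /F1.
have L2 : 0 = lap (fun t => (Qi t)%:C) s +
    - a%:C * (s^-1 * lap (fun t => (Qi t)%:C) s) + (- b)%:C * (s^-1 * lap (fun t => (Qr t)%:C) s).
  rewrite -Er -Ei -(lapZ (- a%:C) ji) -(lapZ (- b)%:C jr) -(lapD ii z3) -(lapD i2 z4).
  rewrite (eq_lap (h := fun=> 0 * 1%:C)) => [|t /F2 ->]; last by rewrite mul0r.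
  by have [j1 _] := lap_one s0; rewrite (lapZ 0 j1) mul0r.
have sn0 : s != 0 by exact: right_neq0.
have uE : u = a%:C + iC * b%:C by exact: cplx_split.
have ii1 : iC * iC = -1 by exact: cplx_ii.
rewrite rmorphN in L2.
by rewrite L1 LH [in RHS]uE; apply: shift_algebra.
Qed.

End LaplacePrimitive.

(** * Integrals and null sets *)

Section NullSets.
Import HBNNSimple.
Context {R : realType}.
Local Notation mu := (@lebesgue_measure R).

(** The integral is built from simple functions below the integrand, so that
    it does not see null sets even when the integrand is not measurable. *)
Lemma ge0_le_integral_ae (D : set R) (f g : R -> \bar R) :
  (forall t, 0 <= f t)%E -> (forall t, 0 <= g t)%E ->
  {ae mu, forall t, D t -> f t = g t} ->
  (\int[mu]_(t in D) f t <= \int[mu]_(t in D) g t)%E.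
Proof.
move=> f0 g0 [N [mN N0 fgN]].
rewrite [leLHS]ge0_integralE// [leRHS]ge0_integralE//.
have mN' : @measurable _ (measurableTypeR R) (~` N).
  by rewrite -setTD; exact: measurableD.
apply: ge_ereal_sup => _ [h /= hf <-]; apply: ereal_sup_ubound => /=.
exists (proj_nnsfun h mN') => /=.
  move=> t; rewrite mindicE; have [tN|tN] := boolP (t \in ~` N); last first.
    by rewrite mulr0 /patch; case: ifP.
  rewrite mulr1 (le_trans (hf t))// /patch; case: ifPn => // tD.
  have [->//|ne] := pselect (f t = g t).
  exfalso; move: tN; rewrite inE /=; apply; apply: fgN => /= H; apply: ne; apply: H.
  by rewrite inE in tD.
rewrite -[LHS]integralT_nnsfun -[RHS]integralT_nnsfun; apply: ge0_ae_eq_integral => //.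
- by apply/measurable_EFinP; exact: measurable_funPT.
- by apply/measurable_EFinP; exact: measurable_funPT.
- by move=> t _; rewrite lee_fin fun_ge0.
- by move=> t _; rewrite lee_fin fun_ge0.
- exists N; split => // t /= H; apply: contrapT => tN; apply: H => _.
  by rewrite /= mindicE mem_set//= mulr1.
Qed.

Lemma Rintegral_ae (D : set R) (f g : R -> R) :
  {ae mu, forall t, D t -> f t = g t} ->
  \int[mu]_(t in D) f t = \int[mu]_(t in D) g t.
Proof.
move=> fg; rewrite /Rintegral; congr fine.
rewrite [LHS]integralE [RHS]integralE.
have key (F G : R -> \bar R) : {ae mu, forall t, D t -> f t = g t} ->
   (forall t, 0 <= F t)%E -> (forall t, 0 <= G t)%E ->
   (forall t, f t = g t -> F t = G t) ->
   (\int[mu]_(t in D) F t = \int[mu]_(t in D) G t)%E.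
  move=> h F0 G0 FG; apply/eqP; rewrite eq_le; apply/andP; split;
    apply: ge0_le_integral_ae => //; move: h;
    apply: (@filterS _ _ (ae_filter_ringOfSetsType mu)) => t H Dt.
  - by apply: FG; exact: H.
  - by apply/esym/FG; exact: H.
congr (_ - _)%E; apply: key => //.
- by move=> t fgt; rewrite !funeposE fgt.
- by move=> t fgt; rewrite !funenegE fgt.
Qed.

End NullSets.

(** * Prabhakar operators *)

Section Operators.
Context {R : realType}.
Local Notation mu := (@lebesgue_measure R).
Implicit Types (k alpha m omega gam t sigma : R) (f g h : R -> R) (s : R[i]).

(** What the identity and the Prabhakar integrals share; the symbol M is the
    factor by which the operator acts on Laplace integrals. *)
Record good_op (A : (R -> R) -> R -> R) sigma (M : R[i] -> R[i]) : Prop := GoodOp {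
  op_ext : forall g h, (forall t, 0 <= t -> g t = h t) ->
    forall t, 0 <= t -> A g t = A h t;
  op_locint : forall g, locint g -> locint (A g);
  op_primitive : forall g t, locint g -> 0 <= t ->
    primitive (A g) t = A (primitive g) t;
  op_lap : forall g s, sigma <= complex.Re s -> lapI (fun t => (g t)%:C) s ->
    lapI (fun t => (A g t)%:C) s /\
    lap (fun t => (A g t)%:C) s = M s * lap (fun t => (g t)%:C) s }.

Definition kPrabhakar_symbol k alpha m omega gam s : R[i] :=
  powC (k%:C * s) (- (m / k))%:C *
  powC (1 - (omega * k)%:C * powC (k%:C * s) (- (alpha / k))%:C) (- (gam / k))%:C.

Lemma kPrabhakarE k alpha m omega gam f t : 0 < m ->
  kPrabhakar k alpha m omega gam f t =
  causal_conv (kPrabhakar_kernel k alpha m omega gam) f t.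
Proof. by move=> m0; rewrite /kPrabhakar gt_eqF. Qed.

Lemma good_kPrabhakar k alpha m omega gam : 0 < k -> 0 < alpha ->
  0 < m \/ (m = 0 /\ gam = 0) ->
  exists2 sigma, 0 < sigma & good_op (kPrabhakar k alpha m omega gam) sigma
    (kPrabhakar_symbol k alpha m omega gam).
Proof.
move=> k0 al0 [m0|[-> ->]]; last first.
  have E f : kPrabhakar k alpha 0 omega 0 f = f by apply/funext => t; rewrite /kPrabhakar eqxx.
  exists 1 => //; split => //.
  - by move=> g h gh t t0; rewrite !E gh.
  - by move=> g; rewrite E.
  - by move=> g t; rewrite !E.
  - move=> g s _; rewrite E => ig; split=> //.
    by rewrite /kPrabhakar_symbol !mul0r oppr0 !powC0 !mul1r.
have [sigma s0 H] := lap_kPrabhakar_kernel omega gam k0 al0 m0.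
exists sigma => //; set K := kPrabhakar_kernel k alpha m omega gam.
have E f : kPrabhakar k alpha m omega gam f = causal_conv K f.
  by apply/funext => t; exact: kPrabhakarE.
have [iK _] := H sigma%:C (lexx _).
have lK : locint K by exact: lapI_locint iK.
split.
- move=> g h gh t t0; rewrite !E; apply: eq_Rintegral => x.
  by rewrite inE/= in_itv/= => /andP[x0 _]; rewrite gh.
- by move=> g lg; rewrite E; exact: locint_causal_conv.
- by move=> g t lg t0; rewrite !E; exact: primitive_causal_convr.
- move=> g s ss ig; rewrite E; have [i1 E1] := H s ss.
  by rewrite /kPrabhakar_symbol -E1; exact: lap_conv.
Qed.

Lemma kPrabhakar_ae k alpha m omega gam f h t : 0 < m ->
  (forall T, {ae mu, forall x, `[0, T]%classic x -> f x = h x}) ->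
  kPrabhakar k alpha m omega gam f t = kPrabhakar k alpha m omega gam h t.
Proof.
move=> m0 fh; rewrite !kPrabhakarE//; apply: Rintegral_ae.
move: (fh t); apply: (@filterS _ _ (ae_filter_ringOfSetsType mu)) => x H xt.
by rewrite H.
Qed.

End Operators.

(** * Abel's theorem along a ray *)

Section Abel.
Context {R : realType}.
Local Notation mu := (@lebesgue_measure R).
Local Notation P := (`[0, +oo[%classic : set R).
Implicit Types (H : R -> R[i]) (L u : R[i]).

Lemma cvgC_eps (h : nat -> R[i]) L :
  (forall e : R, 0 < e -> \forall n \near \oo, normC (h n - L) <= e) -> cvgC \oo h L.
Proof.
move=> hL; split; apply/cvgrPdist_le => e /hL; apply: filterS => n; apply: le_trans.
- by rewrite distrC -cReN -cReD; exact: normr_Re.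
- by rewrite distrC -cImN -cImD; exact: normr_Im.
Qed.

Lemma cvgC_pinfty H L e : cvgC +oo H L -> 0 < e ->
  exists2 T, 0 < T & forall t, T <= t -> normC (H t - L) <= e.
Proof.
move=> [hr hi] e0; have e20 : 0 < e / 2 by lra.
move/cvgrPdist_le : hr => /(_ _ e20)[T1 [_ P1]].
move/cvgrPdist_le : hi => /(_ _ e20)[T2 [_ P2]].
exists (Num.max 1 (Num.max T1 T2 + 1)); first by rewrite lt_max ltr01.
move=> t; rewrite ge_max => /andP[_ tT].
have h1 : T1 <= Num.max T1 T2 by rewrite le_max lexx.
have h2 : T2 <= Num.max T1 T2 by rewrite le_max lexx orbT.
have t1 : T1 < t by lra.
have t2 : T2 < t by lra.
rewrite (le_trans (normC_le_ReIm _))// (splitr e) lerD//.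
- by rewrite cReD cReN distrC P1.
- by rewrite cImD cImN distrC P2.
Qed.

Lemma lapI_bounded H B s : measurableC P H -> (forall t, 0 <= t -> normC (H t) <= B) ->
  0 < complex.Re s -> lapI H s.
Proof.
move=> mH HB s0; have mP : @measurable _ (measurableTypeR R) P by exact: measurable_itv.
have [e1 _] := exp_integral s0.
apply: (lapI_le mH (lexx (complex.Re s)) _ HB).
by apply: eq_integrable (integrableZl mP B e1) => // t _; rewrite /= -EFinM mulrC.
Qed.

(** Before T the bound B is weighted by exp (1 - t / T) >= 1, so that both
    contributions are explicit exponential integrals. *)
Lemma lap_remainder H B T e s : measurableC P H -> 0 < T -> 0 <= B -> 0 <= e ->
  (forall t, 0 <= t -> normC (H t) <= B) -> (forall t, T <= t -> normC (H t) <= e) ->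
  0 < complex.Re s ->
  normC (lap H s) <= 2 * (e / complex.Re s + B * expR 1 * T).
Proof.
move=> mH T0 B0 e0 HB He s0.
have mP : @measurable _ (measurableTypeR R) P by exact: measurable_itv.
have [i1 E1] := exp_integral s0.
have T'0 : 0 < T^-1 by rewrite invr_gt0.
have [i2 E2] := exp_integral T'0; rewrite invrK in E2.
have j1 := integrableZl mP e i1; have j2 := integrableZl mP (B * expR 1) i2.
rewrite -E1 -[in X in _ * (_ + _ * X)]E2 -RintegralZl// -RintegralZl// -RintegralD//.
apply: (@normC_integralC _ _ mP).
- by apply: measurableCM => //; exact: measurableC_kernel.
- by have := integrableD mP j1 j2; apply: eq_integrable.
move=> t tP; have t0 : 0 <= t by move: tP; rewrite /= in_itv/= andbT.
rewrite normCM normC_kernel; have [tT|Tt] := leP t T.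
- rewrite -[leLHS]add0r lerD ?mulr_ge0 ?expR_ge0// -mulrA -expRD mulrC.
  apply: ler_pM; rewrite ?normC_ge0 ?expR_ge0 ?HB// ler_expR.
  rewrite (@le_trans _ _ 0)//; first by rewrite oppr_le0 mulr_ge0// ltW.
  by rewrite subr_ge0 ler_pdivrMl// mulr1.
- rewrite -[leLHS]addr0 lerD ?mulr_ge0 ?expR_ge0// mulrC ler_wpM2r ?expR_ge0//.
  by rewrite He// ltW.
Qed.

(** With p the n-th point of the ray, the part of the integral where H is
    close to L stays small because the ratio of the modulus of p to its real
    part is constant; the remaining part is of order p. *)
Lemma lap_abel H B L u : measurableC P H -> 0 < complex.Re u ->
  (forall t, 0 <= t -> normC (H t) <= B) -> cvgC +oo H L ->
  cvgC \oo (fun n : nat => ((n.+1%:R^-1 : R)%:C * u) * lap H ((n.+1%:R^-1 : R)%:C * u)) L.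
Proof.
move=> mH u0 HB HL; apply: cvgC_eps => e e0.
have nu0 : 0 < normC u by rewrite normC_gt0 right_neq0.
have B0 : 0 <= B by rewrite (le_trans _ (HB 0 _))// normC_ge0.
set a := complex.Re u in u0.
pose e' := e * a / (4 * normC u).
have e'0 : 0 < e' by rewrite /e' divr_gt0 ?mulr_gt0.
have [T T0 HT] := cvgC_pinfty HL e'0.
pose C := B + normC L.
have C0 : 0 <= C by rewrite addr_ge0// normC_ge0.
pose K := 2 * normC u * (C * expR 1 * T).
have K0 : 0 <= K by rewrite !mulr_ge0 ?expR_ge0// ltW.
have cd : (fun n : nat => (n.+1%:R^-1 : R) * K) @ \oo --> (0 : R).
  by rewrite -[X in _ --> X](mul0r K); apply: cvgMl; exact: cvg_harmonic.
have e20 : 0 < e / 2 by lra.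
move/cvgrPdist_le : cd => /(_ _ e20); apply: filterS => n.
set d : R := n.+1%:R^-1; have d0 : 0 < d by rewrite invr_gt0.
rewrite sub0r normrN (ger0_norm (mulr_ge0 (ltW d0) K0)) => dK.
set p := d%:C * u; have p0 : 0 < complex.Re p by rewrite cReM /= mul0r subr0 mulr_gt0.
pose r t := H t + (- L) * 1%:C.
have iH := lapI_bounded mH HB p0.
have [i1 E1] := lap_one p0.
have Er : lap r p = lap H p - L * p^-1.
  by rewrite (lapD iH (lapIZ (- L) i1)) (lapZ _ i1) E1 mulNr.
have pn0 : p != 0 by exact: right_neq0.
have -> : p * lap H p - L = p * lap r p.
  by rewrite Er mulrBr mulrCA mulfV// mulr1.
have mr : measurableC P r.
  by apply: measurableCD => //; exact: measurableC_cst.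
have rC t : 0 <= t -> normC (r t) <= C.
  by move=> t0; rewrite (le_trans (normC_le1 _ _))// mulr1 normCN lerD// HB.
have re t : T <= t -> normC (r t) <= e' by move=> /HT; rewrite /r mulr1.
have := lap_remainder mr T0 C0 (ltW e'0) rC re p0.
rewrite normCM; have np : normC p = d * normC u by rewrite normCM normC_real ger0_norm// ltW.
have Rp : complex.Re p = d * a by rewrite cReM /= mul0r subr0.
rewrite np Rp => le1.
have dn0 : 0 <= d * normC u by rewrite mulr_ge0// ltW.
apply: (le_trans (ler_wpM2l dn0 le1)).
have -> : d * normC u * (2 * (e' / (d * a) + C * expR 1 * T)) = e / 2 + d * K.
  by rewrite /e' /K; field; rewrite !gt_eqF.
by rewrite [leRHS](splitr e) lerD2l.
Qed.

Lemma laplace_partial_bounded (f : R -> R) u : laplace_exists f u ->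
  cvgC +oo (laplace_partial f u) (laplace f u) /\
  exists B, forall t, 0 <= t -> normC (laplace_partial f u t) <= B.
Proof.
move=> [lf cr ci]; have HL : cvgC +oo (laplace_partial f u) (laplace f u).
  by split; [exact: cr | exact: ci].
split => //; have [T T0 HT] := cvgC_pinfty HL ltr01.
pose F t := expC (- (u * t%:C)) * (f t)%:C.
have iF (t : R) : mu.-integrable `[0, t]%classic (fun x => (normC (F x))%:E).
  apply: integrable_normC; first exact: measurable_itv.
  exact: integrableC_laplace_kernel.
pose N := 2 * \int[mu]_(x in `[0, T]) normC (F x).
have N0 : 0 <= N by rewrite mulr_ge0// Rintegral_ge0// => x _; exact: normC_ge0.
exists (N + (1 + normC (laplace f u))) => t t0; have [tT|Tt] := leP t T; last first.
  rewrite -[leLHS]add0r lerD// -[laplace_partial f u t](subrK (laplace f u)).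
  by rewrite (le_trans (normC_le1 _ _))// lerD2r HT// ltW.
rewrite -[leLHS]addr0 lerD ?addr_ge0 ?normC_ge0//.
have mt : @measurable _ (measurableTypeR R) `[0, t]%classic by exact: measurable_itv.
have ic := integrableC_laplace_kernel u lf t.
have h : normC (integralC `[0, t]%classic F) <= 2 * \int[mu]_(x in `[0, t]) normC (F x).
  apply: (normC_integralC mt); first exact: integrableC_measurable ic.
    exact: iF.
  by [].
apply: (le_trans h).
rewrite /N ler_pM2l// /Rintegral fine_le//.
- exact: integrable_fin_num (iF t).
- exact: integrable_fin_num (iF T).
apply: ge0_subset_integral => //.
- exact: measurable_int (iF T).
- by move=> x _; rewrite lee_fin normC_ge0.
- move=> x /=; rewrite !in_itv/= => /andP[-> xt]; exact: le_trans tT.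
Qed.

End Abel.

(** * The transform identity and the symbol *)

Section AnalyticComplex.
Context {R : realType}.
Implicit Types (g h : R -> R[i]).

Definition analyticC g (y r : R) :=
  analytic_at (fun x => complex.Re (g x)) y r /\ analytic_at (fun x => complex.Im (g x)) y r.

Lemma analyticC_cst (z : R[i]) y r : analyticC (fun=> z) y r.
Proof. by split; exact: analytic_at_cst. Qed.

Lemma analyticCM g h y r : analyticC g y r -> analyticC h y r ->
  analyticC (fun x => g x * h x) y r.
Proof.
move=> [g1 g2] [h1 h2]; split.
- under eq_fun do rewrite cReM; apply: analytic_atB; exact: analytic_atM.
- under eq_fun do rewrite cImM; apply: analytic_atD; exact: analytic_atM.
Qed.

Lemma analyticCB g h y r : analyticC g y r -> analyticC h y r ->
  analyticC (fun x => g x - h x) y r.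
Proof.
move=> [g1 g2] [h1 h2]; split.
- by under eq_fun do rewrite cReD cReN; exact: analytic_atB.
- by under eq_fun do rewrite cImD cImN; exact: analytic_atB.
Qed.

Lemma analyticC_real (p q : R) y r : analyticC (fun x => (p * x + q)%:C) y r.
Proof. by split; [exact: analytic_at_affine | exact: analytic_at_cst]. Qed.

End AnalyticComplex.

Lemma cancel_squares (K : fieldType) (s p x y f0 k m1 m2 : K) : s != 0 ->
  s^-1 * (p / s * x) = k * (m1 * (m2 * (p / s * y + - f0 * (s^-1 * s^-1)))) ->
  p * x = k * (m1 * m2) * (s * (p * y) - f0).
Proof.
move=> s0 H; have -> : p * x = s * s * (s^-1 * (p / s * x)) by field.
by rewrite H; field.
Qed.

Section TransformIdentity.
Context {R : realType}.
Local Notation mu := (@lebesgue_measure R).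
Variables (A1 A2 : (R -> R) -> R -> R) (sigma1 sigma2 : R) (M1 M2 : R[i] -> R[i]).
Hypotheses (good1 : good_op A1 sigma1 M1) (good2 : good_op A2 sigma2 M2).
Variables (k f0 : R) (f h D : R -> R) (u : R[i]).
Hypotheses (lf : locint f) (lh : locint h) (lD : locint D).
Hypothesis fE : forall t, 0 <= t -> f t = f0 + primitive h t.
Hypothesis DE : forall t, 0 <= t -> D t = k * A1 (A2 h) t.

Let eq_primitive (f1 f2 : R -> R) (t : R) : (forall x, 0 <= x -> f1 x = f2 x) ->
  primitive f1 t = primitive f2 t.
Proof.
by move=> E; apply: eq_Rintegral => x; rewrite inE/= in_itv/= => /andP[x0 _]; exact: E.
Qed.

Let primitive_ops (E g : R -> R) : locint g ->
  (forall t, 0 <= t -> E t = k * A1 (A2 g) t) ->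
  forall t, 0 <= t -> primitive E t = k * A1 (A2 (primitive g)) t.
Proof.
move=> lg Eg t t0; rewrite (eq_primitive t Eg).
have l2 := op_locint good2 lg; have l1 := op_locint good1 l2.
have mt : @measurable _ (measurableTypeR R) `[0, t]%classic by exact: measurable_itv.
rewrite [LHS](RintegralZl k mt (l1 t)) -/(primitive _ _) (op_primitive good1 l2 t0).
by congr (k * _); apply: (op_ext good1) => // x x0; exact: (op_primitive good2).
Qed.

Variables (Bf BD : R).
Hypothesis bf : forall t, 0 <= t -> normC (laplace_partial f u t) <= Bf.
Hypothesis bD : forall t, 0 <= t -> normC (laplace_partial D u t) <= BD.

(** The Laplace integrals of f and D need not converge absolutely at s, but
    those of primitives do. Primitives commute with the operators, so that a
    second primitive turns the definition of D into a relation between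
    [primitive (primitive D)] and [primitive f - f0 * t], to which the
    convolution theorem applies. *)
Lemma transform_identity s : 0 < complex.Re s -> complex.Re u < complex.Re s ->
  sigma1 <= complex.Re s -> sigma2 <= complex.Re s ->
  (s - u) * lap (laplace_partial D u) (s - u) =
  k%:C * (M1 s * M2 s) *
    (s * ((s - u) * lap (laplace_partial f u) (s - u)) - f0%:C).
Proof.
move=> s0 us s1 s2.
have [iF EF] := lap_primitive_improper lf bf s0 us.
have [iD ED] := lap_primitive_improper lD bD s0 us.
have [iDD EDD] := lap_primitive s0 iD.
have [i1 E1] := lap_one s0; have [i2 E2] := lap_primitive (g := cst 1) s0 i1.
pose phi := primitive (primitive h).
have phiE t : 0 <= t -> (primitive f t)%:C + (- f0%:C) * (primitive (cst 1) t)%:C = (phi t)%:C.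
  move=> t0; rewrite /phi.
  have mt : @measurable _ (measurableTypeR R) `[0, t]%classic by exact: measurable_itv.
  have -> : primitive (primitive h) t = primitive (fun x => f x - f0 * 1) t.
    by apply: eq_primitive => x x0; rewrite fE// mulr1 addrAC subrr add0r.
  have i3 := integrableZl mt f0 (@locint_cst R 1 t).
  rewrite [in RHS]/primitive (RintegralB mt (lf t) i3) (RintegralZl f0 mt (@locint_cst R 1 t)).
  by rewrite rmorphB rmorphM mulNr.
have z1 := lapIZ (- f0%:C) i2.
have iphi : lapI (fun t => (phi t)%:C) s by exact: eq_lapI phiE (lapID iF z1).
have Ephi : lap (fun t => (phi t)%:C) s =
    lap (fun t => (primitive f t)%:C) s + - f0%:C * (s^-1 * s^-1).
  have E3 : lap (fun t => (primitive (cst 1) t)%:C) s = s^-1 * s^-1.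
    by rewrite E2; congr (_ * _); exact: E1.
  rewrite -E3 -(lapZ (- f0%:C) i2) -(lapD iF z1).
  by apply: eq_lap => t /phiE.
have PD := primitive_ops (locint_primitive lh) (primitive_ops lh DE).
have [j2 J2] := op_lap good2 s2 iphi; have [j1 J1] := op_lap good1 s1 j2.
have E4 : lap (fun t => (primitive (primitive D) t)%:C) s =
    k%:C * lap (fun t => (A1 (A2 phi) t)%:C) s.
  by rewrite -(lapZ k%:C j1); apply: eq_lap => t t0; rewrite PD// rmorphM.
rewrite EDD ED J1 J2 Ephi EF in E4.
exact: cancel_squares (right_neq0 s0) E4.
Qed.

End TransformIdentity.

Section Symbol.
Context {R : realType}.
Local Notation mu := (@lebesgue_measure R).
Local Notation P := (`[0, +oo[%classic : set R).
Implicit Types (k alpha m omega gam : R) (u s z : R[i]).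

Lemma kPrabhakar_symbolM k alpha m1 m2 omega g1 g2 s :
  kPrabhakar_symbol k alpha m1 omega g1 s * kPrabhakar_symbol k alpha m2 omega g2 s =
  kPrabhakar_symbol k alpha (m1 + m2) omega (g1 + g2) s.
Proof.
have E (x y : R) : (- (x / k))%:C + (- (y / k))%:C = (- ((x + y) / k))%:C :> R[i].
  by rewrite -rmorphD -opprD -mulrDl.
by rewrite /kPrabhakar_symbol mulrACA -powCD -powCD !E.
Qed.

Lemma kPrabhakar_symbol_ray k alpha m omega gam (y : R) u :
  0 < k -> 0 < y -> 0 < complex.Re u ->
  kPrabhakar_symbol k alpha m omega gam (y%:C * u) =
  (y `^ (- (m / k)))%:C * powC (k%:C * u) (- (m / k))%:C *
  powC (1 - omega%:C * k%:C * powC (k%:C * u) (- (alpha / k))%:C * (y `^ (- (alpha / k)))%:C)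
    (- (gam / k))%:C.
Proof.
move=> k0 y0 u0; have ku0 : 0 < complex.Re (k%:C * u) by rewrite cReM /= mul0r subr0 mulr_gt0.
have E : k%:C * (y%:C * u) = y%:C * (k%:C * u) by rewrite mulrCA.
rewrite /kPrabhakar_symbol E (powC_posM (- (m / k)) y0 ku0) (powC_posM (- (alpha / k)) y0 ku0).
have okE : (omega * k)%:C = omega%:C * k%:C :> R[i] by rewrite -rmorphM.
by rewrite okE (mulrC (y `^ (- (alpha / k)))%:C) mulrA.
Qed.

(** The symbol along the ray is a real Laplace transform, hence analytic in y;
    as the modulus of z is strictly less than 1 the series kernel still
    converges slightly to the left of y = 1. *)
Lemma symbol_laplace k alpha m gam z : 0 < k -> 0 < alpha -> 0 < m -> normC z < 1 ->
  exists (kappa : R -> R[i]) (sigma : R), 0 < sigma < 1 /\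
  forall y : R, sigma <= y -> lapI kappa y%:C /\
    lap kappa y%:C = (k `^ (- (m / k)))%:C * (y `^ (- (m / k)))%:C *
      powC (1 - z * (y `^ (- (alpha / k)))%:C) (- (gam / k))%:C.
Proof.
move=> k0 al0 m0 z1; set a := alpha / k; set b := m / k.
have a0 : 0 < a by exact: divr_gt0.
have b0 : 0 < b by exact: divr_gt0.
pose w := z * (k `^ a)%:C.
have z0 := normC_ge0 z.
pose x := (normC z + 1) / 2.
have x0 : 0 < x by rewrite /x; lra.
have x1 : x < 1 by rewrite /x; lra.
pose sigma := x `^ a^-1.
have s0 : 0 < sigma by rewrite powR_gt0.
have s1 : sigma < 1.
  rewrite /sigma -[ltRHS](_ : 1 `^ a^-1 = 1); last by rewrite powR1.
  by rewrite gt0_ltr_powR ?invr_gt0 ?nnegrE// ltW.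
have kk : (k `^ a) * (k `^ (- a)) = 1 by rewrite powRN mulfV// gt_eqF// powR_gt0.
have w1 : normC w * (k * sigma) `^ (- a) < 1.
  rewrite normCM normC_real ger0_norm ?powR_ge0// powRM ?ltW// -mulrA (mulrA (k `^ a)) kk mul1r.
  rewrite powRN /sigma -powRrM mulVf ?gt_eqF// powRr1 ?(ltW x0)//.
  by rewrite ltr_pdivrMr// mul1r /x; lra.
have kP (t : R) : exists l, 0 < t -> cvgS (prab_term k a b (gam / k) w t) l.
  have [t0|t0] := ltP 0 t; last by exists 0.
  by have [l lP] := prab_is_cvg (gam / k) k0 a0 b0 s0 w1 t0; exists l.
have [kappa kapP] := choice kP.
exists kappa, sigma; rewrite s0 s1; split=> // y sy.
have y0 : 0 < y by exact: lt_le_trans sy.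
have [I ->] := lap_prab k0 a0 b0 s0 w1 kapP (s := y%:C) sy.
have ky : k%:C * y%:C = (k * y)%:C :> R[i] by rewrite -rmorphM.
have ky0 : 0 < k * y by exact: mulr_gt0.
have e1 : w * ((k * y) `^ (- a))%:C = z * (y `^ (- a))%:C.
  rewrite /w (powRM (- a) (ltW k0) (ltW y0)) -mulrA -rmorphM.
  by rewrite (mulrA (k `^ a)) kk mul1r.
have e2 : ((k * y) `^ (- b))%:C = (k `^ (- b))%:C * (y `^ (- b))%:C :> R[i].
  by rewrite (powRM (- b) (ltW k0) (ltW y0)) -rmorphM.
by split=> //; rewrite ky (powC_pos (- b) ky0) (powC_pos (- a) ky0) e1 e2.
Qed.

End Symbol.

(** * Continuation along the ray *)

Section Ray.
Context {R : realType}.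
Local Notation mu := (@lebesgue_measure R).
Local Notation P := (`[0, +oo[%classic : set R).
Implicit Types (H : R -> R[i]) (u : R[i]).

Lemma integrable_exp_normC H (sigma : R) : lapI H sigma%:C ->
  mu.-integrable P (fun t => (expR (- (sigma * t)) * normC (H t))%:E).
Proof.
move=> iH; have := integrable_normC (measurable_itv _) iH.
by apply: eq_integrable => // t _; rewrite normCM normC_kernel.
Qed.

Lemma ray_analytic H B u (y c : R) : measurableC P H ->
  (forall t, 0 <= t -> normC (H t) <= B) -> 0 < complex.Re u -> 1 < y ->
  0 < c -> c * normC u < complex.Re u ->
  analyticC (fun x => lap H (x%:C * u - u)) y (c * (y - 1)).
Proof.
move=> mH HB u0 y1 c0 cu; apply: lap_analytic => //.
- by rewrite mulr_gt0// subr_gt0.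
- exact: right_neq0.
apply: integrable_exp_normC; apply: lapI_bounded HB _ => //=.
rewrite !ReImE /= mul0r subr0.
have -> : y * complex.Re u - complex.Re u - c * (y - 1) * normC u =
  (y - 1) * (complex.Re u - c * normC u) by ring.
by rewrite mulr_gt0// subr_gt0.
Qed.

Lemma real_laplace_analytic (kappa : R -> R[i]) (sigma y r : R) : 0 < r ->
  sigma <= y - r -> lapI kappa sigma%:C ->
  analyticC (fun x => lap kappa x%:C) y r.
Proof.
move=> r0 sr ik.
have E x : x%:C = x%:C * 1 + 0 :> R[i] by rewrite mulr1 addr0.
have ik' : lapI kappa (y - r)%:C by apply: lapI_mono ik.
rewrite /analyticC; under eq_fun do rewrite E.
under [X in _ /\ analytic_at X _ _]eq_fun do rewrite E.
apply: lap_analytic => //.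
  exact: lapI_measurable ik.
have n1 : normC 1 = 1 :> R by exact: normC1.
by rewrite -E n1 mulr1; exact: integrable_exp_normC.
Qed.

Lemma analyticC_linear u (y r : R) : analyticC (fun x => x%:C * u) y r.
Proof.
apply: analyticCM (analyticC_cst u y r).
by have := analyticC_real 1 0 y r; under eq_fun do rewrite mul1r addr0.
Qed.

Lemma analyticC_cvg (g : R -> R[i]) (y r : R) (x : nat -> R) : 0 < r -> analyticC g y r ->
  x @ \oo --> y -> cvgC \oo (fun n => g (x n)) (g y).
Proof.
move=> r0 [g1 g2] xy; split.
- exact: cvg_comp xy (analytic_at_continuous r0 g1).
- exact: cvg_comp xy (analytic_at_continuous r0 g2).
Qed.

Lemma analyticC_continuation (g : R -> R[i]) (c Y : R) : 0 < c <= 1 ->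
  (forall y, 1 < y -> analyticC g y (c * (y - 1))) ->
  (forall y, Y <= y -> g y = 0) -> forall y, 1 < y -> g y = 0.
Proof.
move=> cP an gY y y1; apply: cplx_eq.
- apply: (@analytic_continuation _ (fun x => complex.Re (g x)) c Y cP) => // x.
    by move=> /an[].
  by move=> /gY ->.
- apply: (@analytic_continuation _ (fun x => complex.Im (g x)) c Y cP) => // x.
    by move=> /an[].
  by move=> /gY ->.
Qed.

End Ray.

Lemma cancel_factor (K : comPzRingType) (x ki kk y w : K) : ki * kk = 1 ->
  x * ki * (kk * y * w) = y * x * w.
Proof.
move=> e; have -> : x * ki * (kk * y * w) = (ki * kk) * (y * x * w) by ring.
by rewrite e mul1r.
Qed.

Lemma combine_powers (K : comPzRingType) (k x w u l f0 y : K) : y = k * u * x ->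
  k * (x * w) * (u * l - f0) = y * w * l - k * x * w * f0.
Proof. by move=> ->; ring. Qed.

Section RegularizedDerivative.
Context {R : realType}.
Local Notation mu := (@lebesgue_measure R).

(** Since m < k, at least one of the two operators is an integral, which
    ignores the null set where the derivative of f differs from h. *)
Lemma regularized_ae (k alpha m nu omega gam : R) (f h : R -> R) sigma M :
  0 < k -> 0 <= nu -> nu <= 1 -> m < k ->
  good_op (kPrabhakar k alpha (nu * (k - m)) omega (- gam * nu)) sigma M ->
  (forall T, {ae mu, forall t, `[0, T]%classic t -> derive1 f t = h t}) ->
  forall t, 0 <= t -> regularized_kHilferPrabhakar k alpha m nu omega gam f t =
  k * kPrabhakar k alpha (nu * (k - m)) omega (- gam * nu)
    (kPrabhakar k alpha ((1 - nu) * (k - m)) omega (- gam * (1 - nu)) h) t.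
Proof.
move=> k0 nu0 nu1 mk good fh t t0; rewrite /regularized_kHilferPrabhakar; apply: (congr1 ( *%R k)).
have km : 0 < k - m by rewrite subr_gt0.
have [nu1'|nuE] := ltP nu 1.
  apply: (op_ext good) => // x x0; apply: kPrabhakar_ae => //.
  by rewrite mulr_gt0// subr_gt0.
have {nuE nu1 nu0}-> : nu = 1 by apply/eqP; rewrite eq_le nu1.
have E g : kPrabhakar k alpha ((1 - 1) * (k - m)) omega (- gam * (1 - 1)) g = g.
  by apply/funext => x; rewrite /kPrabhakar subrr mul0r mulr0 eqxx.
by rewrite !E; apply: kPrabhakar_ae => //; rewrite mul1r.
Qed.

End RegularizedDerivative.

Theorem lemma3p4 (R : realType) (k alpha gam omega mu nu : R) (f : R -> R)
    (u : R[i])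
    (k_gt0 : 0 < k) (alpha_gt0 : 0 < alpha)
    (mu_gt0 : 0 < mu) (mu_lt1 : mu < 1) (mu_ltk : mu < k)
    (nu_ge0 : 0 <= nu) (nu_le1 : nu <= 1)
    (f_ac : forall b : R, 0 < b -> abs_continuous 0 b f)
    (u_gt0 : 0 < complex.Re u)
    (f_laplace : laplace_exists f u)
    (Df_laplace : laplace_exists
       (regularized_kHilferPrabhakar k alpha mu nu omega gam f) u)
    (u_conv : `|omega%:C * k%:C * powC (k%:C * u) (- (alpha / k))%:C| < 1) :
  laplace (regularized_kHilferPrabhakar k alpha mu nu omega gam f) u =
    powC (k%:C * u) (mu / k)%:C
      * powC (1 - omega%:C * k%:C * powC (k%:C * u) (- (alpha / k))%:C)
          (gam / k)%:C
      * laplace f u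
    - k%:C * powC (k%:C * u) (- ((k - mu) / k))%:C
      * powC (1 - omega%:C * k%:C * powC (k%:C * u) (- (alpha / k))%:C)
          (gam / k)%:C
      * (lim (f x @[x --> 0^'+]))%:C.
Proof.
have -> : lim (f x @[x --> 0^'+]) = f 0.
  by apply: cvg_lim => //; exact: ac_right_limit.
set D := regularized_kHilferPrabhakar k alpha mu nu omega gam f in Df_laplace *.
set z := omega%:C * k%:C * _ in u_conv *.
have z1 : normC z < 1 by move: u_conv; rewrite ltcE => /andP[_]; rewrite Re_norm.
have [h [lh fE fh]] := ac_primitive f_ac.
have km : 0 < k - mu by rewrite subr_gt0.
set m1 := nu * (k - mu); set g1 := - gam * nu.
set m2 := (1 - nu) * (k - mu); set g2 := - gam * (1 - nu).
have c1 : 0 < m1 \/ (m1 = 0 /\ g1 = 0).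
  have [n0|n0] := eqVneq nu 0; first by right; rewrite /m1 /g1 n0 mul0r mulr0.
  by left; rewrite mulr_gt0// lt_neqAle eq_sym n0.
have c2 : 0 < m2 \/ (m2 = 0 /\ g2 = 0).
  have [nu1|n1] := eqVneq nu 1; first by right; rewrite /m2 /g2 nu1 subrr mul0r mulr0.
  by left; rewrite mulr_gt0// subr_gt0 lt_neqAle n1.
have [s1 s10 good1] := good_kPrabhakar omega k_gt0 alpha_gt0 c1.
have [s2 s20 good2] := good_kPrabhakar omega k_gt0 alpha_gt0 c2.
have DE := regularized_ae k_gt0 nu_ge0 nu_le1 mu_ltk good1 fh.
have [Hf [Bf bf]] := laplace_partial_bounded f_laplace.
have [HD [BD bD]] := laplace_partial_bounded Df_laplace.
have [lf _ _] := f_laplace; have [lD _ _] := Df_laplace.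
have [kappa [sigma [/andP[sg0 sg1] kapP]]] :=
  symbol_laplace (- gam) k_gt0 alpha_gt0 km z1.
set a := complex.Re u in u_gt0.
have nu0 : 0 < normC u by rewrite normC_gt0 right_neq0.
have ku0 : 0 < complex.Re (k%:C * u) by rewrite cReM /= mul0r subr0 mulr_gt0.
pose b := (k - mu) / k.
pose W y := powC (1 - z * (y `^ (- (alpha / k)))%:C) (- (- gam / k))%:C.
(* M is the symbol of the composed operator at y * u, written as a multiple of
   a real Laplace transform. *)
pose M y := k%:C * (powC (k%:C * u) (- b)%:C * ((k `^ (- b))^-1)%:C * lap kappa y%:C).
have kb : (k `^ (- b))^-1%:C * (k `^ (- b))%:C = 1 :> R[i].
  by rewrite -rmorphM mulVf// gt_eqF// powR_gt0.
have ME y : sigma <= y -> 0 < y ->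
    M y = k%:C * kPrabhakar_symbol k alpha (k - mu) omega (- gam) (y%:C * u).
  move=> sy y0; have [_ E] := kapP y sy.
  rewrite /M E (kPrabhakar_symbol_ray _ _ _ _ k_gt0 y0 u_gt0) -/z -/b.
  by rewrite (cancel_factor _ _ _ kb).
pose p (y : R) := y%:C * u - u.
have pE y : p y = (y - 1)%:C * u by rewrite /p rmorphB mulrBl mul1r.
pose F y := p y * lap (laplace_partial D u) (p y)
  - M y * (y%:C * u * (p y * lap (laplace_partial f u) (p y)) - (f 0)%:C).
(* Beyond Y the point y * u lies in the half-planes where both symbols are
   known. *)
pose Y := 2 + s1 / a + s2 / a.
have q1 : 0 < s1 / a by exact: divr_gt0.
have q2 : 0 < s2 / a by exact: divr_gt0.
have FY y : Y <= y -> F y = 0.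
  rewrite /Y => Yy; have y1 : 1 < y by lra.
  have y0 : 0 < y by lra.
  have Rs : complex.Re (y%:C * u) = y * a by rewrite cReM /= mul0r subr0.
  have Rs0 : 0 < complex.Re (y%:C * u) by rewrite Rs mulr_gt0.
  have Rus : complex.Re u < complex.Re (y%:C * u) by rewrite Rs -/a ltr_pMl.
  have Rs1 : s1 <= complex.Re (y%:C * u) by rewrite Rs -ler_pdivrMr//; lra.
  have Rs2 : s2 <= complex.Re (y%:C * u) by rewrite Rs -ler_pdivrMr//; lra.
  have T := transform_identity good1 good2 lf lh lD fE DE bf bD Rs0 Rus Rs1 Rs2.
  have sy : sigma <= y by lra.
  have m12 : m1 + m2 = k - mu by rewrite /m1 /m2; ring.
  have g12 : g1 + g2 = - gam by rewrite /g1 /g2; ring.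
  rewrite kPrabhakar_symbolM m12 g12 -(ME y sy y0) in T.
  rewrite /F /p; apply/eqP; rewrite subr_eq0; apply/eqP; exact: T.
(* The Laplace integrals of bounded functions converge in the right
   half-plane, which contains the disc of radius c * (y - 1) * normC u about
   (y - 1) * u. *)
pose c := a / (2 * normC u).
have au : a <= normC u by exact: Re_le_normC.
have cP : 0 < c <= 1.
  by rewrite divr_gt0 ?mulr_gt0//= ler_pdivrMr ?mulr_gt0//; lra.
have cu : c * normC u < a.
  by rewrite /c invfM mulrA mulfVK ?gt_eqF//; lra.
have [_ c1'] := andP cP; have [c0 _] := andP cP.
have [ik _] := kapP sigma (lexx _).
have Man y r : 0 < r -> sigma <= y - r -> analyticC M y r.
  move=> r0 sr; apply: analyticCM; first exact: analyticC_cst.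
  apply: analyticCM; first exact: analyticC_cst.
  exact: real_laplace_analytic r0 sr ik.
have pan y r : analyticC p y r.
  by apply: analyticCB; [exact: analyticC_linear | exact: analyticC_cst].
have mD := measurableC_laplace_partial u lD.
have mf := measurableC_laplace_partial u lf.
have Fan y : 1 < y -> analyticC F y (c * (y - 1)).
  move=> y1; have r0 : 0 < c * (y - 1) by rewrite mulr_gt0// subr_gt0.
  have sr : sigma <= y - c * (y - 1).
    have : c * (y - 1) <= 1 * (y - 1) by rewrite ler_wpM2r// subr_ge0 ltW.
    lra.
  have anD := ray_analytic mD bD u_gt0 y1 c0 cu.
  have anf := ray_analytic mf bf u_gt0 y1 c0 cu.
  apply: analyticCB; first exact: analyticCM (pan _ _) anD.
  apply: analyticCM; first exact: Man r0 sr.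
  apply: analyticCB; last exact: analyticC_cst.
  apply: analyticCM; first exact: analyticC_linear.
  exact: analyticCM (pan _ _) anf.
have F0 := analyticC_continuation cP Fan FY.
(* The identity F = 0 holds for y > 1; let y decrease to 1. *)
pose yn (n : nat) : R := 1 + n.+1%:R^-1.
have yn1 n : 1 < yn n by rewrite /yn ltrDl invr_gt0.
have yn_cvg : yn @ \oo --> (1 : R).
  rewrite -[X in _ --> X]addr0; apply: cvgD; first exact: cvg_cst.
  exact: cvg_harmonic.
have pn n : p (yn n) = (n.+1%:R^-1 : R)%:C * u.
  by rewrite pE /yn addrAC subrr add0r.
have Mcvg : cvgC \oo (fun n => M (yn n)) (M 1).
  have r0 : 0 < 1 - sigma by lra.
  have sr : sigma <= 1 - (1 - sigma) by lra.
  exact: analyticC_cvg r0 (Man 1 _ r0 sr) yn_cvg.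
have ucvg : cvgC \oo (fun n => (yn n)%:C * u) u.
  rewrite -[X in cvgC _ _ X]mul1r.
  exact: analyticC_cvg ltr01 (analyticC_linear u 1 1) yn_cvg.
have lim1 : laplace D u = M 1 * (u * laplace f u - (f 0)%:C).
  have LD := lap_abel mD u_gt0 bD HD.
  have Lf := lap_abel mf u_gt0 bf Hf.
  apply: cvgC_unique LD _.
  apply: (eq_cvgC (f := fun n => M (yn n) * ((yn n)%:C * u *
      ((n.+1%:R^-1 : R)%:C * u * lap (laplace_partial f u) ((n.+1%:R^-1 : R)%:C * u))
      + - (f 0)%:C))).
    apply/funext => n; have E := F0 _ (yn1 n); rewrite /F pn in E.
    exact: esym (subr0_eq E).
  apply: cvgCM => //; apply: cvgCD; last exact: cvgC_cst.
  exact: cvgCM.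
rewrite lim1.
have kz : powC (k%:C * u) (mu / k)%:C = k%:C * u * powC (k%:C * u) (- b)%:C.
  have -> : (mu / k)%:C = 1 + (- b)%:C :> R[i].
    rewrite -[1]/(1%:C) -rmorphD /b; congr (_%:C); field.
    by rewrite gt_eqF.
  by rewrite powCD powC1.
rewrite (ME 1 (ltW sg1) ltr01) (kPrabhakar_symbol_ray _ _ _ _ k_gt0 ltr01 u_gt0) -/z -/b.
rewrite !powR1 mul1r mulr1 mulNr opprK.
exact: combine_powers kz.
Qed.
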